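(* Let $M\in\mathbb{N}$, $\mathcal{Z}\in\mathbb{Z}_M$, $w\in\mathcal{W}^*(\mathcal{Z})$, $r,\nu_0\in\mathbb{N}$, $\nu_0\ge r$, $\vartheta>0$, $f\in\mathbb{L}_\infty^w$ and $B>0$. Then there exists $N\in\mathbb{N}$ depending only on $r$, $\vartheta$, $w$ and $\mathcal{Z}$ such that for every $n\ge N$ there is a polynomial $P_n\in\Pi_n$ satisfying $$\|w(f-P_n)\|\le c\,\omega_\varphi^r(f,1,B,\vartheta/n)_w$$ and $$\|w\varphi^\nu P_n^{(\nu)}\|\le c\,n^\nu\,\omega_\varphi^r(f,1,B,\vartheta/n)_w,\qquad r\le\nu\le\nu_0,$$ where the constants $c$ depend only on $r$, $\nu_0$, $B$, $\vartheta$, $w$ and $\mathcal{Z}$.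
   Context: Functions $f$ are real-valued measurable functions on $[-1,1]$. $\|g\|_I:=\operatorname{ess\,sup}_{u\in I}|g(u)|$, $\|g\|:=\|g\|_{[-1,1]}$. $\Pi_n$ is the space of algebraic polynomials of degree at most $n-1$. $\mathbb{L}_\infty^w:=\{f:[-1,1]\to\mathbb{R} : \|wf\|<\infty\}$. $E_r(f,I)_w:=\inf_{q\in\Pi_r}\|w(f-q)\|_I$. $\varphi(x):=\sqrt{1-x^2}$, $\rho(h,x):=h\varphi(x)+h^2$. $A^*$ weights: a nonnegative integrable function $w$ on $[-1,1]$ is an $A^*$ weight if there is a constant $L^*$ such that $w(x)\le \frac{L^*}{|I|}\int_I w$ for all intervals $I\subset[-1,1]$ and all $x\in I$. $\mathbb{Z}_M$ is the set of all $M$-tuples $\mathcal{Z}=(z_j)_{j=1}^M$ with $-1\le z_1<\dots<z_M\le 1$. $\mathcal{W}^*(\mathcal{Z})$ is the class of $A^*$ weights $w$ for which there is a constant $c_*>0$ such that for any $\varepsilon>0$ and $x,y\in[-1,1]$ with $|x-y|\le\rho(\varepsilon,x)$ and $\operatorname{dist}([x,y],z_j)\ge\rho(\varepsilon,z_j)$ for all $1\le j\le M$ (here $[x,y]$ is the interval with endpoints $x,y$ in either order), $c_*w(y)\le w(x)\le c_*^{-1}w(y)$; $c_*$ does not depend on $x,y,\varepsilon$. For $A,h>0$: $\mathcal{Z}_{A,h}^j:=\{x\in[-1,1] : |x-z_j|\le A\rho(h,z_j)\}$ and $\mathcal{I}_{A,h}:=\{x\in[-1,1] : |x-z_j|\ge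 A\rho(h,z_j)\text{ for all }1\le j\le M\}$. The $r$th symmetric difference is $\Delta_h^r(f,x,J):=\sum_{i=0}^r\binom{r}{i}(-1)^{r-i}f(x-rh/2+ih)$ if $[x-rh/2,x+rh/2]\subset J$, and $0$ otherwise. The main part modulus is $\Omega_\varphi^r(f,A,t)_w:=\sup_{0<h\le t}\|w(\cdot)\Delta_{h\varphi(\cdot)}^r(f,\cdot,\mathcal{I}_{A,h})\|$, and the complete weighted modulus of smoothness is, for $A,B,t>0$, $\omega_\varphi^r(f,A,B,t)_w:=\Omega_\varphi^r(f,A,t)_w+\sum_{j=1}^M E_r(f,\mathcal{Z}_{B,t}^j)_w$. *)

(* Defs.v *)
From mathcomp Require Import all_boot all_order all_algebra.
From mathcomp Require Import all_classical all_reals all_analysis ess_sup_inf.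

Set Implicit Arguments.
Unset Strict Implicit.
Unset Printing Implicit Defensive.

Import Order.TTheory GRing.Theory Num.Theory.
Import numFieldNormedType.Exports.

Local Open Scope classical_set_scope.
Local Open Scope ring_scope.

(* R equipped with the sigma-algebra of Lebesgue (not only Borel) measurable
   sets, i.e. the domain of completed_lebesgue_measure *)
Definition lebesgueR (R : realType) :=
  caratheodory_type ((@wlength R idfun)^*)%mu.

(* Functions on [-1, 1] are represented by functions on R whose values outside
   [-1, 1] are irrelevant. *)
Definition I11 (R : realType) : set R := `[-1, 1].
Arguments I11 : clear implicits.

Section Norms.
Context {R : realType}.
Implicit Types (I : set R) (f g w : R -> R) (q : {poly R}).

Definition esup_norm I g : \bar R :=
  ess_sup (@completed_lebesgue_measure R) ((fun x => `|g x|%:E) \_ I).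

Definition Linf_w w f : Prop :=
  measurable_fun (I11 R : set (lebesgueR R)) (f : lebesgueR R -> R) /\
  (esup_norm (I11 R) (fun x => w x * f x)%R < +oo)%E.

Definition best_approx (r : nat) f I w : \bar R :=
  ereal_inf [set esup_norm I (fun x => w x * (f x - q.[x])) |
             q in [set q : {poly R} | (size q <= r)%N]].

Definition phi (x : R) : R := Num.sqrt (1 - x ^+ 2).

Definition rho (h x : R) : R := h * phi x + h ^+ 2.

End Norms.

Section Weights.
Context {R : realType}.
Implicit Types (w : R -> R) (x y : R).
Local Notation mu := (@completed_lebesgue_measure R).

Definition Astar_weight w : Prop :=
  [/\ forall x, I11 R x -> 0 <= w x,
      mu.-integrable (I11 R : set (lebesgueR R))
        (EFin \o w : lebesgueR R -> \bar R) &
      exists L : R, forall I : set R,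
        is_interval I -> I `<=` I11 R -> (0 < mu I)%E ->
        forall x, I x -> w x <= L / fine (mu I) * \int[mu]_(u in I) w u].

Definition in_ZM (M : nat) (Z : M.-tuple R) : Prop :=
  (forall j : 'I_M, -1 <= tnth Z j <= 1) /\
  (forall i j : 'I_M, (i < j)%N -> tnth Z i < tnth Z j).

Definition segment x y : set R := `[Num.min x y, Num.max x y].

Definition Wstar (M : nat) (Z : M.-tuple R) w : Prop :=
  Astar_weight w /\
  exists2 c : R, 0 < c &
    forall eps x y : R, 0 < eps -> I11 R x -> I11 R y ->
      `|x - y| <= rho eps x ->
      (forall j : 'I_M,
        ((rho eps (tnth Z j))%:E <= edist_inf (segment x y) (tnth Z j))%E) ->
      c * w y <= w x <= c^-1 * w y.

End Weights.

Section Moduli.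
Context {R : realType} (M : nat) (Z : M.-tuple R).
Implicit Types (f w : R -> R).

Definition near_Z (A h : R) (j : 'I_M) : set R :=
  [set x | I11 R x /\ `|x - tnth Z j| <= A * rho h (tnth Z j)].

Definition away_Z (A h : R) : set R :=
  [set x | I11 R x /\ forall j : 'I_M,
    A * rho h (tnth Z j) <= `|x - tnth Z j|].

Definition sym_diff (r : nat) (h : R) f (x : R) (J : set R) : R :=
  if `[< `[x - r%:R * h / 2, x + r%:R * h / 2] `<=` J >] then
    \sum_(i < r.+1) 'C(r, i)%:R * (-1) ^+ (r - i)
      * f (x - r%:R * h / 2 + i%:R * h)
  else 0.

Definition main_modulus (r : nat) f (A t : R) w : \bar R :=
  ereal_sup [set esup_norm (I11 R)
                   (fun x => w x * sym_diff r (h * phi x) f x (away_Z A h)) |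
             h in [set h : R | 0 < h <= t]].

Definition complete_modulus (r : nat) f (A B t : R) w : \bar R :=
  (main_modulus r f A t w
   + \sum_(j < M) best_approx r f (near_Z B t j) w)%E.

End Moduli.

(* Main.v *)
(** Write [x = cos t]. At the scale [k ~ 1/n] the weight is replaced by its
    averages over the images under cos of arcs of radius [k]; the A* property
    makes these averages doubling, hence slowly varying in [t], and they
    dominate the weight. On each such arc [f] has a polynomial approximant of
    degree less than [r]: close to a node [z_j] it is a near-best one on the
    set around [z_j], elsewhere [w] is comparable to its average and Whitney's
    inequality applies. Two such approximants are compared on a subarc of
    proportional length that avoids the nodes, where [w] is bounded below by
    its average; the difference then grows only polynomially in the angular
    distance over [k]. A discrete convolution with a power of the Fejér kernel
    glues the local approximants into one polynomial, and a Bernstein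
    inequality that tolerates polynomial growth gives the derivative bounds.
    For small degrees one truncates the polynomial of a fixed large degree,
    controlling the error by its [r]-th derivative; if the modulus vanishes one
    passes to the limit through interpolation. *)
Require Import Defs.
From mathcomp Require Import all_boot all_order all_algebra.
From mathcomp Require Import all_classical all_reals all_analysis.
From mathcomp Require Import ess_sup_inf measurable_realfun zify ring lra.

Import Order.TTheory GRing.Theory Num.Theory.
Import numFieldNormedType.Exports.

Local Open Scope classical_set_scope.
Local Open Scope ring_scope.

Set Implicit Arguments.
Unset Strict Implicit.
Unset Printing Implicit Defensive.

(** * Lebesgue measure: affine substitutions and sections of null sets *)

Section MeasureTools.
Context {R : realType}.
Local Notation mu := (@lebesgue_measure R).

(** Two features of the data shape the argument. First, [f] is known only up to null sets and is
    Lebesgue rather than Borel measurable, while the modulus bounds, for each fixed [h], differences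
    whose step [h * phi x] varies with the point. Whitney's inequality therefore has to start from
    differences that are small for almost every step and almost every point. Exchanging the two
    variables by Fubini needs a Borel representative of [f], and averaging over the step replaces
    the continuity that a bounded measurable function lacks. Second, the comparison of local
    approximants loses a power of the angular distance over [k]. Each unit of that power is paid for
    by one factor of the Fejér kernel, and one further factor is kept to be summed over the nodes;
    this fixes the exponent of the kernel. The numerical constants around the nodes all descend from
    the constant 64 in the comparison of [|cos s - cos t|] with [rho]. *)

Lemma affine_measurable (a c : R) :
  measurable_fun setT (fun h : R => a + c * h).
Proof.
apply: measurable_funD => //; apply: measurable_funM => //.
Qed.

(** Uniqueness of Lebesgue measure, applied to [|c|] times the pushforward under [h |-> a + c h]:
    the two measures agree on half-open intervals. *)
Lemma lebesgue_affine (a c : R) (A : set R) : c != 0 -> measurable A ->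
  mu A = (`|c|%:E * mu ((fun h : R => (a + c * h)%R) @^-1` A))%E.
Proof.
move=> c0 mA.
pose phi : measurableTypeR R -> measurableTypeR R := fun h => a + c * h.
have mphi : measurable_fun setT phi by exact: affine_measurable.
have c0' : (0 <= `|c|) by [].
pose nuf := (mscale (NngNum c0') (pushforward mu phi) :
  {measure set (measurableTypeR R) -> \bar R}).
pose nu : {measure set (measurableTypeR R) -> \bar R} := nuf mphi.
rewrite (@lebesgue_measure_unique R nu) //.
move=> X; rewrite ocitvP => -[->|[[x y] /= xy ->]]; first by rewrite !measure0.
change (mu `]x, y] = `|c|%:E * mu ((fun h : R => (a + c * h)%R) @^-1` `]x, y]%classic))%E.
have [cp|cn|c00] := ltrgt0P c; last by rewrite c00 eqxx in c0.
- have -> : (fun h : R => a + c * h) @^-1` `]x, y] = `](x - a) / c, (y - a) / c]%classic.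
    apply/seteqP; split => h /=; rewrite !in_itv /= ltr_pdivrMr // ler_pdivlMr //;
      rewrite (mulrC h) => /andP[h1 h2]; apply/andP; split; lra.
  rewrite !lebesgue_measure_itv /= !lte_fin ltr_pM2r ?invr_gt0 // ltrD2r xy.
  rewrite -!EFinB -EFinM; congr EFin; field; lra.
- have -> : (fun h : R => a + c * h) @^-1` `]x, y] = `[(y - a) / c, (x - a) / c[%classic.
    apply/seteqP; split => h /=; rewrite !in_itv /= ltr_ndivlMr // ler_ndivrMr //;
      rewrite (mulrC h) => /andP[h1 h2]; apply/andP; split; lra.
  rewrite !lebesgue_measure_itv /= !lte_fin ltr_nM2r ?invr_lt0 // ltrD2r xy.
  rewrite -!EFinB -EFinM; congr EFin; field; lra.
Qed.

Lemma affine_negligible (a c : R) (N : set R) : c != 0 -> mu.-negligible N ->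
  mu.-negligible ((fun h : R => a + c * h) @^-1` N).
Proof.
move=> c0 [A [mA A0 NA]].
exists ((fun h : R => a + c * h) @^-1` A); split.
- by rewrite -[X in measurable X]setTI; exact: affine_measurable.
- have := lebesgue_affine a c0 mA; rewrite A0 => /esym/eqP.
  by rewrite mule_eq0 eqe normr_eq0 (negbTE c0) /= => /eqP.
- by move=> h /= /NA.
Qed.

Lemma ae_affine (a c : R) (P : R -> Prop) : c != 0 ->
  {ae mu, forall x, P x} -> {ae mu, forall h, P (a + c * h)}.
Proof. by move=> c0 /(affine_negligible a c0). Qed.

(** By Tonelli the measures of the sections in either direction integrate to the product measure of
    [B]. Null sections in one direction make it zero, which forces almost all sections in the other
    direction to be null. *)
Lemma ae_swap (B : set (measurableTypeR R * measurableTypeR R)) : measurable B ->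
  {ae mu, forall y, {ae mu, forall x, ~ B (x, y)}} ->
  {ae mu, forall x, {ae mu, forall y, ~ B (x, y)}}.
Proof.
move=> mB H.
have F0 := @indic_fubini_tonelli _ _ _ _ R mu mu B mB.
have G0 : (\int[mu]_y fubini_G mu (EFin \o \1_B) y = 0)%E.
  rewrite -(integral0 mu setT).
  apply: (ge0_ae_eq_integral (mu := mu)).
  - exact: measurableT.
  - exact: indic_measurable_fun_fubini_tonelli_G.
  - exact: measurable_cst.
  - by move=> y _; exact: indic_fubini_tonelli_G_ge0.
  - by [].
  - apply: filterS H => y Hy _ /=.
    rewrite indic_fubini_tonelli_GE //=; apply/negligibleP.
      exact: measurable_ysection.
    apply: negligibleS Hy => x /=; rewrite /ysection /= inE => Bx nB; exact: nB.
rewrite G0 in F0.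
have mF := indic_measurable_fun_fubini_tonelli_F mu mB.
have := (ae_eq_integral_abs mu measurableT mF).1.
move=> H1.
have : (\int[mu]_x `|fubini_F mu (EFin \o \1_B) x| = 0)%E.
  rewrite -[RHS]F0; apply: eq_integral => x _; rewrite gee0_abs //.
  exact: indic_fubini_tonelli_F_ge0.
move=> /H1; apply: filterS => x /(_ I) /=.
rewrite indic_fubini_tonelli_FE //= => /negligibleP Hx.
apply: negligibleS (Hx _); last exact: measurable_xsection.
by move=> y /= /contrapT; rewrite /xsection /= inE.
Qed.


Lemma bounded_integrable (g : R -> R) (M a b : R) : measurable_fun setT g ->
  (forall x, `|g x| <= M) -> mu.-integrable `[a, b] (EFin \o g).
Proof.
move=> mg gM; apply: measurable_bounded_integrable => //.
- suff : (mu `[a, b]%classic < +oo)%E by [].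
  by rewrite lebesgue_measure_itv; case: ifP => //=; rewrite -?EFinB ltry.
- exact: measurable_funS mg.
- exists M; split; first by rewrite num_real.
  by move=> x Mx y _; exact: le_trans (gM y) (ltW Mx).
Qed.

Lemma Rintegral_bound (g : R -> R) (M : R) (D : set (measurableTypeR R)) : measurable D ->
  measurable_fun setT g -> mu.-integrable D (EFin \o g) -> (mu D < +oo)%E ->
  (forall x, `|g x| <= M) -> `|\int[mu]_(x in D) g x| <= M * fine (mu D).
Proof.
move=> mD mg ig Dfin gM.
have h := le_normr_Rintegral mD ig.
apply: (le_trans h).
rewrite -Rintegral_cst //; apply: le_Rintegral => //.
- exact: (integrable_norm ig).
- by apply: measurable_bounded_integrable => //; exact: bounded_cst.
Qed.

Lemma Rintegral_translate (g : R -> R) (M a b d : R) : measurable_fun setT g ->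
  (forall x, `|g x| <= M) ->
  \int[mu]_(x in `[a, b]) g (d + x) = \int[mu]_(x in `[d + a, d + b]) g x.
Proof.
move=> mg gM.
pose phi : measurableTypeR R -> measurableTypeR R := fun h => d + 1 * h.
have mphi : measurable_fun setT phi by exact: affine_measurable.
have phiV : phi @^-1` `[d + a, d + b] = `[a, b]%classic.
  by apply/seteqP; split=> x /=; rewrite /phi mul1r !in_itv /= !lerD2l.
rewrite /Rintegral; congr fine.
transitivity (\int[pushforward mu phi]_(x in `[(d + a)%R, (d + b)%R]) (g x)%:E)%E; last first.
  apply: eq_measure_integral => A mA _ /=.
  by rewrite (lebesgue_affine d (oner_neq0 R) mA) normr1 mul1e.
rewrite (integral_pushforward mphi); last 3 first.
- exact/measurable_EFinP.
- rewrite phiV; apply: (@bounded_integrable (g \o phi) M) => //.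
    exact: measurableT_comp.
  by move=> x; exact: gM.
- exact: measurable_itv.
by rewrite phiV; apply: eq_integral => x _ /=; rewrite /phi mul1r.
Qed.

(* Only the translates of the two endpoints by [d] contribute. *)
Lemma Rintegral_shift_le (g : R -> R) (M a b d : R) : measurable_fun setT g ->
  (forall x, `|g x| <= M) -> a <= b ->
  `|\int[mu]_(x in `[a, b]) g (d + x) - \int[mu]_(x in `[a, b]) g x|
    <= 2 * M * `|d|.
Proof.
wlog d0 : g d / 0 <= d => [hw|] mg gM ab.
  have [d0|d0] := leP 0 d; first exact: hw.
  pose g' x := g (d + x).
  have mg' : measurable_fun setT g'.
    have -> : g' = g \o (fun x => d + 1 * x) by apply/funext => x; rewrite /g' /= mul1r.
    by apply: measurableT_comp => //; exact: affine_measurable.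
  have := hw g' (- d) (ltW _) mg' (fun x => gM _) ab.
  rewrite oppr_gt0 => /(_ d0); rewrite normrN distrC; apply: le_trans.
  rewrite le_eqVlt; apply/orP; left; apply/eqP; congr (`|_ - _|).
  by apply: eq_Rintegral => x _; rewrite /g' addNKr.
rewrite (Rintegral_translate _ _ _ mg gM) (ger0_norm d0).
have M0 : 0 <= M by apply: le_trans (gM 0).
have ig x y := bounded_integrable x y mg gM.
have igS : mu.-integrable `[a, d + b] (EFin \o g) by [].
have h1 := @Rintegral_itvB R g (BLeft a) (BRight (d + b)) b (ig _ _).
have h2 := @Rintegral_itvB R g (BLeft a) (BRight (d + b)) (d + a) (ig _ _).
rewrite !bnd_simp in h1 h2.
have {}h1 := h1 ab ltac:(lra). have {}h2 := h2 ltac:(lra) ltac:(lra).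
have e3 : \int[mu]_(x in `]d + a, d + b]) g x = \int[mu]_(x in `[d + a, d + b]) g x.
  rewrite Rintegral_itv_obnd_cbnd //.
  by apply: (integrableS _ _ _ (ig (d + a) (d + b))) => //; exact: subset_itv_oc_cc.
have b1 : `|\int[mu]_(x in `]b, d + b]) g x| <= M * d.
  apply: le_trans (Rintegral_bound (M := M) _ mg _ _ gM) _ => //.
  - by apply: (integrableS _ _ _ (ig b (d + b))) => //; exact: subset_itv_oc_cc.
  - by rewrite lebesgue_measure_itv; case: ifP => //=; rewrite -?EFinB ltry.
  - rewrite lebesgue_measure_itv /=; case: ifP => /= _; first by rewrite addrK.
    by rewrite mulr0 mulr_ge0.
have b2 : `|\int[mu]_(x in `[a, d + a]) g x| <= M * d.
  apply: le_trans (Rintegral_bound (M := M) _ mg _ _ gM) _ => //.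
  - by rewrite lebesgue_measure_itv; case: ifP => //=; rewrite -?EFinB ltry.
  - rewrite lebesgue_measure_itv /=; case: ifP => /= _; first by rewrite addrK.
    by rewrite mulr0 mulr_ge0.
rewrite -e3.
have -> : \int[mu]_(x in `]d + a, d + b]) g x - \int[mu]_(x in `[a, b]) g x =
  \int[mu]_(x in `]b, d + b]) g x - \int[mu]_(x in `[a, d + a]) g x.
  suff H : forall p q s u v : R, p - q = u -> p - s = v -> v - q = u - s by apply: H h1 h2.
  by move=> *; lra.
apply: le_trans (ler_normB _ _) _; lra.
Qed.

End MeasureTools.

(** * Chebyshev polynomials and the Bernstein inequality *)

Section Chebyshev.
Context {R : realType}.
Implicit Types (p q : {poly R}) (t x : R).

(** Carries two consecutive Chebyshev polynomials, which makes the three-term recurrence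
    structural. *)
Fixpoint cheb2 n : {poly R} * {poly R} :=
  if n is n'.+1 then let: (p, q) := cheb2 n' in (q, 2%:R *: ('X * q) - p)
  else (1, 'X).

Definition cheb n : {poly R} := (cheb2 n).1.

Lemma cheb0 : cheb 0 = 1. Proof. by []. Qed.
Lemma cheb1 : cheb 1 = 'X. Proof. by []. Qed.
Lemma chebSS n : cheb n.+2 = 2%:R *: ('X * cheb n.+1) - cheb n.
Proof. by rewrite /cheb /=; case: (cheb2 n). Qed.

Lemma cheb_cos n t : (cheb n).[cos t] = cos (n%:R * t).
Proof.
elim/ltn_ind: n => -[|[|n]] IH.
- by rewrite cheb0 hornerE mul0r cos0.
- by rewrite cheb1 hornerE mul1r.
rewrite chebSS hornerD hornerN hornerZ hornerM hornerX !IH //.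
have -> : n.+2%:R * t = n.+1%:R * t + t by rewrite -[n.+2%:R]natr1; ring.
have -> : n%:R * t = n.+1%:R * t - t by rewrite -[n.+1%:R]natr1; ring.
rewrite cosB cosD; ring.
Qed.

Lemma deriv_cheb n t : sin t * (cheb n)^`().[cos t] = n%:R * sin (n%:R * t).
Proof.
elim/ltn_ind: n => -[|[|n]] IH.
- by rewrite cheb0 derivC hornerE !mul0r mulr0.
- by rewrite cheb1 derivX hornerE !mul1r mulr1.
rewrite chebSS derivB derivZ derivM derivX !hornerE cheb_cos.
have h1 := IH n.+1 (ltnSn _); have h0 := IH n (leqW (ltnSn _)).
transitivity (2 * sin t * cos (n.+1%:R * t) +
  2 * cos t * (sin t * (cheb n.+1)^`().[cos t]) - sin t * (cheb n)^`().[cos t]); first by ring.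
rewrite h1 h0.
have -> : n.+2%:R * t = n.+1%:R * t + t by rewrite -[n.+2%:R]natr1; ring.
have -> : n%:R * t = n.+1%:R * t - t by rewrite -[n.+1%:R]natr1; ring.
rewrite sinB sinD -[n.+2%:R]natr1 -[n.+1%:R]natr1; ring.
Qed.

Lemma size_cheb n : (size (cheb n) <= n.+1)%N.
Proof.
elim/ltn_ind: n => -[|[|n]] IH.
- by rewrite cheb0 size_poly1.
- by rewrite cheb1 size_polyX.
rewrite chebSS (leq_trans (size_polyD _ _)) // geq_max size_polyN.
rewrite (leq_trans (IH n _)) ?andbT //; last by rewrite ltnW.
apply: leq_trans (size_scale_leq _ _) _.
by apply: leq_trans (size_polyMleq _ _) _; rewrite size_polyX add2n /= ltnS IH.
Qed.

Lemma mulX_cheb n : 'X * cheb n.+1 = 2^-1 *: (cheb n.+2 + cheb n).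
Proof. by rewrite chebSS addrNK scalerA mulVf ?scale1r // pnatr_eq0. Qed.

Lemma cheb_span n p : (size p <= n)%N ->
  exists u : nat -> R, p = \sum_(i < n) u i *: cheb i.
Proof.
pose S m q := exists u : nat -> R, q = \sum_(i < m) u i *: cheb i.
have S0 m : S m 0.
  by exists (fun=> 0); rewrite big1 // => i _; rewrite scale0r.
have SD m q1 q2 : S m q1 -> S m q2 -> S m (q1 + q2).
  move=> [u ->] [v ->]; exists (fun i => u i + v i); rewrite -big_split /=.
  by apply: eq_bigr => i _; rewrite scalerDl.
have SZ m c q : S m q -> S m (c *: q).
  move=> [u ->]; exists (fun i => c * u i); rewrite scaler_sumr.
  by apply: eq_bigr => i _; rewrite scalerA.
have SC m i : (i < m)%N -> S m (cheb i).
  move=> im; exists (fun j => (j == i)%:R).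
  rewrite (bigD1 (Ordinal im)) //= eqxx scale1r big1 ?addr0 // => j.
  by rewrite -val_eqE /= => /negbTE ->; rewrite scale0r.
have Sm m (I : Type) (s : seq I) (F : I -> {poly R}) :
    (forall i, S m (F i)) -> S m (\sum_(i <- s) F i).
  by move=> h; elim/big_ind : _ => //; exact: SD.
rewrite -/(S n p); elim: n p => [|n IH] p.
  by rewrite leqn0 size_poly_eq0 => /eqP ->; exact: S0.
elim/poly_ind : p => [|q c _] sz; first exact: S0.
apply: (SD); last first.
  have -> : c%:P = c *: cheb 0 by rewrite cheb0 alg_polyC.
  exact/SZ/SC.
have szq : (size q <= n)%N.
  have [->|q0] := eqVneq q 0; first by rewrite size_poly0.
  by move: sz; rewrite size_MXaddC (negbTE q0).
have [u ->] := IH q szq.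
rewrite mulr_suml; apply: Sm => -[[|i] /= im].
  by rewrite -scalerAl mul1r; apply/SZ/(SC _ 1%N).
rewrite -scalerAl mulrC mulX_cheb; apply/SZ/SZ/SD; apply: SC => //.
by apply: ltnW; apply: ltnW.
Qed.

Lemma sin_period t l : sin (t + l%:R * (2 * pi)) = sin t.
Proof.
rewrite -[RHS](periodicn (@sinD2pi R) l t); congr sin.
by rewrite -[pi *+ 2 *+ l]mulr_natr -[pi *+ 2]mulr_natr; ring.
Qed.

Lemma cos_period t l : cos (t + l%:R * (2 * pi)) = cos t.
Proof.
rewrite -[RHS](periodicn (@cosD2pi R) l t); congr cos.
by rewrite -[pi *+ 2 *+ l]mulr_natr -[pi *+ 2]mulr_natr; ring.
Qed.

(** Multiplication by [2 sin (l pi / m)], which is positive, turns the sum into a telescoping one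
    whose two ends differ by [l] periods. *)
Lemma node_sum l m t : (0 < l < m)%N ->
  \sum_(k < m) cos (l%:R * (t + k%:R * (2 * pi / m%:R))) = 0.
Proof.
move=> /andP[l0 lm].
have m0 : m%:R != 0 :> R by rewrite pnatr_eq0 -lt0n (leq_trans _ lm).
have mp : 0 < m%:R :> R by rewrite ltr0n (leq_trans _ lm).
pose b : R := l%:R * pi / m%:R.
have sb : 0 < sin b.
  apply: sin_gt0_pi; rewrite /b divr_gt0 ?mulr_gt0 ?pi_gt0 ?mp // ?ltr0n //=.
  by rewrite ltr_pdivrMr // mulrC ltr_pM2l ?pi_gt0 // ltr_nat.
pose a := l%:R * t.
have E k : 2 * sin b * cos (l%:R * (t + k%:R * (2 * pi / m%:R))) =
   sin (a + (2 * k.+1%:R - 1) * b) - sin (a + (2 * k%:R - 1) * b).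
  have -> : l%:R * (t + k%:R * (2 * pi / m%:R)) = a + 2 * k%:R * b.
    by rewrite /a /b; field.
  have -> : a + (2 * k.+1%:R - 1) * b = (a + 2 * k%:R * b) + b.
    by rewrite -[k.+1%:R]natr1; ring.
  have -> : a + (2 * k%:R - 1) * b = (a + 2 * k%:R * b) - b by ring.
  by rewrite sinD sinB; ring.
apply: (mulfI (lt0r_neq0 (mulr_gt0 (ltr0n R 2) sb))); rewrite mulr0 mulr_sumr.
under eq_bigr do rewrite E.
rewrite -(big_mkord xpredT (fun k => sin (a + (2 * k.+1%:R - 1) * b) - sin (a + (2 * k%:R - 1) * b))).
rewrite telescope_sumr //.
have -> : a + (2 * m%:R - 1) * b = (a + (2 * 0%:R - 1) * b) + l%:R * (2 * pi).
  by rewrite /b; field.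
by rewrite sin_period subrr.
Qed.

(** In the Chebyshev basis only the constant term survives the sum over [m] equispaced angles. This
    exact quadrature later normalizes the gluing kernel. *)
Lemma node_sum_poly p m : (size p <= m)%N -> exists c : R, forall t,
  \sum_(k < m) p.[cos (t + k%:R * (2 * pi / m%:R))] = c.
Proof.
move=> /cheb_span[u ->]; case: m => [|m] in u *.
  by exists 0 => t; rewrite big_ord0.
exists (m.+1%:R * u 0%N) => t.
under eq_bigr do rewrite horner_sum.
rewrite exchange_big /= (bigD1 ord0) //= [X in _ + X]big1 ?addr0 => [|i i0].
  under eq_bigr do rewrite !hornerE.
  by rewrite sumr_const card_ord mulr_natl.
under eq_bigr do rewrite hornerZ cheb_cos.
by rewrite -mulr_sumr node_sum ?mulr0 // ltn_ord andbT lt0n.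
Qed.

End Chebyshev.

(** * Riesz interpolation and Bernstein inequalities for higher derivatives *)

Section Bernstein.
Context {R : realType}.
Implicit Types (p q : {poly R}) (t x : R).

(** The nodes [(2 k + 1) pi / (2 n)] are the zeros of [cos (n t)] in one period; the weights [wt]
    are Riesz' [(-1) ^ k / (4 n sin (tau / 2) ^ 2)]. *)
Let tau n k : R := pi / (2 * n%:R) + k%:R * (2 * pi / (2 * n)%:R).
Let wt n k : R := (-1) ^+ k / (2 * n%:R * (1 - cos (tau n k))).

Let tau_range n k : (0 < n)%N -> (k < 2 * n)%N -> 0 < tau n k < 2 * pi.
Proof.
move=> n0 kn; rewrite /tau natrM.
have np : 0 < n%:R :> R by rewrite ltr0n.
have p0 := pi_gt0 R.
have -> : pi / (2 * n%:R) + k%:R * (2 * pi / (2 * n%:R)) = (2 * k%:R + 1) * pi / (2 * n%:R) :> R.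
  by field; rewrite lt0r_neq0.
have k0 : 0 <= k%:R :> R by rewrite ler0n.
apply/andP; split; first by rewrite divr_gt0 ?mulr_gt0 //; lra.
rewrite ltr_pdivrMr ?mulr_gt0 //.
have : k%:R + 1 <= 2 * n%:R :> R by rewrite natr1 -natrM ler_nat.
nra.
Qed.

Let cos_lt1 t : 0 < t < 2 * pi -> cos t < 1.
Proof.
move=> /andP[t0 t2].
have s0 : 0 < sin (t / 2) by apply: sin_gt0_pi; apply/andP; split; lra.
have -> : t = (t / 2) *+ 2 by rewrite mulr2n; lra.
rewrite cos_mulr2n cos2sin2 mulr2n; have : 0 < sin (t / 2) ^+ 2 by rewrite exprn_gt0.
lra.
Qed.

Let ntau n k : (0 < n)%N -> n%:R * tau n k = pi / 2 + k%:R * pi.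
Proof. by move=> n0; rewrite /tau natrM; field; rewrite pnatr_eq0 -lt0n. Qed.

Let sin_ntau n k : (0 < n)%N -> sin (n%:R * tau n k) = (-1) ^+ k.
Proof.
move=> n0; rewrite ntau //; elim: k => [|k IH]; first by rewrite mul0r addr0 sin_pihalf.
have -> : pi / 2 + k.+1%:R * pi = (pi / 2 + k%:R * pi) + pi :> R.
  by rewrite -[k.+1%:R]natr1; ring.
by rewrite sinDpi IH exprS mulN1r.
Qed.

Let cos_ntau n k : (0 < n)%N -> cos (n%:R * tau n k) = 0.
Proof.
move=> n0; rewrite ntau //; elim: k => [|k IH]; first by rewrite mul0r addr0 cos_pihalf.
have -> : pi / 2 + k.+1%:R * pi = (pi / 2 + k%:R * pi) + pi :> R.
  by rewrite -[k.+1%:R]natr1; ring.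
by rewrite cosDpi IH oppr0.
Qed.

(** The second difference in [l] of [sin (l tau)] is [-2 (1 - cos tau) sin (l tau)], which cancels
    the denominator of the weight. What remains is a multiple of [cos ((n - l) tau)], because
    [cos (n tau) = 0] and [sin (n tau) = (-1) ^ k], so [node_sum] applies unless [l = n]. *)
Let riesz_diff n l : (0 < n)%N -> (0 < l <= n)%N ->
  \sum_(k < 2 * n) wt n k * (sin (l.+1%:R * tau n k) + sin (l.-1%:R * tau n k)
     - 2 * sin (l%:R * tau n k)) = if (l == n)%N then - 2 else 0.
Proof.
move=> n0 /andP[l0 ln].
have np : 0 < n%:R :> R by rewrite ltr0n.
transitivity (\sum_(k < 2 * n) - (n%:R^-1) * cos ((n - l)%:R * tau n k)).
  apply: eq_bigr => k _.
  have c1 : 1 - cos (tau n k) != 0.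
    by rewrite lt0r_neq0 // subr_gt0; exact/cos_lt1/tau_range.
  have -> : l.+1%:R * tau n k = l%:R * tau n k + tau n k by rewrite -natr1; ring.
  have -> : l.-1%:R * tau n k = l%:R * tau n k - tau n k.
    by rewrite -[in RHS](prednK l0) -natr1; ring.
  rewrite natrB // mulrBl cosB sin_ntau // cos_ntau // mul0r add0r sinD sinB /wt.
  by field; rewrite lt0r_neq0.
rewrite -mulr_sumr; have [->|lneq] := eqVneq l n.
  rewrite subnn; under eq_bigr do rewrite mul0r cos0.
  by rewrite sumr_const card_ord natrM; field; rewrite lt0r_neq0.
rewrite [X in _ * X]node_sum ?mulr0 //.
rewrite subn_gt0 ltn_neqAle lneq ln /=.
by rewrite (leq_ltn_trans (leq_subr _ _)) // mul2n -addnn -addn1 leq_add2l.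
Qed.

(** By [riesz_diff] the sums are linear in [l] up to [n]. The symmetry [a (n + 1) = a (n - 1)]
    combined with the value [-2] of the second difference at [n] gives slope one. *)
Let riesz_sin n l : (0 < n)%N -> (l <= n)%N ->
  \sum_(k < 2 * n) wt n k * sin (l%:R * tau n k) = l%:R.
Proof.
move=> n0.
pose a i := \sum_(k < 2 * n) wt n k * sin (i%:R * tau n k).
have a0 : a 0%N = 0.
  by rewrite /a big1 // => k _; rewrite mul0r sin0 mulr0.
have rec i : (0 < i <= n)%N -> a i.+1 + a i.-1 - 2 * a i = if (i == n)%N then - 2 else 0.
  move=> ii; rewrite -(riesz_diff n0 ii) /a mulr_sumr -big_split -sumrB /=.
  by apply: eq_bigr => k _; ring.
have lin i : (i < n)%N -> a i = i%:R * a 1%N /\ a i.+1 = i.+1%:R * a 1%N.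
  elim: i => [|i IH] ii; first by rewrite a0 mul0r mul1r.
  have [h1 h2] := IH (ltnW ii); split => //.
  have := rec i.+1; rewrite /= (ltnW ii) (ltn_eqF ii) h1 h2 => /(_ isT).
  by rewrite -[i.+2%:R]natr1 -[i.+1%:R]natr1 => h; lra.
have aend : a n.+1 = a n.-1.
  apply: eq_bigr => k _; congr (_ * _).
  have -> : n.+1%:R * tau n k = n%:R * tau n k + tau n k by rewrite -natr1; ring.
  have -> : n.-1%:R * tau n k = n%:R * tau n k - tau n k.
    by rewrite -subn1 natrB //; ring.
  by rewrite sinB sinD cos_ntau //; ring.
have a1 : a 1%N = 1.
  have := rec n; rewrite n0 leqnn eqxx aend => /(_ isT).
  have := lin n.-1; rewrite (prednK n0) leqnn => /(_ isT)[-> ->].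
  by rewrite -[in n%:R](prednK n0) -natr1; lra.
rewrite -/(a l); case: l => [|l] ll; first by rewrite a0.
by have [_ ->] := lin l ll; rewrite a1 mulr1.
Qed.

(** The reflection [tau |-> 2 pi - tau] permutes the nodes, keeps the cosines and flips the sign of
    each weight. *)
Let riesz_cos n l : (0 < n)%N ->
  \sum_(k < 2 * n) wt n k * cos (l%:R * tau n k) = 0.
Proof.
move=> n0; set s := LHS.
suff : s = - s by move=> h; lra.
rewrite {1}/s (reindex_inj rev_ord_inj) -sumrN; apply: eq_bigr => k _ /=.
have np : 0 < n%:R :> R by rewrite ltr0n.
have E : tau n (2 * n - k.+1) = 2 * pi - tau n k.
  rewrite /tau natrB // !natrM -[k.+1%:R]natr1; field; exact: lt0r_neq0.
have C i : cos (i%:R * (2 * pi - tau n k)) = cos (i%:R * tau n k).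
  rewrite -(cosN (i%:R * tau n k)) -(cos_period (- _) i); congr cos; ring.
rewrite E /wt E C -[cos (2 * pi - tau n k)]mulr1.
have := C 1%N; rewrite !mul1r mulr1 => ->.
have -> : (-1) ^+ (2 * n - k.+1) = - (-1) ^+ k :> R.
  rewrite -signr_odd oddB // oddM /= -[in RHS]signr_odd.
  by case: (odd k); rewrite ?expr0 ?expr1 ?opprK.
by rewrite !mulNr.
Qed.

(** At [l = n] the factor [sin (n tau)] is exactly the sign of the weight. *)
Let riesz_abs n : (0 < n)%N -> \sum_(k < 2 * n) `|wt n k| = n%:R.
Proof.
move=> n0; rewrite -(riesz_sin n0 (leqnn n)); apply: eq_bigr => k _.
rewrite sin_ntau // /wt normrM normrX normrN1 expr1n mul1r.
have c1 : 0 < 1 - cos (tau n k) by rewrite subr_gt0; exact/cos_lt1/tau_range.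
rewrite ger0_norm ?invr_ge0 ?mulr_ge0 ?ler0n ?(ltW c1) //.
by rewrite [RHS]mulrAC -exprD addnn -signr_odd odd_double expr0 mul1r.
Qed.

(* M. Riesz' interpolation formula for the derivative of a trigonometric
   polynomial, whose weights have absolute values summing to the degree. *)
Lemma bernstein n p (M : R) t : (0 < n)%N -> (size p <= n.+1)%N ->
  (forall x, -1 <= x <= 1 -> `|p.[x]| <= M) ->
  `|sin t * p^`().[cos t]| <= n%:R * M.
Proof.
move=> n0 /cheb_span[u pE] pM.
have -> : sin t * p^`().[cos t] = - \sum_(k < 2 * n) wt n k * p.[cos (t + tau n k)].
  rewrite pE; under [X in - X]eq_bigr => k _ do rewrite horner_sum mulr_sumr.
  rewrite exchange_big (raddf_sum (@deriv R)) horner_sum mulr_sumr -sumrN /=; apply: eq_bigr => l _.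
  rewrite derivZ hornerZ mulrCA deriv_cheb.
  under eq_bigr => k _ do rewrite hornerZ cheb_cos mulrDr cosD.
  have S : \sum_(k < 2 * n) wt n k * sin (l%:R * tau n k) = l%:R.
    by apply: riesz_sin => //; rewrite -ltnS.
  have H := riesz_cos l n0.
  transitivity (- (u l * cos (l%:R * t) * \sum_(k < 2 * n) wt n k * cos (l%:R * tau n k)) +
     u l * sin (l%:R * t) * \sum_(k < 2 * n) wt n k * sin (l%:R * tau n k)).
    by rewrite H S mulr0 oppr0 add0r; ring.
  rewrite !mulr_sumr -!sumrN -big_split /=; apply: eq_bigr => k _; ring.
rewrite normrN; apply: le_trans (ler_norm_sum _ _ _) _.
rewrite -(riesz_abs n0) mulr_suml; apply: ler_sum => k _.
by rewrite normrM ler_wpM2l // pM // cos_geN1 cos_le1.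
Qed.


Lemma bernstein_itv n p (M a b : R) : (0 < n)%N -> (size p <= n.+1)%N -> a < b ->
  (forall x, a <= x <= b -> `|p.[x]| <= M) ->
  forall x, a <= x <= b ->
    (x - a) * (b - x) * p^`().[x] ^+ 2 <= (n%:R * M) ^+ 2.
Proof.
move=> n0 sp ab pM x /andP[ax xb].
pose c : R := (a + b) / 2; pose h : R := (b - a) / 2.
have h0 : 0 < h by rewrite /h; lra.
pose q := p \Po (h *: 'X + c%:P).
have qE y : q.[y] = p.[h * y + c] by rewrite horner_comp !hornerE.
have sq : (size q <= n.+1)%N.
  rewrite size_comp_poly2 //.
  by rewrite -mul_polyC size_MXaddC polyC_eq0 (gt_eqF h0) size_polyC (gt_eqF h0).
have dq y : q^`().[y] = h * p^`().[h * y + c].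
  by rewrite deriv_comp derivD derivZ derivX derivC addr0 hornerM horner_comp !(hornerD, hornerZ, hornerX, hornerC) mulr1 mulrC.
pose y := (x - c) / h.
have hy : h * y + c = x by rewrite /y; field; exact: lt0r_neq0.
have yI : -1 <= y <= 1.
  rewrite /y ler_pdivlMr // ler_pdivrMr // /c /h; apply/andP; split; lra.
have := @bernstein n q M (acos y) n0 sq.
rewrite acosK ?in_itv //= dq hy => H.
have {}H : `|sin (acos y) * (h * p^`().[x])| <= n%:R * M.
  apply: H => z /andP[z1 z2]; rewrite qE; apply: pM; rewrite /c /h; apply/andP; split; nra.
have : (sin (acos y) * (h * p^`().[x])) ^+ 2 <= (n%:R * M) ^+ 2.
  by rewrite -real_normK ?num_real // lerXn2r // ?nnegrE // (le_trans _ H).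
rewrite exprMn sin2cos2 acosK ?in_itv //=; apply: le_trans.
rewrite le_eqVlt; apply/orP; left; apply/eqP.
have yh : y * h = x - c by rewrite /y divfK ?lt0r_neq0.
transitivity ((h ^+ 2 - (y * h) ^+ 2) * p^`().[x] ^+ 2); last by ring.
by rewrite yh /c /h; field.
Qed.

Lemma size_derivn p k : (size p^`(k) <= size p)%N.
Proof.
elim: k => [|k IH]; first by rewrite derivn0.
by rewrite derivnS (leq_trans _ IH) // (leq_trans (size_poly _ _)) // leq_pred.
Qed.

Lemma phi_cos t : 0 <= t <= pi -> phi (cos t) = sin t.
Proof.
move=> tp; rewrite /phi -sin2cos2 sqrtr_sqr ger0_norm //; exact: sin_ge0_pi.
Qed.

Lemma phi_ge0 x : 0 <= phi x. Proof. exact: sqrtr_ge0. Qed.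

Lemma phi_sqr x : -1 <= x <= 1 -> phi x ^+ 2 = 1 - x ^+ 2.
Proof. by move=> /andP[x1 x2]; rewrite sqr_sqrtr //; nra. Qed.

Lemma phi_le1 x : phi x <= 1.
Proof.
rewrite -[leRHS]sqrtr1 ler_wsqrtr // gerBl; exact: sqr_ge0.
Qed.

(* The one-step inequality is applied on the nested intervals
   [-1 + kd/(2v), 1 - kd/(2v)], where d is the distance of x to the endpoints. *)
Lemma bernstein_higher n p (M : R) v x : (0 < n)%N -> (size p <= n.+1)%N ->
  (forall y, -1 <= y <= 1 -> `|p.[y]| <= M) -> -1 <= x <= 1 ->
  `|phi x ^+ v * p^`(v).[x]| <= (8 * v%:R * n%:R) ^+ v * M.
Proof.
move=> n0 sp pM xI; have M0 : 0 <= M by apply: le_trans (pM 0 _) => //; lra.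
case: v => [|v]; first by rewrite !expr0 derivn0 !mul1r pM.
set V := v.+1; pose d := 1 - `|x|.
have V0 : 0 < V%:R :> R by rewrite ltr0n.
have N0 : 0 < n%:R :> R by rewrite ltr0n.
have x1 : `|x| <= 1 by rewrite ler_norml; lra.
have [->|dn0] := eqVneq (phi x) 0.
  rewrite exprS !mul0r normr0 mulr_ge0 // exprn_ge0 // !mulr_ge0 //; lra.
have d0 : 0 < d.
  rewrite lt_neqAle eq_sym subr_ge0 x1 andbT subr_eq0; apply/eqP => e.
  by move: dn0; rewrite /phi -real_normK ?num_real // -e expr1n subrr sqrtr0 eqxx.
have dle : d <= 1 by rewrite /d; have := normr_ge0 x; lra.
(* One differentiation costs [n ^ 2 / (e / 2)] in the square, with [e = d / (2 V)] the width lost on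
   each side; this is [A / d]. *)
pose A : R := 4 * V%:R * n%:R ^+ 2.
have A0 : 0 <= A by rewrite !mulr_ge0 ?sqr_ge0 //; lra.
have step k : (k <= V)%N -> forall y, -1 + d * k%:R / (2 * V%:R) <= y <= 1 - d * k%:R / (2 * V%:R) ->
    p^`(k).[y] ^+ 2 * d ^+ k <= A ^+ k * M ^+ 2.
  elim: k => [|k IH] kV y.
    rewrite mulr0 mul0r addr0 subr0 derivn0 !expr0 mulr1 mul1r => yI.
    by rewrite -real_normK ?num_real // lerXn2r // ?nnegrE // pM.
  move=> yI; have {}IH := IH (ltnW kV).
  set a := -1 + d * k%:R / (2 * V%:R) in IH *; set b := 1 - d * k%:R / (2 * V%:R) in IH *.
  pose e := d / (2 * V%:R).
  have e0 : 0 < e by rewrite divr_gt0 // mulr_gt0.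
  have kd : d * k%:R / (2 * V%:R) = k%:R * e by rewrite /e; ring.
  have kd1 : d * k.+1%:R / (2 * V%:R) = k%:R * e + e by rewrite -natr1 /e; ring.
  have ke : k%:R * e <= 2^-1.
    have : k%:R / V%:R <= 1 :> R by rewrite ler_pdivrMr // mul1r ler_nat ltnW.
    have -> : k%:R * e = (k%:R / V%:R) * d / 2 by rewrite /e; field; exact: lt0r_neq0.
    have : 0 <= k%:R / V%:R :> R by rewrite divr_ge0 // ler0n.
    nra.
  rewrite kd1 in yI; rewrite /a /b kd in IH; rewrite {a b}.
  have [B B0 B2] : exists2 B, 0 <= B & B ^+ 2 = A ^+ k * M ^+ 2 / d ^+ k.
    exists (Num.sqrt (A ^+ k * M ^+ 2 / d ^+ k)); first exact: sqrtr_ge0.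
    by rewrite sqr_sqrtr // divr_ge0 ?mulr_ge0 ?exprn_ge0 // ltW.
  have pB z : -1 + k%:R * e <= z <= 1 - k%:R * e -> `|p^`(k).[z]| <= B.
    move=> /IH H; rewrite -(@ler_pXn2r _ 2) ?nnegrE // real_normK ?num_real // B2.
    by rewrite ler_pdivlMr // exprn_gt0.
  have ab : -1 + k%:R * e < 1 - k%:R * e by lra.
  have yI' : -1 + k%:R * e <= y <= 1 - k%:R * e by lra.
  have szk : (size p^`(k) <= n.+1)%N by rewrite (leq_trans (size_derivn _ _)).
  have := bernstein_itv n0 szk ab pB yI'.
  rewrite -derivnS exprMn B2 => H.
  (* One end of the interval is at distance at least [e] from [y], and the other at least half the
     length, hence at least [1 / 2]. *)
  have L : e / 2 <= (y - (-1 + k%:R * e)) * (1 - k%:R * e - y) by nra.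
  have {}H : e / 2 * p^`(k.+1).[y] ^+ 2 <= n%:R ^+ 2 * (A ^+ k * M ^+ 2 / d ^+ k).
    by apply: le_trans H; rewrite ler_wpM2r ?sqr_ge0.
  have dk : 0 < d ^+ k by rewrite exprn_gt0.
  rewrite ![_ ^+ k.+1]exprS.
  have -> : p^`(k.+1).[y] ^+ 2 * (d * d ^+ k) = (e / 2 * p^`(k.+1).[y] ^+ 2) * (4 * V%:R * d ^+ k).
    by rewrite /e; field; exact: lt0r_neq0.
  have -> : A * A ^+ k * M ^+ 2 = n%:R ^+ 2 * (A ^+ k * M ^+ 2 / d ^+ k) * (4 * V%:R * d ^+ k).
    by rewrite {1}/A; field; exact: lt0r_neq0.
  by rewrite ler_wpM2r // !mulr_ge0 // ltW.
have {step} H := step V (leqnn _) x.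
have {}H : p^`(V).[x] ^+ 2 * d ^+ V <= A ^+ V * M ^+ 2.
  apply: H; have -> : d * V%:R / (2 * V%:R) = d / 2 by field; exact: lt0r_neq0.
  have : `|x| <= 1 - d / 2 by rewrite /d; lra.
  by rewrite ler_norml; lra.
rewrite -(@ler_pXn2r _ 2) ?nnegrE //; last first.
  by rewrite mulr_ge0 // exprn_ge0 // !mulr_ge0 //; lra.
rewrite real_normK ?num_real // exprMn.
have p2 : phi x ^+ 2 <= 2 * d.
  rewrite phi_sqr //.
  have -> : x ^+ 2 = `|x| ^+ 2 by rewrite real_normK ?num_real.
  by rewrite /d; nra.
rewrite -!exprM [(V * 2)%N]mulnC !exprM.
apply: (@le_trans _ _ ((2 * d) ^+ V * p^`(V).[x] ^+ 2)).
  by rewrite ler_wpM2r ?sqr_ge0 // lerXn2r // ?nnegrE ?sqr_ge0 // mulr_ge0 // ltW.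
rewrite exprMn.
apply: (@le_trans _ _ (2 ^+ V * (A ^+ V * M ^+ 2))).
  by rewrite -mulrA ler_wpM2l ?exprn_ge0 // mulrC.
rewrite mulrA -exprMn [leRHS]exprMn -[_ ^+ V ^+ 2]exprM [(V * 2)%N]mulnC exprM.
rewrite ler_wpM2r ?sqr_ge0 // lerXn2r // ?nnegrE ?mulr_ge0 ?sqr_ge0 //.
rewrite /A; have V1 : 1 <= V%:R :> R by rewrite ler1n.
have : 0 <= V%:R * n%:R ^+ 2 * (V%:R - 1) :> R by rewrite !mulr_ge0 ?sqr_ge0 //; lra.
have : 0 <= V%:R * n%:R ^+ 2 :> R by rewrite !mulr_ge0 ?sqr_ge0 //; lra.
nra.
Qed.

End Bernstein.

(** * Fejér kernels *)

Section Fejer.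
Context {R : realType}.
Implicit Types (p q : {poly R}) (t x : R).

(** With truncated subtraction, [i - j + (j - i)] is [|i - j|]. At [cos t] the double sum is the
    squared modulus of the sum of [exp (i j t)] over [j < N], that is, [N] times the usual Fejér
    kernel, with peak [N ^ 2]. *)
Definition fejer N : {poly R} :=
  \sum_(i < N) \sum_(j < N) cheb (i - j + (j - i)).

Let cosabs (i j : nat) t :
  cos ((i - j + (j - i))%:R * t) = cos (i%:R * t) * cos (j%:R * t) + sin (i%:R * t) * sin (j%:R * t).
Proof.
rewrite -cosB -mulrBl; case: (leqP i j) => ij.
  have -> : (i - j = 0)%N by apply/eqP; rewrite subn_eq0.
  by rewrite add0n natrB // -(cosN (_ * t)); congr cos; ring.
have -> : (j - i = 0)%N by apply/eqP; rewrite subn_eq0 ltnW.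
by rewrite addn0 natrB // ltnW.
Qed.

Lemma fejer_cos N t : (fejer N).[cos t] =
  (\sum_(i < N) cos (i%:R * t)) ^+ 2 + (\sum_(i < N) sin (i%:R * t)) ^+ 2.
Proof.
rewrite /fejer horner_sum !expr2 !mulr_suml -big_split; apply: eq_bigr => i _ /=.
rewrite horner_sum !mulr_sumr -big_split; apply: eq_bigr => j _ /=.
by rewrite cheb_cos cosabs.
Qed.

Lemma fejer_ge0 N t : 0 <= (fejer N).[cos t].
Proof. by rewrite fejer_cos addr_ge0 ?sqr_ge0. Qed.

Lemma fejer_le N t : (fejer N).[cos t] <= N%:R ^+ 2.
Proof.
rewrite /fejer horner_sum; apply: (@le_trans _ _ (\sum_(i < N) \sum_(j < N) 1)).
  apply: ler_sum => i _; rewrite horner_sum; apply: ler_sum => j _.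
  by rewrite cheb_cos cos_le1.
by under eq_bigr do rewrite sumr_const card_ord; rewrite sumr_const card_ord expr2 mulr_natl.
Qed.

Lemma fejer_at0 N : (fejer N).[cos 0] = N%:R ^+ 2.
Proof.
rewrite fejer_cos; under eq_bigr do rewrite mulr0 cos0.
under [X in _ + X ^+ 2]eq_bigr do rewrite mulr0 sin0.
by rewrite !sumr_const card_ord mul0rn expr0n addr0.
Qed.

Lemma fejer_mul N t : (1 - cos t) * (fejer N).[cos t] = 1 - cos (N%:R * t).
Proof.
rewrite fejer_cos; set C := \sum_(i < N) cos _; set S := \sum_(i < N) sin _.
(* Real and imaginary parts of the geometric sum [(1 - z) (1 + ... + z ^ (N - 1)) = 1 - z ^ N] at
   [z = exp (i t)]. *)
have [h1 h2] : (1 - cos t) * C + sin t * S = 1 - cos (N%:R * t) /\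
               (1 - cos t) * S - sin t * C = - sin (N%:R * t).
  rewrite /C /S; elim: N {C S} => [|N [IH1 IH2]].
    by rewrite !big_ord0 mul0r cos0 sin0; split; ring.
  rewrite !big_ord_recr /= !mulrDr opprD.
  have -> : N.+1%:R * t = N%:R * t + t by rewrite -natr1; ring.
  rewrite cosD sinD; split; [move: IH1 | move: IH2];
  set c := \sum_(i < N) cos _; set s := \sum_(i < N) sin _ => IH.
    transitivity ((1 - cos t) * c + sin t * s + (1 - cos t) * cos (N%:R * t) + sin t * sin (N%:R * t)); first by ring.
    by rewrite IH; ring.
  transitivity ((1 - cos t) * s - sin t * c + (1 - cos t) * sin (N%:R * t) - sin t * cos (N%:R * t)); first by ring.
  by rewrite IH; ring.
have e : ((1 - cos t) ^+ 2 + sin t ^+ 2) * (C ^+ 2 + S ^+ 2) =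
   (1 - cos (N%:R * t)) ^+ 2 + sin (N%:R * t) ^+ 2.
  transitivity (((1 - cos t) * C + sin t * S) ^+ 2 + ((1 - cos t) * S - sin t * C) ^+ 2); first by ring.
  by rewrite h1 h2; ring.
have := e; rewrite !sin2cos2; move: (cos t) (cos (N%:R * t)) => c d H.
have : 2 * ((1 - c) * (C ^+ 2 + S ^+ 2)) = 2 * (1 - d).
  transitivity (((1 - c) ^+ 2 + (1 - c ^+ 2)) * (C ^+ 2 + S ^+ 2)); first by ring.
  by rewrite H; ring.
by move/mulfI; apply; rewrite pnatr_eq0.
Qed.

Lemma fejer_decay N t : N%:R ^+ 2 * (1 - cos t) * (fejer N).[cos t] <= 2 * N%:R ^+ 2.
Proof.
rewrite -mulrA fejer_mul mulrC ler_wpM2r ?sqr_ge0 //; have := cos_geN1 (N%:R * t); lra.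
Qed.

Lemma fejer_growth N t : (1 + N%:R ^+ 2 * (1 - cos t)) * (fejer N).[cos t] <= 3 * N%:R ^+ 2.
Proof. by rewrite mulrDl mul1r; have := fejer_decay N t; have := fejer_le N t; lra. Qed.

Lemma size_fejer N : (size (fejer N) <= N)%N.
Proof.
apply: (leq_trans (size_sum _ _ _)); apply/bigmax_leqP => i _.
apply: (leq_trans (size_sum _ _ _)); apply/bigmax_leqP => j _.
apply: leq_trans (size_cheb _) _.
case: (leqP i j) => ij.
  by rewrite (eqP (_ : (i - j == 0)%N)) ?subn_eq0 // add0n (leq_ltn_trans (leq_subr _ _)).
by rewrite [X in (_ + X)%N](eqP (_ : (j - i == 0)%N)) ?subn_eq0 ?(ltnW ij) // addn0 (leq_ltn_trans (leq_subr _ _)).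
Qed.

Lemma fejer_node_sum N m t : (N <= m)%N ->
  \sum_(k < m) (fejer N).[cos (t + k%:R * (2 * pi / m%:R))] = (N * m)%:R.
Proof.
move=> Nm; rewrite /fejer; under eq_bigr do rewrite horner_sum.
rewrite exchange_big /=.
under eq_bigr => i _ do under eq_bigr do rewrite horner_sum.
transitivity (\sum_(i < N) (m%:R : R)); last by rewrite sumr_const card_ord natrM mulr_natl.
apply: eq_bigr => i _; rewrite exchange_big (bigD1 i) //= [X in _ + X]big1 ?addr0.
  rewrite !subnn; under eq_bigr do rewrite addn0 cheb0 hornerE.
  by rewrite sumr_const card_ord.
move=> j ji; under eq_bigr do rewrite cheb_cos.
apply: node_sum; apply/andP; split.
  rewrite addn_gt0 !subn_gt0; have : (val i != val j) by rewrite eq_sym.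
  by case: ltngtP.
case: (leqP i j) => ij.
  by rewrite (eqP (_ : (i - j == 0)%N)) ?subn_eq0 // add0n (leq_ltn_trans (leq_subr _ _)) // (leq_trans _ Nm).
by rewrite [X in (_ + X)%N](eqP (_ : (j - i == 0)%N)) ?subn_eq0 ?(ltnW ij) // addn0
   (leq_ltn_trans (leq_subr _ _)) // (leq_trans _ Nm).
Qed.

Lemma size_fejer_exp N s : (0 < N)%N -> (size (fejer N ^+ s) <= s * N.-1 + 1)%N.
Proof.
move=> N0; apply: leq_trans (size_exp_leq _ _) _.
rewrite addn1 ltnS mulnC leq_mul2l; apply/orP; right.
by rewrite -!subn1 leq_sub2r // size_fejer.
Qed.

(** A translate of an even trigonometric polynomial is no longer even, hence not a polynomial in
    [cos t]; the sum of the two opposite translates is. *)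
Lemma sym_translate (u : {poly R}) t0 : exists2 v : {poly R}, (size v <= size u)%N &
  forall t, v.[cos t] = u.[cos (t - t0)] + u.[cos (t + t0)].
Proof.
have [c uE] := cheb_span (leqnn (size u)).
exists (\sum_(i < size u) (c i * (2 * cos (i%:R * t0))) *: cheb i).
  apply: (leq_trans (size_sum _ _ _)); apply/bigmax_leqP => i _.
  apply: leq_trans (size_scale_leq _ _) _.
  by apply: leq_trans (size_cheb _) _.
move=> t; rewrite [in RHS]uE !horner_sum -big_split /=; apply: eq_bigr => i _.
rewrite !hornerZ !cheb_cos mulrBr mulrDr cosB cosD; ring.
Qed.

Lemma localizer (s n : nat) t0 : (0 < n)%N -> 0 <= t0 <= pi ->
  exists D : {poly R}, [/\ (size D <= s * n + 1)%N, 1 <= D.[cos t0] &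
    forall t, 0 <= t <= pi ->
      0 <= D.[cos t] /\ D.[cos t] * (1 + n%:R ^+ 2 * (1 - cos (t - t0))) ^+ s <= 2 * 3 ^+ s].
Proof.
move=> n0 t0I.
have N0 : 0 < (n%:R : R) ^+ 2 by rewrite exprn_gt0 // ltr0n.
have [v sv vE] := sym_translate (fejer n ^+ s) t0.
exists (((n%:R : R) ^+ 2) ^- s *: v).
have F0 t : 0 <= (fejer n ^+ s).[cos t] by rewrite horner_exp exprn_ge0 // fejer_ge0.
have Ns : 0 < ((n%:R : R) ^+ 2) ^+ s by rewrite exprn_gt0.
split.
- apply: leq_trans (size_scale_leq _ _) _; apply: leq_trans sv _.
  apply: leq_trans (size_fejer_exp s n0) _.
  by rewrite leq_add2r leq_mul2l leq_pred orbT.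
- rewrite hornerZ vE subrr horner_exp fejer_at0 mulrDr mulVf ?lt0r_neq0 // lerDl.
  by rewrite mulr_ge0 // invr_ge0 ltW.
move=> t tI; rewrite hornerZ vE; split.
  by rewrite mulr_ge0 ?addr_ge0 // invr_ge0 ltW.
have key x : cos x <= cos (t - t0) ->
    (fejer n ^+ s).[cos x] * (1 + n%:R ^+ 2 * (1 - cos (t - t0))) ^+ s <= 3 ^+ s * ((n%:R : R) ^+ 2) ^+ s.
  move=> hx; rewrite horner_exp -!exprMn; apply: lerXn2r.
  - by rewrite nnegrE mulr_ge0 ?fejer_ge0 // addr_ge0 // mulr_ge0 ?(ltW N0) // subr_ge0 cos_le1.
  - by rewrite nnegrE mulr_ge0 // ltW.
  apply: le_trans (fejer_growth n x); rewrite mulrC ler_wpM2r ?fejer_ge0 //.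
  by rewrite lerD2l ler_wpM2l ?(ltW N0) // lerD2l lerN2.
rewrite -mulrA ler_pdivrMl // mulrDl.
have k1 := key (t - t0) (lexx _).
(* For both angles in [[0, pi]] the reflected translate is the farther one, so it obeys the same
   decay. *)
have k2 : cos (t + t0) <= cos (t - t0).
  rewrite cosD cosB; have := sin_ge0_pi tI; have := sin_ge0_pi t0I; nra.
have {}k2 := key _ k2.
rewrite mulrC in k1; rewrite mulrC in k2; rewrite mulrC.
by rewrite [in leRHS]mulrCA; lra.
Qed.

Lemma derivn_mul p q v : (p * q)^`(v) = \sum_(i < v.+1) 'C(v, i)%:R *: (p^`(i) * q^`(v - i)).
Proof.
elim: v => [|v IH].
  by rewrite big_ord1 /= bin0 scale1r.
rewrite derivnS IH (raddf_sum (@deriv R)) /=.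
under eq_bigr do rewrite derivZ derivM scalerDr -!derivnS.
rewrite big_split /= [RHS]big_ord_recl [X in _ = X + _]/= bin0 scale1r ?subn0 ?derivn0.
rewrite [X in _ + X]big_ord_recl /= bin0 scale1r ?subn0 ?derivn0 addrCA; congr (_ + _).
transitivity (\sum_(i < v.+1) 'C(v, i)%:R *: (p^`(i.+1) * q^`(v - i))
   + \sum_(i < v.+1) 'C(v, i.+1)%:R *: (p^`(i.+1) * q^`(v - i))).
  congr (_ + _); rewrite [RHS]big_ord_recr /= bin_small // scale0r addr0.
  by apply: eq_bigr => i _; rewrite /bump leq0n add1n add0n -[(q^`(_))^`()]derivnS -subSn ?ltn_ord // subSS.
rewrite -big_split /=; apply: eq_bigr => i _.
by rewrite /bump /= add1n subSS binS natrD scalerDl addrC.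
Qed.

(* Multiplying by a localized kernel makes the polynomial bounded; its
   derivatives are then recovered from Leibniz' rule at [cos t0]. *)
Lemma bernstein_growth (s v : nat) : exists2 C : R, 0 <= C &
  forall n p (E : R) t0 k, (0 < n)%N -> (size p <= n.+1)%N -> 0 <= E -> 0 <= t0 <= pi ->
  (forall t, 0 <= t <= pi -> `|p.[cos t]| <= E * (1 + n%:R ^+ 2 * (1 - cos (t - t0))) ^+ s) ->
  (k <= v)%N -> `|phi (cos t0) ^+ k * p^`(k).[cos t0]| <= C * n%:R ^+ k * E.
Proof.
elim: v => [|v [C C0 IH]].
  exists 1 => // n p E t0 k n0 _ E0 t0I pE; rewrite leqn0 => /eqP ->.
  rewrite !expr0 derivn0 !mul1r; apply: le_trans (pE _ t0I) _.
  by rewrite subrr cos0 subrr mulr0 addr0 expr1n mulr1.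
pose K : R := 2 * 3 ^+ s.
have K0 : 0 <= K by rewrite mulr_ge0 // exprn_ge0.
pose W k : R := (8 * k%:R * s.+1%:R) ^+ k * K.
have W0 k : 0 <= W k by rewrite mulr_ge0 // exprn_ge0 // !mulr_ge0 // ?ler0n.
pose C' : R := W v.+1 + \sum_(i < v.+1) 'C(v.+1, i)%:R * C * W (v.+1 - i)%N.
have S0 : 0 <= \sum_(i < v.+1) 'C(v.+1, i)%:R * C * W (v.+1 - i)%N.
  by apply: sumr_ge0 => i _; rewrite !mulr_ge0 // ?ler0n.
have C'0 : 0 <= C' by rewrite addr_ge0.
exists (C + C') => [|n p E t0 k n0 sp E0 t0I pE kv]; first by rewrite addr_ge0.
have nk : 0 <= n%:R ^+ k * E by rewrite mulr_ge0 ?exprn_ge0 // ler0n.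
rewrite -mulrA.
have [kv'|vk] := leqP k v.
  apply: (le_trans (IH n p E t0 k n0 sp E0 t0I pE kv')).
  by rewrite -mulrA ler_wpM2r // lerDl.
have {kv vk} -> : k = v.+1 by apply/eqP; rewrite eqn_leq kv vk.
have [D [sD D1 HD]] := localizer s n0 t0I.
have x0I : -1 <= cos t0 <= 1 by rewrite cos_geN1 cos_le1.
have dn0 : (0 < s.+1 * n)%N by rewrite muln_gt0.
have DK y : -1 <= y <= 1 -> `|D.[y]| <= K.
  move=> yI; rewrite -(acosK (x := y)) ?in_itv //.
  have aI : 0 <= acos y <= pi by rewrite acos_ge0 ?acos_lepi.
  have [D0 HK] := HD _ aI; rewrite ger0_norm //; apply: le_trans HK.
  rewrite ler_peMr // exprn_ege1 // lerDl mulr_ge0 ?sqr_ge0 // subr_ge0 cos_le1 //.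
have pDK y : -1 <= y <= 1 -> `|(p * D).[y]| <= K * E.
  move=> yI; rewrite -(acosK (x := y)) ?in_itv //.
  have aI : 0 <= acos y <= pi by rewrite acos_ge0 ?acos_lepi.
  have [D0 HK] := HD _ aI; rewrite hornerM normrM (ger0_norm D0).
  apply: (le_trans (ler_wpM2r D0 (pE _ aI))).
  by rewrite -mulrA mulrC ler_wpM2r // mulrC.
have sD' : (size D <= (s.+1 * n).+1)%N.
  by apply: leq_trans sD _; rewrite addn1 ltnS leq_mul2r leqnSn orbT.
have spD : (size (p * D)%R <= (s.+1 * n).+1)%N.
  apply: leq_trans (size_polyMleq _ _) _.
  have := leq_add sp sD; rewrite addn1 addSn addnS mulSn => h.
  by move: h; case: (_ + _)%N => //= u; rewrite ltnS => /leq_trans; apply.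
have PD i := bernstein_higher i dn0 sD' DK x0I.
have PpD i := bernstein_higher i dn0 spD pDK x0I.
set x := cos t0 in x0I D1 PD PpD *; set f := phi x in PD PpD *.
have f0 : 0 <= f by exact: phi_ge0.
have WE i : (8 * i%:R * (s.+1 * n)%:R) ^+ i * K = W i * n%:R ^+ i.
  by rewrite /W natrM mulrA [in LHS]exprMn; ring.
have L : f ^+ v.+1 * p^`(v.+1).[x] * D.[x] = f ^+ v.+1 * (p * D)^`(v.+1).[x] -
    \sum_(i < v.+1) 'C(v.+1, i)%:R * (f ^+ i * p^`(i).[x]) * (f ^+ (v.+1 - i) * D^`(v.+1 - i).[x]).
  rewrite derivn_mul big_ord_recr /= binn scale1r subnn derivn0 hornerD hornerM horner_sum.
  rewrite mulrDr; set T := \sum_(i < v.+1) _ * (_ * _).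
  have H S : S = T -> S + f ^+ v.+1 * (p^`(v.+1).[x] * D.[x]) - T =
      f ^+ v.+1 * (p^`(v.+1).[x] * D.[x]) by move=> ->; rewrite addrAC subrr add0r.
  rewrite H; first by rewrite mulrA.
  rewrite /T mulr_sumr.
  apply: eq_bigr => i _; rewrite hornerZ hornerM.
  have -> : f ^+ v.+1 = f ^+ i * f ^+ (v.+1 - i) by rewrite -exprD subnKC // ltnW.
  by ring.
apply: (@le_trans _ _ (`|f ^+ v.+1 * p^`(v.+1).[x] * D.[x]|)).
  by rewrite [leRHS]normrM ler_peMr // ger0_norm // (le_trans ler01 D1).
rewrite L; apply: le_trans (ler_normB _ _) _.
apply: (@le_trans _ _ (C' * (n%:R ^+ v.+1 * E))); last by rewrite ler_wpM2r ?mulr_ge0 ?exprn_ge0 ?ler0n // lerDr.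
rewrite /C' mulrDl; apply: lerD.
  apply: le_trans (PpD v.+1) _; rewrite mulrA WE.
  by rewrite mulrA.
apply: le_trans (ler_norm_sum _ _ _) _; rewrite mulr_suml; apply: ler_sum => i _.
have h1 := IH n p E t0 i n0 sp E0 t0I pE ltac:(by rewrite -ltnS).
have h2 := PD (v.+1 - i)%N; rewrite WE in h2.
have e : (n%:R : R) ^+ v.+1 = n%:R ^+ i * n%:R ^+ (v.+1 - i) by rewrite -exprD subnKC // ltnW.
rewrite !normrM (ger0_norm (ler0n _ _)); rewrite !normrM in h1 h2.
apply: (@le_trans _ _ ('C(v.+1, i)%:R * (C * n%:R ^+ i * E * (W (v.+1 - i)%N * n%:R ^+ (v.+1 - i))))).
  by rewrite -mulrA ler_wpM2l ?ler0n //; apply: ler_pM => //; rewrite mulr_ge0.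
rewrite e le_eqVlt; apply/orP; left; apply/eqP.
suff H : forall q C a E w b : R, q * (C * a * E * (w * b)) = q * C * w * (a * b * E) by exact: H.
by move=> *; ring.
Qed.

End Fejer.

(** * Interpolation and almost-everywhere bounds *)

Section Interpolation.
Context {R : realType}.
Implicit Types (p q : {poly R}) (x : R) (y v : nat -> R).

Definition lagp (n : nat) y (i : 'I_n) : {poly R} :=
  \prod_(j < n | j != i) ((y i - y j)^-1 *: ('X - (y j)%:P)).

Let card_neq n (i : 'I_n) : #|[pred j : 'I_n | j != i]| = n.-1.
Proof.
have h := cardC (pred1 i); rewrite card1 card_ord in h.
rewrite (congr1 predn (esym h)) add1n /=; apply: eq_card => j; by rewrite !inE.
Qed.

Lemma size_lagp n y (i : 'I_n) : (size (lagp y i) <= n)%N.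
Proof.
rewrite /lagp; apply: leq_trans (size_prod_leq _ _) _.
have cardP := card_neq i.
have n0 : (0 < n)%N by apply: leq_ltn_trans (ltn_ord i).
rewrite leq_subLR cardP.
have : (\sum_(j < n | j != i) size ((y i - y j)^-1 *: ('X - (y j)%:P)) <= \sum_(j < n | j != i) 2)%N.
  apply: leq_sum => j _; apply: leq_trans (size_scale_leq _ _) _; by rewrite size_XsubC.
rewrite sum_nat_const cardP => h.
by apply: leq_ltn_trans h _; rewrite muln2 -addnn ltn_add2l ltn_predL.
Qed.

Lemma lagp_eval n y (i j : 'I_n) : (forall i j : 'I_n, i != j -> y i != y j) ->
  (lagp y i).[y j] = (i == j)%:R.
Proof.
move=> inj; rewrite /lagp horner_prod; have [->|ij] := eqVneq i j.
  by apply: big1 => k kj; rewrite hornerZ !hornerE mulVf // subr_eq0 inj // eq_sym.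
by rewrite (bigD1 j) 1?eq_sym //= hornerZ !hornerE subrr mulr0 mul0r.
Qed.

Lemma interpolation n y v : (forall i j : 'I_n, i != j -> y i != y j) ->
  exists2 q : {poly R}, (size q <= n)%N & forall i : 'I_n, q.[y i] = v i.
Proof.
move=> inj; exists (\sum_(i < n) v i *: lagp y i).
  apply: (leq_trans (size_sum _ _ _)); apply/bigmax_leqP => i _.
  apply: leq_trans (size_scale_leq _ _) _; exact: size_lagp.
move=> i; rewrite horner_sum (bigD1 i) //= big1 ?addr0.
  by rewrite hornerZ lagp_eval // eqxx mulr1.
by move=> j ji; rewrite hornerZ lagp_eval // (negbTE ji) mulr0.
Qed.

Lemma lagrange_eq n y p : (forall i j : 'I_n, i != j -> y i != y j) -> (size p <= n)%N ->
  p = \sum_(i < n) p.[y i] *: lagp y i.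
Proof.
move=> inj sp; apply/eqP; rewrite -subr_eq0; apply/eqP.
set q := \sum_(i < n) _.
have sq : (size q <= n)%N.
  apply: (leq_trans (size_sum _ _ _)); apply/bigmax_leqP => i _.
  apply: leq_trans (size_scale_leq _ _) _; exact: size_lagp.
apply: (@roots_geq_poly_eq0 _ _ [seq y (val i) | i <- enum 'I_n]).
- apply/allP => _ /mapP[i _ ->]; rewrite /root hornerD hornerN horner_sum (bigD1 i) //= big1 ?addr0.
    by rewrite hornerZ lagp_eval // eqxx mulr1 subrr.
  by move=> j ji; rewrite hornerZ lagp_eval // (negbTE ji) mulr0.
- rewrite map_inj_in_uniq ?enum_uniq // => i j _ _ h.
  by apply/eqP; apply: contraT => /inj; rewrite h eqxx.
- rewrite size_map size_enum_ord.
  by apply: leq_trans (size_polyD _ _) _; rewrite geq_max size_polyN sp sq.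
Qed.

Lemma interp_bound n y p (M D e x : R) : 0 < e ->
  (forall i j : 'I_n, i != j -> e <= `|y i - y j|) -> (size p <= n)%N ->
  (forall i : 'I_n, `|p.[y i]| <= M) -> (forall i : 'I_n, `|x - y i| <= D) ->
  `|p.[x]| <= n%:R * (D / e) ^+ n.-1 * M.
Proof.
move=> e0 sep sp pM xD.
have inj (i j : 'I_n) : i != j -> y i != y j.
  by move=> /sep h; apply: contraTneq h => ->; rewrite subrr normr0 -ltNge.
rewrite (lagrange_eq inj sp) horner_sum; apply: le_trans (ler_norm_sum _ _ _) _.
apply: (@le_trans _ _ (\sum_(i < n) (D / e) ^+ n.-1 * M)); last first.
  by rewrite sumr_const card_ord -mulrA mulr_natl.
apply: ler_sum => i _; rewrite hornerZ normrM mulrC.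
have D0 : 0 <= D by apply: le_trans (xD i).
apply: ler_pM => //; rewrite /lagp horner_prod normr_prod.
have cardP := card_neq i.
rewrite -cardP -prodr_const; apply: ler_prod => j ji.
rewrite normr_ge0 /= hornerZ hornerXsubC normrM normfV mulrC.
apply: ler_pM => //.
rewrite lef_pV2 ?posrE //; last by apply: (lt_le_trans e0); apply: sep; rewrite eq_sym.
by apply: sep; rewrite eq_sym.
Qed.

(** Interpolation at [n] points of spacing [l / n]. A bound on a short interval extends to the line
    with a factor polynomial in the relative distance. *)
Lemma poly_growth n p (M a l x : R) : 0 < l -> (size p <= n)%N ->
  (forall z, a <= z <= a + l -> `|p.[z]| <= M) ->
  `|p.[x]| <= n%:R * (n%:R * (`|x - a| + l) / l) ^+ n.-1 * M.
Proof.
case: n => [|n] l0 sp pM.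
  move: sp; rewrite leqn0 size_poly_eq0 => /eqP ->.
  by rewrite horner0 normr0 !mul0r.
have n0 : 0 < n.+1%:R :> R by rewrite ltr0n.
pose y i : R := a + i%:R * (l / n.+1%:R).
have e0 : 0 < l / n.+1%:R by rewrite divr_gt0.
have -> : n.+1%:R * (`|x - a| + l) / l = (`|x - a| + l) / (l / n.+1%:R).
  by field; rewrite !lt0r_neq0.
have yI (i : 'I_n.+1) : a <= y i <= a + l.
  have : 0 <= (i%:R : R) <= n.+1%:R by rewrite ler0n ler_nat ltnW.
  move=> /andP[i0 i1]; apply/andP; split; first by rewrite lerDl mulr_ge0 // ltW.
  by rewrite lerD2l mulrCA ger_pMr // ler_pdivrMr // mul1r.
apply: (@interp_bound n.+1 y) => //.
- move=> i j ij; rewrite /y opprD addrACA subrr add0r -mulrBl normrM (gtr0_norm e0).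
  rewrite ler_peMl ?(ltW e0) //.
  have : (val i != val j) by [].
  by case: ltngtP => // h _; [rewrite distrC|]; rewrite -natrB ?(ltnW h) // normr_nat ler1n subn_gt0.
- by move=> i; exact: pM.
- move=> i; have /andP[h1 h2] := yI i.
  have -> : x - y i = (x - a) + (a - y i) by ring.
  apply: le_trans (ler_normD _ _) _; rewrite lerD2l ler_norml; lra.
Qed.

(** The bound is assumed on [[-1, 2]] so that the factor [(z + 1) (2 - z)] in [bernstein_itv] is at
    least one on [[0, 1]]. *)
Lemma poly_lipschitz n p (M x y : R) : (0 < n)%N -> (size p <= n.+1)%N ->
  (forall z, -1 <= z <= 2 -> `|p.[z]| <= M) -> 0 <= x <= 1 -> 0 <= y <= 1 ->
  `|p.[x] - p.[y]| <= n%:R * M * `|x - y|.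
Proof.
move=> n0 sp pM.
wlog xy : x y / x <= y => [hw xI yI|xI yI].
  have [xy|/ltW yx] := leP x y; first exact: hw.
  by rewrite distrC [X in _ * X]distrC; exact: hw.
have M0 : 0 <= M by apply: le_trans (pM 0 _) => //; lra.
have dp z : 0 <= z <= 1 -> `|p^`().[z]| <= n%:R * M.
  move=> zI; have := bernstein_itv n0 sp (a := -1) (b := 2) ltac:(lra) pM (x := z) ltac:(lra).
  move=> H; rewrite -(@ler_pXn2r _ 2) ?nnegrE ?mulr_ge0 ?ler0n // real_normK ?num_real //.
  apply: le_trans H; rewrite ler_peMl ?sqr_ge0 //; nra.
have [c cI] := @MVT_segment R (horner p) (horner p^`()) x y xy
   (fun z _ => is_derive_poly p z) ltac:(by apply: continuous_subspaceT => z; exact: continuous_horner).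
rewrite distrC => ->; rewrite normrM [in leRHS]distrC ler_wpM2r // dp //.
by move: cI; rewrite in_itv /= => /andP[h1 h2]; lra.
Qed.

End Interpolation.

Section AlmostEverywhere.
Context {R : realType}.
Local Notation mu := (@lebesgue_measure R).

Lemma ae_mono (P Q : R -> Prop) : {ae mu, forall x, P x} ->
  (forall x, P x -> Q x) -> {ae mu, forall x, Q x}.
Proof. by move=> H PQ; apply: negligibleS H => x /= nQ /PQ. Qed.

Lemma ae_conj (P Q : R -> Prop) : {ae mu, forall x, P x} -> {ae mu, forall x, Q x} ->
  {ae mu, forall x, P x /\ Q x}.
Proof.
move=> HP HQ; apply: negligibleS (negligibleU HP HQ) => x /=.
by move=> /not_andP.
Qed.

Lemma ae_forall_nat (P : nat -> R -> Prop) : (forall n, {ae mu, forall x, P n x}) ->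
  {ae mu, forall x, forall n, P n x}.
Proof.
move=> H; apply: negligibleS (negligible_bigcup H) => x /= /existsNP[n Pn].
by exists n.
Qed.

Lemma ae_all (P : R -> Prop) : (forall x, P x) -> {ae mu, forall x, P x}.
Proof. by move=> H; apply: negligibleS (negligible_set0 mu) => x /=; apply; exact: H. Qed.

Lemma ae_exists_itv (P : R -> Prop) (u v : R) : u < v ->
  {ae mu, forall x, P x} -> exists2 x, u < x < v & P x.
Proof.
move=> uv [A [mA A0 PA]]; apply: contrapT => H.
have sub : `]u, v[%classic `<=` A.
  move=> x; rewrite /= in_itv /= => xI; apply: PA => Px; apply: H; by exists x.
have : (mu `]u, v[%classic <= mu A)%E by apply: le_measure => //; rewrite inE.
rewrite A0 lebesgue_measure_itv /= lte_fin uv -EFinB lee_fin; lra.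
Qed.

Lemma ae_poly_bound (p : {poly R}) (M a b : R) : a < b ->
  {ae mu, forall x, a <= x <= b -> `|p.[x]| <= M} ->
  forall x, a <= x <= b -> `|p.[x]| <= M.
Proof.
move=> ab H x xI; rewrite leNgt; apply/negP => Mx.
have := @continuous_horner R p x => /cvgr_dist_lt /(_ (`|p.[x]| - M)).
rewrite subr_gt0 Mx => /(_ isT)/nbhs_ballP[d /= d0 dH].
have uv : Num.max a (x - d) < Num.min b (x + d).
  by rewrite lt_min !gt_max; apply/and3P; split; [apply/andP; split| |]; lra.
have [z /andP[z1 z2] Hz] := ae_exists_itv uv H.
move: z1 z2; rewrite gt_max lt_min => /andP[z1 z2] /andP[z3 z4].
have := dH z; rewrite /ball /= ltr_norml => /(_ ltac:(lra)) h.
have := Hz ltac:(lra).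
have := lerB_dist p.[x] p.[z]; lra.
Qed.

End AlmostEverywhere.

(** * Whitney approximation from almost-everywhere differences *)

Section Whitney.
Context {R : realType}.
Local Notation mu := (@lebesgue_measure R).
Implicit Types (p q : {poly R}) (g : R -> R) (x s M e : R).

Definition fdiff (r : nat) g x s : R :=
  \sum_(i < r.+1) 'C(r, i)%:R * (-1) ^+ (r - i) * g (x + i%:R * s).

Lemma fdiffB r g h x s : fdiff r (fun y => g y - h y) x s = fdiff r g x s - fdiff r h x s.
Proof. by rewrite /fdiff -sumrB; apply: eq_bigr => i _; rewrite mulrBr. Qed.

Lemma fdiffS r g x s : fdiff r.+1 g x s = fdiff r g (x + s) s - fdiff r g x s.
Proof.
rewrite /fdiff [LHS]big_ord_recl [X in _ = _ - X]big_ord_recl opprD.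
rewrite !bin0 !subn0 exprS mulN1r mul1r mulNr mul1r addrCA; congr (_ + _).
transitivity (\sum_(i < r.+1) 'C(r, i)%:R * (-1) ^+ (r - i) * g (x + i.+1%:R * s)
  + \sum_(i < r.+1) 'C(r, i.+1)%:R * (-1) ^+ (r - i) * g (x + i.+1%:R * s)).
  rewrite -big_split /=; apply: eq_bigr => i _.
  by rewrite /bump leq0n add1n subSS binS natrD; ring.
congr (_ + _).
  by apply: eq_bigr => i _; congr (_ * g _); rewrite -natr1; ring.
rewrite big_ord_recr /= bin_small // !mul0r addr0 -sumrN; apply: eq_bigr => i _.
rewrite /bump leq0n add1n.
have -> : (r - i = (r - i.+1).+1)%N by rewrite -subSn ?ltn_ord // subSS.
by rewrite exprS; ring.
Qed.

Lemma fdiff_poly r p x s : (size p <= r)%N -> fdiff r (horner p) x s = 0.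
Proof.
elim: r p x => [|r IH] p x.
  rewrite leqn0 size_poly_eq0 => /eqP ->.
  by rewrite /fdiff big_ord1 horner0 mulr0.
move=> sp; rewrite fdiffS.
pose q := p \Po ('X + s%:P) - p.
have sq : (size q <= r)%N.
  apply/leq_sizeP => j; rewrite leq_eqVlt => /predU1P[<-|rj]; last first.
    rewrite coefB !nth_default ?subrr // ?(leq_trans sp) //.
    by rewrite size_comp_poly2 ?size_XaddC ?(leq_trans sp).
  have [sr|sr] := eqVneq (size p) r.+1; last first.
    have {}sp : (size p <= r)%N by rewrite -ltnS ltn_neqAle sr.
    by rewrite coefB !nth_default ?subrr // size_comp_poly2 ?size_XaddC.
  have h := lead_coef_comp p (q := 'X + s%:P); rewrite size_XaddC in h.
  have {}h := h isT; rewrite lead_coefXaddC expr1n mulr1 /lead_coef in h.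
  by move: h; rewrite size_comp_poly2 ?size_XaddC // sr /= coefB => ->; rewrite subrr.
have := IH q x sq; rewrite /q.
have -> : fdiff r (horner (p \Po ('X + s%:P) - p)) x s =
    fdiff r (fun y => (p \Po ('X + s%:P)).[y] - p.[y]) x s.
  by apply: eq_bigr => i _; rewrite hornerD hornerN.
rewrite fdiffB => <-; congr (_ - _); apply: eq_bigr => i _; congr (_ * _).
by rewrite horner_comp hornerD hornerX hornerC; congr (_.[_]); ring.
Qed.

Lemma sum_bin r : \sum_(i < r.+1) 'C(r, i)%:R = 2 ^+ r :> R.
Proof.
have := exprDn (1 : R) 1 r; rewrite (_ : 1 + 1 = 2) // => ->.
by apply: eq_bigr => i _; rewrite !expr1n mulr1.
Qed.

(** The top term of each difference has coefficient one, hence it is at most [e] plus [2 ^ r] times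
    a bound for the preceding terms. *)
Lemma small_differences r (u : nat -> R) e K : 0 <= e ->
  (forall k, (k < r)%N -> u k = 0) ->
  (forall k, (k + r <= K)%N ->
     `|\sum_(i < r.+1) 'C(r, i)%:R * (-1) ^+ (r - i) * u (k + i)%N| <= e) ->
  forall k, (k <= K)%N -> `|u k| <= (2 ^+ r + 1) ^+ k * e.
Proof.
move=> e0 u0 du; elim/ltn_ind => k IH kK.
pose B : R := 2 ^+ r + 1.
have B1 : 1 <= B by rewrite /B lerDr exprn_ge0.
have [kr|rk] := ltnP k r; first by rewrite u0 // normr0 mulr_ge0 // exprn_ge0 // (le_trans ler01).
have [r0|r0] := posnP r.
  have := du k; rewrite r0 addn0 => /(_ kK).
  rewrite big_ord1 bin0 expr0 !mul1r addn0 => h; apply: le_trans h _.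
  by rewrite ler_peMl // exprn_ege1 // lerDl.
have := du (k - r)%N; rewrite subnK // => /(_ kK).
rewrite big_ord_recr /= binn subnn expr0 !mul1r subnK //.
set S := \sum_(i < r) _ => h.
have hS : `|S| <= 2 ^+ r * (B ^+ k.-1 * e).
  apply: le_trans (ler_norm_sum _ _ _) _.
  apply: (@le_trans _ _ (\sum_(i < r) 'C(r, i)%:R * (B ^+ k.-1 * e))).
    apply: ler_sum => i _; rewrite !normrM normrX normrN1 expr1n mulr1 (ger0_norm (ler0n _ _)).
    have ik : (k - r + i < k)%N.
      by rewrite -{2}(subnK rk) ltn_add2l ltn_ord.
    rewrite ler_wpM2l ?ler0n //; apply: le_trans (IH _ ik _) _; first by rewrite (leq_trans (ltnW ik)).
    by rewrite ler_wpM2r // ler_weXn2l // -ltnS prednK // (leq_ltn_trans _ ik).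
  rewrite -mulr_suml ler_wpM2r ?mulr_ge0 ?exprn_ge0 ?(le_trans ler01 B1) //.
  by rewrite -sum_bin big_ord_recr /= lerDl ler0n.
have k0 : (0 < k)%N by rewrite (leq_trans r0).
have -> : B ^+ k * e = B * (B ^+ k.-1 * e) by rewrite -{1}(prednK k0) exprS mulrA.
have -> : u k = (S + u k) - S by ring.
apply: le_trans (ler_normB _ _) _.
have h1 : 1 <= B ^+ k.-1 by rewrite exprn_ege1.
have h2 : e <= B ^+ k.-1 * e by rewrite ler_peMl.
have h3 : B * (B ^+ k.-1 * e) = 2 ^+ r * (B ^+ k.-1 * e) + B ^+ k.-1 * e by rewrite {1}/B mulrDl mul1r.
lra.
Qed.

Let ler_sum_const n (F : 'I_n -> R) M : (forall i, F i <= M) -> \sum_(i < n) F i <= n%:R * M.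
Proof.
move=> H; apply: le_trans (ler_sum _ (fun i _ => H i)) _.
by rewrite sumr_const card_ord mulr_natl.
Qed.

(** The step is quantified before the point, which suits the choice of one generic step for a whole
    grid; [small_diff_swap] provides the opposite order, which suits averaging over the step. *)
Definition small_diff r g e : Prop :=
  {ae mu, forall s, {ae mu, forall x,
     0 < s -> 0 <= x -> x + r%:R * s <= 1 -> `|fdiff r g x s| <= e}}.

Lemma measurable_affine2 (i : R) :
  measurable_fun setT (fun z : measurableTypeR R * measurableTypeR R => z.1 + i * z.2).
Proof.
apply: measurable_funD; first exact: measurable_fst.
apply: measurable_funM; first exact: measurable_cst.
exact: measurable_snd.
Qed.

Lemma small_diff_swap r g e : measurable_fun setT g -> small_diff r g e ->
  {ae mu, forall x, {ae mu, forall s,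
     0 < s -> 0 <= x -> x + r%:R * s <= 1 -> `|fdiff r g x s| <= e}}.
Proof.
move=> mg H.
pose F := fun z : measurableTypeR R * measurableTypeR R =>
  [&& 0 < z.2, 0 <= z.1, z.1 + r%:R * z.2 <= 1 & e < `|fdiff r g z.1 z.2|].
have mF : measurable_fun setT F.
  apply: measurable_and.
    by apply: measurable_fun_ltr; [exact: measurable_cst|exact: measurable_snd].
  apply: measurable_and.
    by apply: measurable_fun_ler; [exact: measurable_cst|exact: measurable_fst].
  apply: measurable_and.
    by apply: measurable_fun_ler; [exact: measurable_affine2|exact: measurable_cst].
  apply: measurable_fun_ltr; first exact: measurable_cst.
  apply: measurableT_comp; first exact: normr_measurable.
  apply: measurable_sum => i; apply: measurable_funM; first exact: measurable_cst.
  by apply: measurableT_comp mg _; exact: measurable_affine2.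
pose B : set (measurableTypeR R * measurableTypeR R) := F @^-1` [set true].
have mB : measurable B by rewrite -[B]setTI; apply: mF => //.
have : {ae mu, forall s, {ae mu, forall x, ~ B (x, s)}}.
  apply: (ae_mono H) => s Hs; apply: (ae_mono Hs) => x Hx.
  by rewrite /B /= /F /= => /and4P[s0 x0 xs]; rewrite ltNge Hx.
move=> /(ae_swap mB) H2; apply: (ae_mono H2) => x Hx; apply: (ae_mono Hx) => s Bx s0 x0 xs.
rewrite leNgt; apply/negP => h; apply: Bx.
by rewrite /B /= /F /= s0 x0 xs h.
Qed.

Lemma Rintegral_sum_bounded (n : nat) (G : nat -> R -> R) M a b :
  (forall i, measurable_fun setT (G i)) -> (forall i x, `|G i x| <= M) ->
  \int[mu]_(x in `[a, b]) (\sum_(i < n) G i x) = \sum_(i < n) \int[mu]_(x in `[a, b]) G i x.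
Proof.
move=> mG GM; elim: n => [|n IH].
  rewrite big_ord0 -[RHS](mul0r (fine (mu `[a, b]%classic))) -Rintegral_cst //.
  by apply: eq_Rintegral => x _; rewrite big_ord0.
rewrite big_ord_recr /= -IH.
transitivity (\int[mu]_(x in `[a, b]) (\sum_(i < n) G i x + G n x)).
  by apply: eq_Rintegral => x _; rewrite big_ord_recr.
apply: RintegralD => //; last exact: bounded_integrable.
apply: (@bounded_integrable _ _ (n%:R * M)).
  by apply: measurable_sum => i.
move=> x; apply: le_trans (ler_norm_sum _ _ _) _.
exact: ler_sum_const.
Qed.

Lemma lebesgue_itvcc (a b : R) : a <= b -> mu `[a, b]%classic = (b - a)%:E.
Proof.
move=> ab; rewrite lebesgue_measure_itv /= lte_fin; case: ltP => // ba.
congr EFin; lra.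
Qed.

Lemma Rintegral_ae_bound g M e a b : measurable_fun setT g -> (forall x, `|g x| <= M) ->
  0 <= e -> a <= b -> {ae mu, forall x, a <= x <= b -> `|g x| <= e} ->
  `|\int[mu]_(x in `[a, b]) g x| <= e * (b - a).
Proof.
move=> mg gM e0 ab H.
have ig := bounded_integrable a b mg gM.
have mD : measurable (`[a, b]%classic : set (measurableTypeR R)) by exact: measurable_itv.
have h := le_normr_Rintegral mD ig.
apply: (le_trans h).
have fe : (\int[mu]_(x in `[a, b]) e%:E = (e * (b - a))%:E)%E.
  rewrite integral_cst // EFinM; congr (_ * _)%E.
  exact: lebesgue_itvcc.
have le : (\int[mu]_(x in `[a, b]) `|(g x)%:E| <= \int[mu]_(x in `[a, b]) e%:E)%E.
  apply: ae_ge0_le_integral => //.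
  - by apply: measurableT_comp => //; apply/measurable_EFinP; exact: measurable_funS mg.
rewrite fe in le.
have f0 : (0 <= \int[mu]_(x in `[a, b]) `|(g x)%:E|)%E by apply: integral_ge0.
rewrite /Rintegral -lee_fin fineK //.
by rewrite ge0_fin_numE // (le_lt_trans le) // ltry.
Qed.

(** [2 ^ r] bounds the sum of the binomials, the factor 2 is that of [Rintegral_shift_le], and [6 r]
    is the inverse length of the window of steps. *)
Let C1 r : R := 2 ^+ r * 2 * (6 * r%:R).

(* Averaging the r-th difference over the step s expresses g x, up to e, as a
   combination of the means of [s |-> g (x + i s)], i > 0; translating x by d
   amounts to translating s by [d / i], so these means are Lipschitz in x. *)
Lemma almost_lipschitz_left r g M e : (0 < r)%N -> 0 <= e ->
  measurable_fun setT g -> (forall x, `|g x| <= M) -> small_diff r g e ->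
  exists2 P : R -> Prop, {ae mu, forall x, P x} &
    forall x y, P x -> P y -> 0 <= x <= 2 / 3 -> 0 <= y <= 2 / 3 ->
      `|g x - g y| <= 2 * e + C1 r * M * `|x - y|.
Proof.
move=> r0 e0 mg gM H.
have r1 : 1 <= r%:R :> R by rewrite ler1n.
have rp : 0 < r%:R :> R by rewrite ltr0n.
eexists; first exact: (small_diff_swap mg H).
move=> x y Px Py xI yI.
(* On this window of steps [r s <= 1 / 3], so every sample point stays below one when
   [x <= 2 / 3]. *)
pose a : R := (6 * r%:R)^-1; pose b : R := (3 * r%:R)^-1.
have ra : r%:R * a = 6^-1 by rewrite /a; field; exact: lt0r_neq0.
have rb : r%:R * b = 3^-1 by rewrite /b; field; exact: lt0r_neq0.
have a0 : 0 < a by rewrite invr_gt0 mulr_gt0.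
have ba : b - a = a by rewrite /a /b; field; exact: lt0r_neq0.
have ab : a <= b by lra.
pose Gz z i s := 'C(r, i)%:R * (-1) ^+ (r - i) * g (z + i%:R * s).
have mGz z i : measurable_fun setT (Gz z i).
  apply: measurable_funM; first exact: measurable_cst.
  by apply: measurableT_comp mg _; exact: affine_measurable.
have M0 : 0 <= M by apply: le_trans (gM 0).
have GzM z i s : `|Gz z i s| <= 2 ^+ r * M.
  rewrite /Gz !normrM normrX normrN1 expr1n mulr1 (ger0_norm (ler0n _ _)).
  apply: ler_pM => //.
  have [ir|ri] := ltnP i r.+1; last by rewrite bin_small // exprn_ge0.
  by rewrite -sum_bin (bigD1 (Ordinal ir)) //= lerDl sumr_ge0 // => j _; rewrite ler0n.
have mf z : measurable_fun setT (fdiff r g z) by apply: measurable_sum => i; exact: mGz.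
have fM z s : `|fdiff r g z s| <= r.+1%:R * (2 ^+ r * M).
  apply: le_trans (ler_norm_sum _ _ _) _.
  apply: ler_sum_const => i; exact: GzM.
have bnd z : 0 <= z <= 2 / 3 ->
    {ae mu, forall s, 0 < s -> 0 <= z -> z + r%:R * s <= 1 -> `|fdiff r g z s| <= e} ->
    `|\int[mu]_(s in `[a, b]) fdiff r g z s| <= e * a.
  move=> zI Hz; rewrite -[in leRHS]ba.
  apply: (Rintegral_ae_bound (mf z) (fM z)) => //.
  apply: (ae_mono Hz) => s Hs /andP[s1 s2]; apply: Hs; [lra|lra|].
  have : r%:R * s <= r%:R * b by rewrite ler_wpM2l // ltW.
  lra.
have {Px} hx := bnd x xI Px; have {Py bnd} hy := bnd y yI Py.
have dec z : \int[mu]_(s in `[a, b]) fdiff r g z s = (-1) ^+ r * g z * a +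
    \sum_(i < r) \int[mu]_(s in `[a, b]) Gz z i.+1 s.
  rewrite (Rintegral_sum_bounded r.+1 a b (mGz z) (GzM z)) big_ord_recl; congr (_ + _).
  transitivity (\int[mu]_(s in `[a, b]) ((-1) ^+ r * g z)).
    by apply: eq_Rintegral => s _; rewrite /Gz bin0 mul1r subn0 mul0r addr0.
  rewrite Rintegral_cst //; congr (_ * _); rewrite -[RHS]ba.
  exact: (congr1 fine (lebesgue_itvcc ab)).
have shift (i : 'I_r) : `|\int[mu]_(s in `[a, b]) Gz x i.+1 s - \int[mu]_(s in `[a, b]) Gz y i.+1 s|
    <= 'C(r, i.+1)%:R * (2 * M * `|x - y|).
  have ip : 0 < i.+1%:R :> R by rewrite ltr0n.
  pose h s := g (y + i.+1%:R * s).
  have mh : measurable_fun setT h by apply: measurableT_comp mg _; exact: affine_measurable.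
  have ih := bounded_integrable a b mh (fun s => gM _).
  pose d := (x - y) / i.+1%:R.
  pose h' s := h (d + s).
  have mh' : measurable_fun setT h'.
    have -> : h' = h \o (fun s => d + 1 * s) by apply/funext => s; rewrite /h' /= mul1r.
    by apply: measurableT_comp mh _; exact: affine_measurable.
  have ih' := bounded_integrable a b mh' (fun s => gM _).
  pose c : R := 'C(r, i.+1)%:R * (-1) ^+ (r - i.+1).
  have -> : \int[mu]_(s in `[a, b]) Gz y i.+1 s = c * \int[mu]_(s in `[a, b]) h s.
    by rewrite -RintegralZl.
  have -> : \int[mu]_(s in `[a, b]) Gz x i.+1 s = c * \int[mu]_(s in `[a, b]) h' s.
    rewrite -RintegralZl //; apply: eq_Rintegral => s _; rewrite /Gz /h' /h /d; congr (_ * g _).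
    by field; exact: lt0r_neq0.
  rewrite -mulrBr normrM /c normrM normrX normrN1 expr1n mulr1 (ger0_norm (ler0n _ _)).
  rewrite ler_wpM2l ?ler0n //.
  apply: le_trans (Rintegral_shift_le d mh (fun s => gM _) ab) _.
  rewrite ler_wpM2l ?mulr_ge0 // /d normrM normfV (gtr0_norm ip) ler_pdivrMr // ler_peMr //.
  by rewrite ler1n.
have sumb : `|\sum_(i < r) \int[mu]_(s in `[a, b]) Gz x i.+1 s -
     \sum_(i < r) \int[mu]_(s in `[a, b]) Gz y i.+1 s| <= 2 ^+ r * (2 * M * `|x - y|).
  rewrite -sumrB; apply: le_trans (ler_norm_sum _ _ _) _.
  apply: (@le_trans _ _ (\sum_(i < r) 'C(r, i.+1)%:R * (2 * M * `|x - y|))); first exact: ler_sum.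
  rewrite -mulr_suml ler_wpM2r ?mulr_ge0 //.
  rewrite -sum_bin big_ord_recl /= bin0 lerDr; exact: ler01.
rewrite !dec in hx hy.
move: sumb hx hy; set Sx := \sum_(i < r) \int[mu]_(s in _) Gz x _ _.
set Sy := \sum_(i < r) _; move=> sumb hx hy.
have -> : `|g x - g y| = `|(-1) ^+ r * (g x - g y) * a| * (6 * r%:R).
  rewrite !normrM normrX normrN1 expr1n mul1r (gtr0_norm a0) /a.
  by field; exact: lt0r_neq0.
have -> : (-1) ^+ r * (g x - g y) * a =
  ((-1) ^+ r * g x * a + Sx) - ((-1) ^+ r * g y * a + Sy) - (Sx - Sy) by ring.
apply: (@le_trans _ _ ((e * a + e * a + 2 ^+ r * (2 * M * `|x - y|)) * (6 * r%:R))).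
  rewrite ler_wpM2r ?mulr_ge0 //.
  apply: le_trans (ler_normB _ _) _; apply: lerD sumb.
  by apply: le_trans (ler_normB _ _) _; apply: lerD.
rewrite le_eqVlt; apply/orP; left; apply/eqP; rewrite /C1 /a.
by field; exact: lt0r_neq0.
Qed.

Lemma small_diff_reflect r g e : small_diff r g e -> small_diff r (fun x => g (1 - x)) e.
Proof.
have sg (a b : nat) : (a <= b)%N -> (-1) ^+ a = (-1) ^+ b * (-1) ^+ (b - a) :> R.
  move=> h; rewrite -{1}(subnKC h) exprD -mulrA -exprD addnn -[X in _ * X]signr_odd odd_double.
  by rewrite expr0 mulr1.
move=> H; apply: (ae_mono H) => s Hs.
have := ae_affine (1 - r%:R * s) (_ : -1 != 0) Hs; rewrite oppr_eq0 oner_eq0 => /(_ isT) Hs'.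
apply: (ae_mono Hs') => x Hx s0 x0 xs.
have := Hx s0 ltac:(lra) ltac:(lra); apply: le_trans.
rewrite le_eqVlt; apply/orP; left; apply/eqP.
have -> : fdiff r (fun x => g (1 - x)) x s = (-1) ^+ r * fdiff r g (1 - r%:R * s + -1 * x) s.
  rewrite /fdiff mulr_sumr (reindex_inj rev_ord_inj); apply: eq_bigr => i _ /=.
  have ir : (i <= r)%N by rewrite -ltnS.
  rewrite subSS bin_sub // subKn //.
  have -> : 1 - (x + (r - i)%:R * s) = 1 - r%:R * s + -1 * x + i%:R * s by rewrite natrB //; ring.
  rewrite (sg _ _ ir).
  suff E : forall c a b k : R, c * (a * b) * k = a * (c * b * k) by exact: E.
  by move=> *; ring.
by rewrite normrM normrX normrN1 expr1n mul1r.
Qed.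

(** Two points at distance at most [1 / 3] lie both in [[0, 2 / 3]] or both in [[1 / 3, 1]]; the
    second case is the first one for the reflected function. *)
Lemma almost_lipschitz r g M e : (0 < r)%N -> 0 <= e ->
  measurable_fun setT g -> (forall x, `|g x| <= M) -> small_diff r g e ->
  exists2 P : R -> Prop, {ae mu, forall x, P x} &
    forall x y, P x -> P y -> 0 <= x <= 1 -> 0 <= y <= 1 -> `|x - y| <= 3^-1 ->
      `|g x - g y| <= 2 * e + C1 r * M * `|x - y|.
Proof.
move=> r0 e0 mg gM H.
have [P aP HP] := almost_lipschitz_left r0 e0 mg gM H.
have mg' : measurable_fun setT (fun x => g (1 - x)).
  have -> : (fun x => g (1 - x)) = g \o (fun x => 1 + -1 * x).
    by apply/funext => x /=; rewrite mulN1r.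
  by apply: measurableT_comp mg _; exact: affine_measurable.
have [Q aQ HQ] := almost_lipschitz_left r0 e0 mg' (fun x => gM _) (small_diff_reflect H).
exists (fun x => P x /\ Q (1 - x)).
  apply: ae_conj => //.
  have := ae_affine 1 (_ : -1 != 0) aQ; rewrite oppr_eq0 oner_eq0 => /(_ isT) aQ'.
  by apply: (ae_mono aQ') => x; rewrite mulN1r.
move=> x y [Px Qx] [Py Qy] xI yI; rewrite ler_norml => xy.
have eqd : `|1 - x - (1 - y)| = `|x - y| by rewrite -normrN; congr (`|_|); ring.
have [x3|x3] := leP x (2 / 3); have [y3|y3] := leP y (2 / 3).
- by apply: HP => //; lra.
- have := HQ _ _ Qx Qy ltac:(lra) ltac:(lra); rewrite !subKr.
  by rewrite eqd.
- have := HQ _ _ Qx Qy ltac:(lra) ltac:(lra); rewrite !subKr.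
  by rewrite eqd.
- have := HQ _ _ Qx Qy ltac:(lra) ltac:(lra); rewrite !subKr.
  by rewrite eqd.
Qed.


(* Contraction: on a grid of fixed mesh 1/D the function is close to its
   interpolating polynomial, and off the grid both vary by less than M/4. *)
Lemma whitney_contraction r : (0 < r)%N -> exists2 C2 : R, 0 <= C2 &
  forall g M e, 0 <= e -> measurable_fun setT g -> (forall x, `|g x| <= M) ->
    small_diff r g e ->
    exists2 q : {poly R}, (size q <= r)%N &
      {ae mu, forall x, 0 <= x <= 1 -> `|g x - q.[x]| <= M / 2 + C2 * e}.
Proof.
move=> r0.
have rp : 0 < r%:R :> R by rewrite ltr0n.
have r1 : 1 <= r%:R :> R by rewrite ler1n.
pose K : R := r%:R * (8 * r%:R) ^+ r.-1.
have K0 : 0 <= K by rewrite mulr_ge0 // exprn_ge0 // mulr_ge0.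
pose Cr : R := r%:R * K.
have Cr0 : 0 <= Cr by rewrite mulr_ge0 // ltW.
have C10 : 0 <= C1 r by rewrite /C1 !mulr_ge0 // ?exprn_ge0.
(* Large enough for [(C1 r + Cr) / D <= 1 / 2], which is the contraction factor; the summand 3 makes
   the mesh at most [1 / 3], as [almost_lipschitz] requires, and leaves room for the sample points
   in [[0, 1]]. *)
have [D' D'big] : exists D' : nat, 2 * (C1 r + Cr) + 3 <= D'%:R.
  exists (Num.truncn (2 * (C1 r + Cr) + 3)).+1; apply/ltW/truncnS_gt.
(* Thus [r] grid points taken [D'] steps apart stay in [[0, 1]] and are separated by at least
   [1 / (4 r)], independently of [D']; this keeps [K] independent of the mesh. *)
pose D : nat := (2 * r * D')%N.
have DE : D%:R = 2 * r%:R * D'%:R :> R by rewrite /D !natrM.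
have D'3 : 3 <= D'%:R :> R by lra.
have D'0 : 0 < D'%:R :> R by lra.
have DD : D'%:R <= D%:R :> R by rewrite DE ler_peMl ?ltW //; lra.
have D0 : 0 < D%:R :> R by lra.
(* A step above [1 / (2 D)] leaves no grid point of index beyond [2 D] in [[0, 1]]. *)
pose CD : R := (2 ^+ r + 1) ^+ (2 * D).
have CD0 : 0 <= CD by rewrite exprn_ge0 // addr_ge0 // exprn_ge0.
exists (2 + 2 * CD) => [|g M e e0 mg gM H]; first by rewrite addr_ge0 // mulr_ge0.
have M0 : 0 <= M by apply: le_trans (gM 0).
have [P aP HP] := almost_lipschitz r0 e0 mg gM H.
(* The step is only pinned to an interval, so that it can avoid the null set of bad steps. *)
have [s sI Hs] : exists2 s, (2 * D%:R)^-1 < s < D%:R^-1 &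
    {ae mu, forall x, 0 < s -> 0 <= x -> x + r%:R * s <= 1 -> `|fdiff r g x s| <= e}.
  by apply: ae_exists_itv H; rewrite ltf_pV2 ?posrE ?mulr_gt0 //; lra.
move: sI => /andP[sl su].
have s0 : 0 < s by apply: lt_trans sl; rewrite invr_gt0 mulr_gt0.
have sl' : 1 < s * (2 * D%:R) by rewrite -ltr_pdivrMr ?mulr_gt0 // mul1r.
have su' : s * D%:R < 1 by rewrite -ltr_pdivlMr // mul1r.
(* Likewise the offset of the grid: a countable intersection makes all points [x0 + k s] good at
   once. *)
have [x0 /andP[x00 x0s] Hx0] : exists2 x, 0 < x < s &
    forall k : nat, P (x + k%:R * s) /\
      (0 < s -> 0 <= x + k%:R * s -> x + k%:R * s + r%:R * s <= 1 -> `|fdiff r g (x + k%:R * s) s| <= e).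
  apply: ae_exists_itv => //; apply: ae_forall_nat => k.
  have A := ae_affine (k%:R * s) (oner_neq0 R) (ae_conj aP Hs).
  by apply: (ae_mono A) => x; rewrite mul1r [k%:R * s + x]addrC.
pose y (k : nat) : R := x0 + k%:R * s.
pose u (k : nat) : R := g (y k).
have yinj (i j : 'I_r) : i != j -> y i != y j.
  move=> ij; rewrite /y (inj_eq (addrI _)) (inj_eq (mulIf (lt0r_neq0 s0))) eqr_nat.
  by [].
have [q sq qE] := interpolation u yinj.
have yS k i : y (k + i)%N = y k + i%:R * s by rewrite /y natrD; ring.
have Kk k : y k <= 1 -> (k <= 2 * D)%N.
  move=> h; rewrite leqNgt; apply/negP => kD.
  have : (2 * D)%:R + 1 <= k%:R :> R by rewrite natr1 ler_nat.
  rewrite natrM => h2; move: h; rewrite /y.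
  have : (2 * D%:R) * s <= k%:R * s by rewrite ler_wpM2r ?(ltW s0) //; lra.
  lra.
have grid k : y k <= 1 -> `|u k - q.[y k]| <= CD * e.
  move=> yk; have kD := Kk k yk.
  have : `|u k - q.[y k]| <= (2 ^+ r + 1) ^+ k * e.
    apply: (@small_differences r (fun k => u k - q.[y k]) e k e0 _ _ k (leqnn k)).
      by move=> i ir; rewrite (qE (Ordinal ir)) subrr.
    move=> i ik; have [_ Hd] := Hx0 i; rewrite -/(y i) in Hd.
    have yi : y i + r%:R * s <= 1.
      rewrite -yS; apply: le_trans yk; rewrite /y lerD2l ler_wpM2r ?(ltW s0) // ler_nat.
      by [].
    have yi0 : 0 <= y i by rewrite /y addr_ge0 ?mulr_ge0 // ltW.
    have := Hd s0 yi0 yi; rewrite -[fdiff _ _ _ _]subr0 -[X in _ - X](fdiff_poly (y i) s sq) -fdiffB.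
    apply: le_trans; rewrite le_eqVlt; apply/orP; left; apply/eqP; congr (`|_|).
    by apply: eq_bigr => j _; rewrite /u yS.
  move=> h; apply: le_trans h _; rewrite ler_wpM2r // ler_weXn2l //.
  by rewrite lerDr exprn_ge0.
have q_le z : -1 <= z <= 2 -> `|q.[z]| <= K * (M + CD * e).
  move=> zI; pose Y (j : nat) := y (j * D')%N.
  have Y1 (j : 'I_r) : 0 <= Y j <= 1.
    rewrite /Y /y addr_ge0 ?mulr_ge0 ?(ltW x00) ?(ltW s0) //=.
    have : j%:R + 1 <= r%:R :> R by rewrite natr1 ler_nat.
    rewrite natrM => jr; have : s * D'%:R * (j%:R + 1) <= s * D'%:R * r%:R.
      by rewrite ler_wpM2l // mulr_ge0 ?(ltW s0) // ltW.
    move: su'; rewrite DE => h1 h2.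
    have : 3 * s <= s * D'%:R by rewrite mulrC ler_wpM2l // ltW.
    lra.
  have sep : (4 * r%:R)^-1 <= s * D'%:R.
    rewrite -[leLHS]mul1r ler_pdivrMr ?mulr_gt0 //.
    by move: sl'; rewrite DE => h; lra.
  have e4 : 0 < (4 * r%:R)^-1 :> R by rewrite invr_gt0 mulr_gt0.
  have -> : K = r%:R * (2 / (4 * r%:R)^-1) ^+ r.-1.
    by rewrite /K invrK; congr (_ * _ ^+ _); ring.
  apply: (@interp_bound _ r Y) => //.
  - move=> i j ij; apply: le_trans sep _.
    have -> : Y i - Y j = (i%:R - j%:R) * (s * D'%:R) by rewrite /Y /y !natrM; ring.
    rewrite normrM (ger0_norm (_ : 0 <= s * D'%:R)); last by rewrite mulr_ge0 // ltW.
    rewrite ler_peMl //; first by rewrite mulr_ge0 // ltW.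
    have : (val i != val j) by [].
    by case: ltngtP => // h _; [rewrite distrC|]; rewrite -natrB ?(ltnW h) // normr_nat ler1n subn_gt0.
  - move=> j; have /andP[h1 h2] := Y1 j.
    have h3 := grid _ h2; have h4 := gM (Y j).
    have -> : q.[Y j] = g (Y j) - (g (Y j) - q.[Y j]) by ring.
    by apply: le_trans (ler_normB _ _) _; apply: lerD.
  - by move=> j; have := Y1 j; rewrite ler_norml; lra.
exists q => //; apply: (ae_mono aP) => z Pz zI.
have s1 : s < 1.
  by have : s * 1 <= s * D%:R by [rewrite ler_wpM2l ?(ltW s0) //; lra]; lra.
have qlip := poly_lipschitz r0 (leq_trans sq (leqnSn r)) q_le.
have [k yk1 yk2] : exists2 k : nat, y k <= 1 & `|z - y k| <= s.
  have [zx|xz] := leP z x0.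
    exists 0%N; first by rewrite /y mul0r addr0; lra. 
    by rewrite /y mul0r addr0 ler_norml; lra.
  pose k := Num.truncn ((z - x0) / s).
  have zs : 0 <= (z - x0) / s by rewrite divr_ge0 ?ltW // subr_gt0.
  have := truncn_itv zs; rewrite -/k => /andP[k1 k2].
  rewrite ler_pdivlMr // in k1; rewrite ltr_pdivrMr // -natr1 in k2.
  exists k; rewrite /y; first lra.
  by rewrite ler_norml; lra.
have sD : s <= D%:R^-1 by exact: ltW.
have D3 : D%:R^-1 <= 3^-1 :> R by rewrite lef_pV2 ?posrE //; lra.
have yk0 : 0 <= y k by rewrite /y addr_ge0 ?mulr_ge0 // ltW.
have h1 := HP z (y k) Pz (Hx0 k).1 zI ltac:(lra) ltac:(lra).
have h2 := grid k yk1.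
have h3 := qlip (y k) z ltac:(lra) zI.
rewrite [`|y k - z|]distrC in h3.
have h4 : C1 r * M * `|z - y k| <= C1 r * M * D%:R^-1.
  by rewrite ler_wpM2l ?mulr_ge0 //; lra.
have h5 : r%:R * (K * (M + CD * e)) * `|z - y k| <= Cr * (M + CD * e) * D%:R^-1.
  rewrite mulrA -/Cr ler_wpM2l ?mulr_ge0 ?addr_ge0 ?mulr_ge0 //; lra.
have -> : g z - q.[z] = (g z - g (y k)) + (u k - q.[y k]) + (q.[y k] - q.[z]).
  by rewrite /u; ring.
apply: le_trans (ler_normD _ _) _.
have := ler_normD (g z - g (y k)) (u k - q.[y k]).
have small : (C1 r + Cr) * D%:R^-1 <= 2^-1.
  by rewrite ler_pdivrMr //; lra.
have CrD : Cr * D%:R^-1 <= 1.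
  by rewrite ler_pdivrMr //; lra.
have h6 : (C1 r + Cr) * D%:R^-1 * M <= 2^-1 * M by rewrite ler_wpM2r.
have h7 : Cr * D%:R^-1 * (CD * e) <= 1 * (CD * e) by rewrite ler_wpM2r // mulr_ge0.
have h8 : Cr * (M + CD * e) * D%:R^-1 + C1 r * M * D%:R^-1 =
   (C1 r + Cr) * D%:R^-1 * M + Cr * D%:R^-1 * (CD * e) by ring.
lra.
Qed.

(** Let [m] be an attained error within [e] of the infimum of all attainable ones. Contracting the
    residual shows that the infimum is at most [m / 2 + C2 e], and hence [m <= (2 + 2 C2) e]. The
    constant does not depend on the a priori bound [M]. *)
Lemma whitney01 r : (0 < r)%N -> exists2 C : R, 0 <= C &
  forall g M e, 0 < e -> measurable_fun setT g -> (forall x, `|g x| <= M) ->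
    small_diff r g e ->
    exists2 p : {poly R}, (size p <= r)%N &
      {ae mu, forall x, 0 <= x <= 1 -> `|g x - p.[x]| <= C * e}.
Proof.
move=> r0; have [C2 C20 contr] := whitney_contraction r0.
exists (2 + 2 * C2) => [|g M e e0 mg gM H]; first by rewrite addr_ge0 // mulr_ge0.
pose S : set R := [set m | 0 <= m /\ exists2 p : {poly R}, (size p <= r)%N &
      {ae mu, forall x, 0 <= x <= 1 -> `|g x - p.[x]| <= m}].
have M0 : 0 <= M by apply: le_trans (gM 0).
have SM : S M.
  split=> //; exists 0; first by rewrite size_poly0.
  by apply: ae_all => x _; rewrite horner0 subr0.
have hS : has_inf S by split; [exists M|exists 0 => m []].
have [m [m0 [p sp Hp]] mlt] := inf_adherent e0 hS.
(* The residual is truncated because the contraction asks for a bound at every point, whereas [m]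
   bounds it only almost everywhere on [[0, 1]]. *)
pose h x := if [&& 0 <= x, x <= 1 & `|g x - p.[x]| <= m] then g x - p.[x] else 0.
have mp : measurable_fun setT (fun x => g x - p.[x]).
  apply: measurable_funB => //; apply: continuous_measurable_fun; exact: continuous_horner.
have mh : measurable_fun setT h.
  apply: measurable_fun_ifT => //.
  apply: measurable_and; first exact: measurable_fun_ler.
  apply: measurable_and; first exact: measurable_fun_ler.
  by apply: measurable_fun_ler => //; apply: measurableT_comp.
have hm x : `|h x| <= m by rewrite /h; case: ifP => [/and3P[] //|_]; rewrite normr0.
have hE : {ae mu, forall x, 0 <= x <= 1 -> h x = g x - p.[x]}.
  by apply: (ae_mono Hp) => x Hx xI; rewrite /h Hx // andbT; move/andP: xI => [-> ->].
have dh : small_diff r h e.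
  apply: (ae_mono H) => s Hs.
  have A : {ae mu, forall x, forall i : nat, 0 <= x + i%:R * s <= 1 -> h (x + i%:R * s) = g (x + i%:R * s) - p.[x + i%:R * s]}.
    apply: ae_forall_nat => i.
    have B := ae_affine (i%:R * s) (oner_neq0 R) hE.
    by apply: (ae_mono B) => x; rewrite mul1r [i%:R * s + x]addrC.
  apply: (ae_mono (ae_conj Hs A)) => x [Hx Ax] s0 x0 xs.
  have := Hx s0 x0 xs; rewrite -[fdiff _ _ _ _]subr0 -[X in _ - X](fdiff_poly x s sp) -fdiffB.
  apply: le_trans; rewrite le_eqVlt; apply/orP; left; apply/eqP; congr (`|_|).
  apply: eq_bigr => i _; rewrite Ax //; apply/andP; split.
    by rewrite addr_ge0 // mulr_ge0 // ltW.
  apply: le_trans xs; rewrite lerD2l ler_wpM2r ?(ltW s0) // ler_nat.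
  by rewrite -ltnS.
have [q sq Hq] := contr h m e (ltW e0) mh hm dh.
have Spq : S (m / 2 + C2 * e).
  split; first by rewrite addr_ge0 ?divr_ge0 ?mulr_ge0 // ltW.
  exists (p + q).
    by apply: leq_trans (size_polyD _ _) _; rewrite geq_max sp sq.
  apply: (ae_mono (ae_conj hE Hq)) => x [h1 h2] xI.
  by have := h2 xI; rewrite h1 // hornerD opprD addrA.
have := ge_inf hS.2 Spq => h1.
exists p => //; apply: (ae_mono Hp) => x Hx xI; apply: le_trans (Hx xI) _.
lra.
Qed.

End Whitney.

(** * Essential suprema and Whitney on subintervals *)

Section EssentialSup.
Context {R : realType}.
Local Notation mu := (@lebesgue_measure R).
Implicit Types (f g : R -> R) (I : set R).

(** Completion creates no new null sets up to inclusion, so all almost-everywhere arguments can be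
    carried out with the Borel measure, for which Fubini is used. *)
Lemma completed_negligibleP (N : set R) :
  (@completed_lebesgue_measure R).-negligible (N : set (lebesgueR R)) <-> mu.-negligible N.
Proof.
split.
- move=> [A [mA A0 NA]]; apply/negligible_outer_measure.
  apply/eqP; rewrite eq_le outer_measure_ge0 andbT.
  have <- : ((wlength idfun)^* A)%mu = 0%E by exact: A0.
  exact: le_outer_measure.
- move=> [A [mA A0 NA]]; exists A; split => //.
  exact: sub_caratheodory.
Qed.

Lemma esup_normP I g (y : R) : 0 <= y ->
  (esup_norm I g <= y%:E)%E <-> {ae mu, forall x, I x -> `|g x| <= y}.
Proof.
move=> y0; split.
- move=> /ess_supP /completed_negligibleP H; apply: negligibleS H => x /= nH.
  rewrite patchE; apply: contra_not nH => + Ix; rewrite mem_set // lee_fin; exact.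
- move=> H; apply/ess_supP/completed_negligibleP; apply: negligibleS H => x /= nH.
  rewrite patchE in nH; apply: contra_not nH => h; case: ifPn => [xI|_].
    by rewrite lee_fin; apply: h; exact: set_mem.
  by rewrite lee_fin.
Qed.

(** Each sublevel set of [f] at a rational height is Borel up to a null set. A single Borel null set
    [A] contains all these defects and the points where [|f| > M]; [g] is [f] off [A] and zero
    elsewhere. *)
Lemma borel_representative f (a b M : R) : -1 <= a -> b <= 1 -> 0 <= M ->
  measurable_fun (I11 R : set (lebesgueR R)) (f : lebesgueR R -> R) ->
  {ae mu, forall x, a <= x <= b -> `|f x| <= M} ->
  exists g : R -> R, [/\ measurable_fun setT g, forall x, `|g x| <= M &
     {ae mu, forall x, a <= x <= b -> g x = f x}].
Proof.
move=> a1 b1 M0 mf fM.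
pose J : set R := `[a, b]%classic.
have JI : J `<=` I11 R.
  by move=> x; rewrite /J /I11 /= !in_itv /= => /andP[h1 h2]; apply/andP; split; lra.
have mJ : measurable (J : set (measurableTypeR R)) by exact: measurable_itv.
have mIl : (@measurable _ (lebesgueR R)) (I11 R).
  by apply: sub_caratheodory; exact: (measurable_itv `[-1, 1]).
have mJl : (@measurable _ (lebesgueR R)) J by apply: sub_caratheodory.
have mfJ : measurable_fun (J : set (lebesgueR R)) (f : lebesgueR R -> R) by exact: measurable_funS mf.
have [rt rtP] : exists rt : nat -> rat, forall q, exists n, rt n = q.
  exists (fun n => odflt 0 (unpickle n)) => q; exists (pickle q); by rewrite pickleK.
pose E (n : nat) : set R := J `&` [set x | f x < ratr (rt n)].
have EB n : exists B : set R, [/\ measurable (B : set (measurableTypeR R)), B `<=` E n &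
     mu.-negligible (E n `\` B)].
  have mE : (@measurable _ (lebesgueR R)) (E n).
    have -> : E n = J `&` f @^-1` `]-oo, ratr (rt n)[.
      by apply/seteqP; split=> x /= [Jx]; rewrite in_itv.
    by apply: mfJ => //; exact: measurable_itv.
  have : (completed_algebra_gen mu).-sigma.-measurable (E n).
    by rewrite completed_caratheodory_measurable.
  rewrite g_sigma_completed_algebra_genE => -[B mB [N nN BN]].
  exists B; split => //.
    by rewrite -BN; exact: subsetUl.
  by apply: negligibleS nN => x [+ nB]; rewrite -BN => -[].
have [B HB] := choice EB.
have nU : mu.-negligible (\bigcup_n (E n `\` B n)).
  by apply: negligible_bigcup => n; have [] := HB n.
have [A [mA A0 NA]] := negligibleU nU fM.
pose g x := if x \in J `\` A then f x else 0.
exists g; split.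
- apply: (measurability _ (RGenInftyO.measurableE R)) => //.
  move=> _ [_ [c ->] <-]; rewrite setTI.
  have mJA : measurable (J `\` A : set (measurableTypeR R)) by exact: measurableD.
  pose U : set R := \bigcup_n (if ratr (rt n) < c then B n `\` A else set0).
  have mU : measurable (U : set (measurableTypeR R)).
    apply: bigcupT_measurable => q; case: ifP => // _; apply: measurableD => //.
    by have [] := HB q.
  have UE : U = (J `\` A) `&` [set x | f x < c].
    apply/seteqP; split => x.
      move=> [q _]; case: ifP => // qc [Bx nA]; have [_ BE _] := HB q.
      by have [Jx fx] := BE x Bx; split => //=; exact: lt_trans qc.
    move=> [[Jx nA] /= fc]; have [q /=] := rat_in_itvoo fc.
    rewrite in_itv /= => /andP[q1 q2]; have [n nq] := rtP q.
    exists n => //; rewrite nq q2; split => //.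
    apply: contrapT => nB; apply: nA; apply: NA; left; exists n => //; split => //.
    by split => //=; rewrite nq.
  have [c0|c0] := ltP 0 c.
  + have -> : g @^-1` `]-oo, c[ = U `|` ~` (J `\` A).
      rewrite UE; apply/seteqP; split => x /=; rewrite in_itv /= /g.
        case: ifPn => [/set_mem h1 h2|/negP h _]; first by left.
        by right => h1; apply: h; exact: mem_set.
      move=> [[h1 h2]|h]; first by rewrite mem_set.
      by rewrite memNset.
    apply: measurableU => //; exact: measurableC.
  + have -> // : g @^-1` `]-oo, c[ = U.
    rewrite UE; apply/seteqP; split => x /=; rewrite in_itv /= /g.
      by case: ifPn => [/set_mem h1 h2|_]; [|rewrite ltNge c0].
    by move=> [h1 h2]; rewrite mem_set.
- move=> x; rewrite /g; case: ifPn => [/set_mem [Jx nA]|_]; last by rewrite normr0.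
  apply: contrapT => h; apply: nA; apply: NA; right => /= h2; apply: h; apply: h2.
  by move: Jx; rewrite /J /= in_itv.
- have nA : mu.-negligible A by exists A; split.
  apply: negligibleS nA => x /= h; apply: contrapT => nA; apply: h => xI.
  rewrite /g mem_set //; split => //; by rewrite /J /= in_itv.
Qed.

Lemma measurable_phi : measurable_fun setT (@phi R).
Proof.
apply: continuous_measurable_fun => x; apply: continuous_comp; last exact: sqrt_continuous.
apply: continuousB; first exact: cst_continuous.
exact: exprn_continuous.
Qed.

(** The symmetric difference without the domain test of [sym_diff] and with a free step. *)
Definition sdiff (r : nat) g (x s : R) : R :=
  \sum_(i < r.+1) 'C(r, i)%:R * (-1) ^+ (r - i) * g (x - r%:R * s / 2 + i%:R * s).

Lemma measurable_sdiff r g d (T : measurableType d) (u v : T -> R) :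
  measurable_fun setT g -> measurable_fun setT u -> measurable_fun setT v ->
  measurable_fun setT (fun z => sdiff r g (u z) (v z)).
Proof.
move=> mg mu' mv; apply: measurable_sum => i; apply: measurable_funM; first exact: measurable_cst.
apply: measurableT_comp mg _; apply: measurable_funD.
  apply: measurable_funB => //; apply: measurable_funM; last exact: measurable_cst.
  by apply: measurable_funM => //; exact: measurable_cst.
by apply: measurable_funM => //; exact: measurable_cst.
Qed.

(* Fubini in the variables x and h, with s = h phi(x). *)
Lemma sdiff_ae r f g (a b hm e : R) : measurable_fun setT g ->
  {ae mu, forall x, a <= x <= b -> g x = f x} ->
  (forall h, 0 < h -> h <= hm -> {ae mu, forall x, a <= x - r%:R * (h * phi x) / 2 ->
     x + r%:R * (h * phi x) / 2 <= b -> `|sdiff r f x (h * phi x)| <= e}) ->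
  (forall x s, 0 < s -> a <= x - r%:R * s / 2 -> x + r%:R * s / 2 <= b -> s <= hm * phi x) ->
  {ae mu, forall x, {ae mu, forall s, 0 < s -> a <= x - r%:R * s / 2 ->
     x + r%:R * s / 2 <= b -> `|sdiff r g x s| <= e}}.
Proof.
move=> mg [A [mA A0 NA]] H small.
have gf x : ~ A x -> a <= x <= b -> g x = f x.
  by move=> nA xI; apply: contrapT => h; apply: nA; apply: NA => /(_ xI).
have nA : {ae mu, forall y, ~ A y}.
  by exists A; split => // y /= /contrapT.
pose T : measurableType _ := (measurableTypeR R * measurableTypeR R)%type.
pose pt (i : nat) (z : T) : R := z.1 - r%:R * (z.2 * phi z.1) / 2 + i%:R * (z.2 * phi z.1).
have mstep : measurable_fun setT (fun z : T => z.2 * phi z.1).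
  apply: measurable_funM; first exact: measurable_snd.
  apply: measurableT_comp measurable_phi _; exact: measurable_fst.
have mhalf : measurable_fun setT (fun z : T => r%:R * (z.2 * phi z.1) / 2).
  by apply: measurable_funM => //; apply: measurable_funM.
have mpt i : measurable_fun setT (pt i).
  by apply: measurable_funD; [exact: measurable_funB|exact: measurable_funM].
pose F (z : T) := [&& 0 < z.2, z.2 <= hm, a <= z.1 - r%:R * (z.2 * phi z.1) / 2,
  z.1 + r%:R * (z.2 * phi z.1) / 2 <= b & e < `|sdiff r g z.1 (z.2 * phi z.1)|].
have mF : measurable_fun setT F.
  do 4 (apply: measurable_and; first by [apply: measurable_fun_ltr | apply: measurable_fun_ler;
     do ?[exact: measurable_cst | exact: measurable_snd | exact: measurable_funB | exact: measurable_funD]]).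
  apply: measurable_fun_ltr; first exact: measurable_cst.
  by apply: measurableT_comp; [exact: normr_measurable|exact: measurable_sdiff].
(* Points with a sample in [A] are removed: outside them [g] may be replaced by [f], and [B] itself
   is defined through the Borel function [g] only. *)
pose B : set T := (F @^-1` [set true]) `\` \big[setU/set0]_(i < r.+1) (pt i @^-1` A).
have mB : measurable B.
  apply: measurableD; first by rewrite -[X in measurable X]setTI; apply: mF.
  by apply: bigsetU_measurable => i _; rewrite -[X in measurable X]setTI; apply: mpt.
have inU z : (\big[setU/set0]_(i < r.+1) (pt i @^-1` A)) z -> exists i : 'I_r.+1, A (pt i z).
  by rewrite -bigcup_mkord_ord => -[i _ Hi]; exists (inord i) => //.
have ptI (z : T) (i : 'I_r.+1) : 0 < z.2 -> a <= z.1 - r%:R * (z.2 * phi z.1) / 2 ->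
    z.1 + r%:R * (z.2 * phi z.1) / 2 <= b -> a <= pt i z <= b.
  move=> z0 h1 h2; rewrite /pt; set s := z.2 * phi z.1 in h1 h2 *.
  have s0 : 0 <= s by rewrite mulr_ge0 ?sqrtr_ge0 // ltW.
  have i0 : 0 <= i%:R * s by rewrite mulr_ge0.
  have i1 : i%:R * s <= r%:R * s by rewrite ler_wpM2r // ler_nat -ltnS.
  lra.
have B0 : {ae mu, forall h, {ae mu, forall x, ~ B (x, h)}}.
  apply: ae_all => h.
  have [h0|h0] := ltP 0 h; last by apply: ae_all => x -[]; rewrite /= /F /= ltNge h0.
  have [hh|hh] := leP h hm; last by apply: ae_all => x -[]; rewrite /= /F /= (leNgt h) hh /= andbF.
  apply: (ae_mono (H h h0 hh)) => x Hx [/= /and5P[/= _ _ h1 h2 h3] nU].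
  have : e < e; last by rewrite ltxx.
  apply: lt_le_trans h3 _; apply: le_trans (Hx h1 h2).
  rewrite le_eqVlt; apply/orP; left; apply/eqP; congr (`|_|); apply: eq_bigr => i _; congr (_ * _).
  apply: gf; last exact: (ptI (x, h) i).
  by move=> Ai; apply: nU; rewrite -bigcup_mkord_ord; exists (val i) => //=; rewrite inord_val.
have {B0} Bx := ae_swap mB B0.
apply: (ae_mono (ae_conj Bx nA)) => x [Hx /= nAx].
have [p0|p0] := eqVneq (phi x) 0.
  by apply: ae_all => s s0 h1 h2; have := small x s s0 h1 h2; rewrite p0 mulr0; lra.
have pp : 0 < phi x by rewrite lt_neqAle eq_sym p0 sqrtr_ge0.
have Hpt (i : nat) : {ae mu, forall h, ~ A (pt i (x, h))}.
  (* When [2 i = r] the sample point is [x] for every [h], so no choice of [h] can avoid [A]; there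
     [x] itself has to lie outside [A]. *)
  have [ir|ir] := eqVneq (i%:R - r%:R / 2 : R) 0.
    apply: ae_all => h; rewrite /pt /=.
    have -> : x - r%:R * (h * phi x) / 2 + i%:R * (h * phi x) =
      x + (i%:R - r%:R / 2) * (h * phi x) by ring.
    by rewrite ir mul0r addr0.
  have c0 : (i%:R - r%:R / 2) * phi x != 0 by rewrite mulf_neq0.
  have K := ae_affine x c0 nA.
  apply: (ae_mono K) => h; rewrite /pt /=.
  by have -> : x - r%:R * (h * phi x) / 2 + i%:R * (h * phi x) = x + (i%:R - r%:R / 2) * phi x * h by ring.
have Hh := ae_conj Hx (ae_forall_nat Hpt).
have ip : (phi x)^-1 != 0 by rewrite invr_neq0.
have Hs := ae_affine 0 ip Hh.
apply: (ae_mono Hs) => s; rewrite add0r => -[nB npt] s0 h1 h2.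
rewrite leNgt; apply/negP => h3; apply: nB.
have e1 : (phi x)^-1 * s * phi x = s by rewrite mulrAC mulVf // mul1r.
split.
  rewrite /= /F /= e1 h1 h2 h3 mulr_gt0 ?invr_gt0 //= andbT.
  by rewrite mulrC ler_pdivrMr //; exact: small.
by move=> /inU[i Ai]; exact: npt Ai.
Qed.

(** The last hypothesis says that every symmetric difference inside [[a, b]] has a step [h * phi x]
    with [h <= hm], hence is controlled by the preceding one. A second exchange of variables
    restores the order of [small_diff] before rescaling to [[0, 1]]. *)
Lemma whitney_interval r : (0 < r)%N -> exists2 C : R, 0 <= C &
  forall f (a b hm e M : R), -1 <= a -> a < b -> b <= 1 -> 0 < e -> 0 <= M ->
  measurable_fun (I11 R : set (lebesgueR R)) (f : lebesgueR R -> R) ->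
  {ae mu, forall x, a <= x <= b -> `|f x| <= M} ->
  (forall h, 0 < h -> h <= hm -> {ae mu, forall x, a <= x - r%:R * (h * phi x) / 2 ->
     x + r%:R * (h * phi x) / 2 <= b -> `|sdiff r f x (h * phi x)| <= e}) ->
  (forall x s, 0 < s -> a <= x - r%:R * s / 2 -> x + r%:R * s / 2 <= b -> s <= hm * phi x) ->
  exists2 p : {poly R}, (size p <= r)%N &
      {ae mu, forall x, a <= x <= b -> `|f x - p.[x]| <= C * e}.
Proof.
move=> r0; have [C C0 W] := @whitney01 R r r0; exists C => [//|f a b hm e M a1 ab b1 e0 M0 mf fM H small].
have [g [mg gM gf]] := borel_representative a1 b1 M0 mf fM.
have Hg := sdiff_ae mg gf H small.
pose l := b - a; have l0 : 0 < l by rewrite subr_gt0.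
pose T : measurableType _ := (measurableTypeR R * measurableTypeR R)%type.
pose F (z : T) := [&& 0 < z.1, a <= z.2 - r%:R * z.1 / 2,
  z.2 + r%:R * z.1 / 2 <= b & e < `|sdiff r g z.2 z.1|].
have mhalf : measurable_fun setT (fun z : T => r%:R * z.1 / 2).
  by apply: measurable_funM => //; apply: measurable_funM => //; exact: measurable_fst.
have mF : measurable_fun setT F.
  apply: measurable_and; first by apply: measurable_fun_ltr => //; exact: measurable_fst.
  apply: measurable_and.
    by apply: measurable_fun_ler => //; apply: measurable_funB => //; exact: measurable_snd.
  apply: measurable_and.
    by apply: measurable_fun_ler => //; apply: measurable_funD => //; exact: measurable_snd.
  apply: measurable_fun_ltr => //.
  by apply: measurableT_comp; [exact: normr_measurable|
     exact: measurable_sdiff].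
pose B : set T := F @^-1` [set true].
have mB : measurable B by rewrite -[B]setTI; apply: mF.
have Bx : {ae mu, forall x, {ae mu, forall s, ~ B (s, x)}}.
  apply: (ae_mono Hg) => x Hx; apply: (ae_mono Hx) => s Hs.
  by rewrite /B /= /F /= => /and4P[h1 h2 h3]; rewrite ltNge Hs.
have {}Bx := ae_swap mB Bx.
pose G y := g (a + l * y).
have mG : measurable_fun setT G by apply: measurableT_comp mg _; exact: affine_measurable.
have dG : small_diff r G e.
  have A1 := ae_affine 0 (lt0r_neq0 l0) Bx.
  apply: (ae_mono A1) => s; rewrite add0r => Hs.
  have A2 := ae_affine (a + r%:R * (l * s) / 2) (lt0r_neq0 l0) Hs.
  apply: (ae_mono A2) => y nB s0 y0 y1.
  have eq : fdiff r G y s = sdiff r g (a + r%:R * (l * s) / 2 + l * y) (l * s).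
    by apply: eq_bigr => i _; rewrite /G; congr (_ * g _); ring.
  rewrite eq leNgt; apply/negP => h; apply: nB; rewrite /B /= /F /= h mulr_gt0 //= andbT.
  have h1 : 0 <= l * y by rewrite mulr_ge0 // ltW.
  have h2 : l * (y + r%:R * s) <= l * 1 by rewrite ler_wpM2l // ltW.
  apply/andP; split; first lra.
  have -> : b = a + l * 1 by rewrite /l; ring.
  lra.
have [p sp Hp] := W G M e e0 mG (fun y => gM _) dG.
exists (p \Po (l^-1 *: 'X + (- (a / l))%:P)).
  rewrite size_comp_poly2 //.
  by rewrite -mul_polyC size_MXaddC polyC_eq0 invr_eq0 (gt_eqF l0) size_polyC invr_eq0 (gt_eqF l0).
have li : l^-1 != 0 by rewrite invr_neq0 // lt0r_neq0.
have A := ae_affine (- (a / l)) li Hp.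
apply: (ae_mono (ae_conj A gf)) => x [h1 h2] xI.
rewrite -h2 // horner_comp hornerD hornerZ hornerX hornerC [l^-1 * x + _]addrC.
have e1 : a + l * (- (a / l) + l^-1 * x) = x by field; exact: lt0r_neq0.
have := h1; rewrite /G e1; apply.
have -> : - (a / l) + l^-1 * x = (x - a) / l by ring.
by rewrite divr_ge0 ?(ltW l0) ?ler_pdivrMr // /l; lra.
Qed.

End EssentialSup.

(** * Arcs of the circle and the function rho *)

Section TrigGeometry.
Context {R : realType}.
Implicit Types (s t u x h : R).

Lemma sin_le u : 0 <= u -> sin u <= u.
Proof.
move=> u0; have [c _ h] := @MVT_segment R (@sin R) (@cos R) 0 u u0 (fun z _ => is_derive_sin z)
  ltac:(by apply: continuous_subspaceT => z; exact: continuous_sin).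
by move: h; rewrite sin0 !subr0 => ->; rewrite ler_piMl // cos_le1.
Qed.

Lemma normr_sin_le u : `|sin u| <= `|u|.
Proof.
wlog u0 : u / 0 <= u => [hw|].
  have [|/ltW u0] := leP 0 u; first exact: hw.
  by rewrite -normrN -sinN -[X in _ <= X]normrN; apply: hw; rewrite oppr_ge0.
rewrite (ger0_norm u0) ler_norml sin_le // andbT.
have [up|pu] := leP u pi.
  by have := sin_ge0_pi (_ : 0 <= u <= pi); rewrite u0 up => /(_ isT); lra.
by have := sin_geN1 u; have := pi_ge2 R; lra.
Qed.

Lemma cos_half u : 1 - cos u = 2 * sin (u / 2) ^+ 2.
Proof.
have -> : cos u = cos ((u / 2) *+ 2) by congr cos; rewrite mulr2n; lra.
rewrite cos_mulr2n cos2sin2 mulr2n; ring.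
Qed.

Lemma one_sub_cos_le u : 1 - cos u <= u ^+ 2.
Proof.
rewrite cos_half; have := normr_sin_le (u / 2).
rewrite -(@ler_pXn2r _ 2) ?nnegrE // !real_normK ?num_real // => h.
have : (u / 2) ^+ 2 = u ^+ 2 / 4 by field.
by have := sqr_ge0 u; lra.
Qed.

Lemma sin_ge_quarter u : 0 <= u <= pi / 2 -> u / 4 <= sin u.
Proof.
move=> /andP[u0 up].
have small (w : R) : 0 <= w <= 1 -> w / 2 <= sin w.
  move=> /andP[w0 w1].
  have [c] := @MVT_segment R (@sin R) (@cos R) 0 w w0 (fun z _ => is_derive_sin z)
     ltac:(by apply: continuous_subspaceT => z; exact: continuous_sin).
  rewrite in_itv /= sin0 !subr0 => /andP[c0 cw] ->.
  have h1 := cos_half c; have h2 := normr_sin_le (c / 2).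
  rewrite -(@ler_pXn2r _ 2) ?nnegrE // !real_normK ?num_real // in h2.
  have h3 : (c / 2) ^+ 2 <= 4^-1 by have : c ^+ 2 <= 1 ^+ 2 by [rewrite lerXn2r ?nnegrE //; lra]; lra.
  have : 2^-1 <= cos c by lra.
  by nra.
have [u1|u1] := leP u 1; first by have := small u ltac:(lra); lra.
have s1 := small 1 ltac:(lra).
have p2 := pihalf_lt2 R; have p1 := pihalf_ge1 R.
have : sin 1 <= sin u.
  rewrite leNgt ltr_sin ?in_itv /= -?leNgt; first exact: ltW.
  - by apply/andP; split; lra.
  - by apply/andP; split; lra.
lra.
Qed.

Lemma one_sub_cos_ge u : `|u| <= pi -> u ^+ 2 / 32 <= 1 - cos u.
Proof.
wlog u0 : u / 0 <= u => [hw|].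
  have [|/ltW u0] := leP 0 u; first exact: hw.
  by rewrite -normrN -cosN -sqrrN; apply: hw; rewrite oppr_ge0.
rewrite (ger0_norm u0) => up; rewrite cos_half.
have h := @sin_ge_quarter (u / 2) ltac:(lra).
have : (u / 8) ^+ 2 <= sin (u / 2) ^+ 2 by rewrite lerXn2r ?nnegrE //; lra.
have -> : (u / 8) ^+ 2 = u ^+ 2 / 64 by field.
lra.
Qed.

Lemma rhoE h t : 0 <= t <= pi -> rho h (cos t) = h * sin t + h ^+ 2.
Proof. by move=> tI; rewrite /rho phi_cos. Qed.

Lemma rho_gt0 h x : 0 < h -> 0 < rho h x.
Proof. by move=> h0; rewrite /rho ltr_wpDl ?exprn_gt0 // mulr_ge0 ?phi_ge0 // ltW. Qed.

Lemma rho_le h h' x : 0 <= h -> h <= h' -> rho h x <= rho h' x.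
Proof.
move=> h0 hh; rewrite /rho lerD ?ler_wpM2r ?phi_ge0 // lerXn2r // nnegrE //.
exact: le_trans hh.
Qed.

Lemma rho_scale_ge c h x : 0 <= h -> 0 <= c <= 1 -> rho (c * h) x <= c * rho h x.
Proof.
move=> h0 /andP[c0 c1]; rewrite /rho mulrDr mulrA lerD2l exprMn.
by rewrite ler_wpM2r ?sqr_ge0 // expr2 ler_piMl.
Qed.

Lemma rho_scale_le c h x : 0 <= h -> 1 <= c -> rho (c * h) x <= c ^+ 2 * rho h x.
Proof.
move=> h0 c1; have c0 : 0 <= c by apply: le_trans c1.
rewrite /rho mulrDr exprMn lerD2r mulrA ler_wpM2r ?phi_ge0 // ler_wpM2r //.
by rewrite expr2 ler_peMl.
Qed.

Lemma rho_scale_small c h x : 0 <= h -> 0 <= c <= 1 -> c ^+ 2 * rho h x <= rho (c * h) x.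
Proof.
move=> h0 /andP[c0 c1]; rewrite /rho mulrDr exprMn lerD2r mulrA ler_wpM2r ?phi_ge0 // ler_wpM2r //.
by rewrite expr2 ler_piMl.
Qed.

(** Together with [cos_dist_ge]: up to constants, [rho h x] is the distance travelled by the cosine
    when the angle of [x] moves by [h]. This turns conditions stated with [rho] into conditions on
    angles. *)
Lemma cos_dist_le s t : 0 <= t <= pi -> `|cos s - cos t| <= rho `|s - t| (cos t).
Proof.
move=> tI; rewrite rhoE // -[in leLHS](subrKC t s) cosD.
set u := s - t.
have -> : cos t * cos u - sin t * sin u - cos t = - (cos t * (1 - cos u)) - sin t * sin u by ring.
apply: le_trans (ler_normB _ _) _; rewrite normrN !normrM (ger0_norm (sin_ge0_pi tI)) addrC.
apply: lerD; first by rewrite mulrC ler_wpM2r ?sin_ge0_pi // normr_sin_le.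
rewrite real_normK ?num_real //; apply: le_trans (one_sub_cos_le u).
have c0 : 0 <= 1 - cos u by rewrite subr_ge0 cos_le1.
by rewrite (ger0_norm c0) ler_piMl // cos_max.
Qed.

Lemma sin_lip s t : 0 <= s <= pi -> sin t <= sin s + `|t - s|.
Proof.
move=> sI; rewrite -[in leLHS](subrKC s t) sinD; set u := t - s.
have s0 := sin_ge0_pi sI; apply: lerD; first by rewrite ler_piMr // cos_le1.
apply: le_trans (normr_sin_le u); apply: le_trans (ler_norm _) _.
by rewrite normrM ler_piMl // cos_max.
Qed.

Lemma rho_doubling k s t : 0 < k -> 0 <= s <= pi -> 0 <= t <= pi ->
  rho k (cos t) <= (1 + `|t - s| / k) * rho k (cos s).
Proof.
move=> k0 sI tI; rewrite !rhoE //; have := sin_lip t sI; have s0 := sin_ge0_pi sI.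
set d := `|t - s| => h; have d0 : 0 <= d := normr_ge0 _.
have -> : (1 + d / k) * (k * sin s + k ^+ 2) = k * sin s + k ^+ 2 + d * sin s + d * k.
  by field; exact: lt0r_neq0.
have : k * sin t <= k * (sin s + d) by rewrite ler_wpM2l // ltW.
have : 0 <= d * sin s by rewrite mulr_ge0.
lra.
Qed.

(** With [u = |s - t|] and [v = (s + t) / 2] the distance is [2 sin v sin (u / 2)]. Here [sin v]
    dominates both [sin t / 2] and [sin (u / 2) >= u / 8]; the product of the lower bounds yields
    64. *)
Lemma cos_dist_ge s t : 0 <= s <= pi -> 0 <= t <= pi ->
  64^-1 * rho `|s - t| (cos t) <= `|cos s - cos t|.
Proof.
move=> sI tI; rewrite rhoE //; set u := `|s - t|.
have u0 : 0 <= u := normr_ge0 _.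
have up : u <= pi by rewrite /u ler_norml; lra.
pose v := (s + t) / 2.
have vI : 0 <= v <= pi by rewrite /v; lra.
have uI : 0 <= u / 2 <= pi by lra.
have sv0 := sin_ge0_pi vI; have su0 := sin_ge0_pi uI.
have ss0 := sin_ge0_pi sI; have st0 := sin_ge0_pi tI.
have E : `|cos s - cos t| = 2 * sin v * sin (u / 2).
  have -> : cos s - cos t = - (2 * sin v * sin ((s - t) / 2)).
    have -> : s = v + (s - t) / 2 by rewrite /v; lra.
    have {2}-> : t = v - (v + (s - t) / 2 - t) / 2 by rewrite /v; lra.
    rewrite cosD cosB.
    have -> : (v + (s - t) / 2 - t) / 2 = (s - t) / 2 by rewrite /v; lra.
    by ring.
  rewrite normrN !normrM (ger0_norm sv0) (ger0_norm (_ : 0 <= 2)) //; congr (_ * _).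
  rewrite /u; have [h|h] := leP 0 (s - t).
    by rewrite (ger0_norm h) ger0_norm // sin_ge0_pi //; lra.
  rewrite (ltr0_norm h) mulNr sinN ler0_norm // -oppr_ge0 -sinN -mulNr sin_ge0_pi //; lra.
have h1 : sin t / 2 <= sin v.
  have : sin s + sin t = 2 * sin v * cos ((s - t) / 2).
    have {1}-> : s = v + (s - t) / 2 by rewrite /v; lra.
    have {2}-> : t = v - (s - t) / 2 by rewrite /v; lra.
    by rewrite sinD sinB; ring.
  have : 2 * sin v * cos ((s - t) / 2) <= 2 * sin v by rewrite ler_piMr ?cos_le1 // mulr_ge0.
  lra.
have h2 : sin (u / 2) <= sin v.
  rewrite -(@ler_pXn2r _ 2) ?nnegrE // -subr_ge0.
  have -> : sin (u / 2) ^+ 2 = sin ((s - t) / 2) ^+ 2.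
    rewrite /u; have [h|h] := leP 0 (s - t); first by rewrite ger0_norm.
    by rewrite ltr0_norm // mulNr sinN sqrrN.
  have -> : sin v ^+ 2 - sin ((s - t) / 2) ^+ 2 = sin s * sin t.
    have {2}-> : s = v + (s - t) / 2 by rewrite /v; lra.
    have {3}-> : t = v - (s - t) / 2 by rewrite /v; lra.
    rewrite sinD sinB.
    transitivity (sin v ^+ 2 * 1 - 1 * sin ((s - t) / 2) ^+ 2); first by ring.
    rewrite -{1}(cos2Dsin2 ((s - t) / 2)) -(cos2Dsin2 v); ring.
  by rewrite mulr_ge0.
have h3 : u / 8 <= sin (u / 2) by have := @sin_ge_quarter (u / 2) ltac:(lra); lra.
rewrite E.
have h4 : (sin t / 2 + u / 8) * (u / 8) <= 2 * sin v * sin (u / 2).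
  by apply: ler_pM; lra.
apply: le_trans h4; have : 0 <= u * sin t by rewrite mulr_ge0.
by have := sqr_ge0 u; nra.
Qed.

Lemma cos_le_anti s t : 0 <= s <= pi -> 0 <= t <= pi -> (cos s <= cos t) = (t <= s).
Proof. by move=> sI tI; rewrite !leNgt ltr_cos // in_itv. Qed.

Lemma arcP a b x : 0 <= a -> a <= b -> b <= pi -> cos b <= x <= cos a ->
  exists2 s, a <= s <= b & x = cos s.
Proof.
move=> a0 ab bp /andP[x1 x2].
have xI : -1 <= x <= 1 by have := cos_geN1 b; have := cos_le1 a; lra.
exists (acos x); last by rewrite acosK.
have sI : 0 <= acos x <= pi by rewrite acos_ge0 ?acos_lepi.
have e := acosK (_ : x \in `[-1, 1]); rewrite in_itv /= xI in e.
by rewrite -{1}(@cos_le_anti (acos x) a) ?e // -?(@cos_le_anti b (acos x)) ?e ?x1 ?x2 //; lra.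
Qed.

End TrigGeometry.

(** * Averages of A* weights over arcs *)

Section WeightIntegral.
Context {R : realType} (w : R -> R) (L : R).
Local Notation mu := (@completed_lebesgue_measure R).

(** Half-open intervals make adjacent integrals add without overlap. *)
Definition wint (a b : R) : R := \int[mu]_(u in (`]a, b]%classic : set (lebesgueR R))) w u.

Definition interval_weight : Prop :=
  [/\ 1 <= L,
   forall a b : R, -1 <= a -> b <= 1 -> 0 <= wint a b,
   forall a b c : R, -1 <= a -> a <= b -> b <= c -> c <= 1 -> wint a c = wint a b + wint b c,
   forall a b x : R, -1 <= a -> a < b -> b <= 1 -> a <= x <= b -> w x <= L / (b - a) * wint a b &
   forall a b m : R, -1 <= a -> a <= b -> b <= 1 ->
     (forall x, a <= x <= b -> w x <= m) -> wint a b <= m * (b - a)].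

End WeightIntegral.

Section AstarIntegral.
Context {R : realType} (w : R -> R).
Local Notation mu := (@completed_lebesgue_measure R).

Lemma measurable_lebesgueR (A : set (measurableTypeR R)) : measurable A ->
  measurable (A : set (lebesgueR R)).
Proof. by move=> mA; apply: sub_caratheodory. Qed.

Lemma completed_itv (a b : R) (x y : bool) : a <= b ->
  mu [set` Interval (BSide x a) (BSide y b)] = (b - a)%:E.
Proof.
move=> ab; rewrite (_ : mu _ = @lebesgue_measure R [set` Interval (BSide x a) (BSide y b)]) //.
rewrite lebesgue_measure_itv /= lte_fin; case: ltgtP ab => // -> _.
by rewrite subrr.
Qed.

Lemma Astar_interval_weight : Astar_weight w -> exists L, interval_weight w L.
Proof.
move=> [w0 wi [L hL]]; exists (Num.max 1 L).
have sub (a b : R) (x y : bool) : -1 <= a -> b <= 1 ->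
    [set` Interval (BSide x a) (BSide y b)] `<=` (I11 R : set (lebesgueR R)).
  move=> a1 b1 z; rewrite /I11 /= !in_itv /= => /andP[].
  by case: x; case: y; rewrite /= => h1 h2; apply/andP; split; move: a1 b1 h1 h2; clear; lra.
have mI (a b : R) (x y : bool) :
    measurable ([set` Interval (BSide x a) (BSide y b)] : set (lebesgueR R)).
  by apply: measurable_lebesgueR; exact: measurable_itv.
have int (a b : R) (x y : bool) : -1 <= a -> b <= 1 ->
    mu.-integrable ([set` Interval (BSide x a) (BSide y b)] : set (lebesgueR R)) (EFin \o w : lebesgueR R -> \bar R).
  by move=> a1 b1; apply: integrableS wi => //; [exact: (mI (-1) 1 true false)|exact: sub].
have ge0 a b : -1 <= a -> b <= 1 -> 0 <= wint w a b.
  by move=> a1 b1; apply: Rintegral_ge0 => x /(sub a b false false a1 b1); exact: w0.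
split => //.
- by rewrite le_max lexx.
- move=> a b c a1 ab bc c1; rewrite /wint.
  have e : (`]a, c]%classic : set (lebesgueR R)) = `]a, b]%classic `|` `]b, c]%classic.
    apply/seteqP; split => x /=; rewrite !in_itv /=.
      by move=> /andP[h1 h2]; have [h|h] := leP x b; [left|right]; apply/andP.
    by move=> [] /andP[h1 h2]; apply/andP; split => //; lra.
  rewrite e Rintegral_setU //.
  - by rewrite -e; apply: int.
  - by apply/disj_setPS => x /= []; rewrite !in_itv /= => /andP[_ h1] /andP[h2 _]; lra.
- move=> a b x a1 ab b1 xab.
  have := hL `[a, b]%classic (@interval_is_interval _ _) (sub a b true false a1 b1) _ x.
  rewrite completed_itv ?(ltW ab) //= lte_fin subr_gt0 in_itv /= => /(_ ab xab) h.
  apply: le_trans h _.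
  have -> : \int[mu]_(u in `[a, b]%classic) w u = wint w a b.
    rewrite /wint.
    have e : (`[a, b]%classic : set (lebesgueR R)) = [set a] `|` `]a, b]%classic.
      apply/seteqP; split => z /=; rewrite !in_itv /=.
        by move=> /andP[h1 h2]; have [h|h] := leP z a; [left|right]; [lra|apply/andP].
      by move=> [->|/andP[h1 h2]]; apply/andP; split => //; lra.
    have ma : measurable ([set a] : set (lebesgueR R)).
      by apply: measurable_lebesgueR; exact: measurable_set1.
    rewrite e Rintegral_setU //.
    - rewrite [X in X + _](_ : _ = 0) ?add0r //.
      rewrite (@eq_Rintegral _ _ _ _ _ (cst (w a))); last by move=> z; rewrite inE /= => ->.
      have mu0 : mu [set a] = 0%E := lebesgue_measure_set1 a.
      transitivity (w a * fine (mu [set a])); first exact: Rintegral_cst.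
      by rewrite mu0 mulr0.
    - by rewrite -e; apply: int.
    - by apply/disj_setPS => z /= []; rewrite !in_itv /= => -> /andP[]; rewrite ltxx.
  rewrite ler_wpM2r ?ge0 // ler_wpM2r ?invr_ge0 ?subr_ge0 ?(ltW ab) //.
  by rewrite le_max lexx orbT.
- move=> a b m a1 ab b1 h; rewrite /wint.
  have -> : m * (b - a) = \int[mu]_(u in (`]a, b]%classic : set (lebesgueR R))) m.
    have muJ : mu (`]a, b]%classic) = (b - a)%:E by apply: completed_itv.
    transitivity (m * fine (mu (`]a, b]%classic))); first by rewrite muJ.
    by apply/esym; exact: Rintegral_cst.
  apply: le_Rintegral => //.
  - exact: int.
  - apply: (@integrableS _ _ _ mu (`]a, b]%classic)) => //.
    apply/integrableP; split; first exact: measurable_cst.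
    have muJ : mu (`]a, b]%classic) = (b - a)%:E by apply: completed_itv.
    rewrite /= integral_cst; last exact: mI.
    have -> : (`|m|%:E * mu (`]a, b]%classic) < +oo)%E by rewrite muJ ltry.
    by [].
  - by move=> x /=; rewrite in_itv /= => /andP[x1 x2]; apply: h; apply/andP; split => //; lra.
Qed.

End AstarIntegral.

(** * Doubling of A* weights *)

Section Doubling.
Context {R : realType} (w : R -> R) (L : R) (W : interval_weight w L).
Implicit Types (a b A B k t : R).
Local Notation q := ((4 * L)^-1).

Lemma extension_ratio_gt0 : 0 < q.
Proof. by have [L1 _ _ _ _] := W; rewrite invr_gt0; lra. Qed.

Lemma wint_le a b A B : -1 <= A -> A <= a -> a <= b -> b <= B -> B <= 1 ->
  wint w a b <= wint w A B.
Proof.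
have [L1 w0 wD _ _] := W => A1 Aa ab bB B1.
rewrite (wD A a B) ?(wD a b B) //; try lra.
have := w0 A a A1 ltac:(lra); have := w0 b B ltac:(lra) B1; lra.
Qed.

(** On the larger interval [w] is at most [L] times its average. The added pieces have total length
    at most [2 q (b - a)], so they carry at most the fraction [2 q L = 1 / 2] of the larger
    integral. *)
Lemma wint_extend a' a b b' : -1 <= a' -> a' <= a -> a < b -> b <= b' -> b' <= 1 ->
  a - q * (b - a) <= a' -> b' <= b + q * (b - a) -> wint w a' b' <= 2 * wint w a b.
Proof.
have [L1 w0 wD wA wU] := W => a1 aa ab bb b1 aq bq.
have ab' : 0 < b' - a' by lra.
set W' := wint w a' b'; have W0 : 0 <= W' by exact: w0.
pose m := L / (b' - a') * W'.
have hl := wU a' a m a1 aa ltac:(lra) ltac:(by move=> x xI; apply: wA; lra).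
have hr := wU b b' m ltac:(lra) bb b1 ltac:(by move=> x xI; apply: wA; lra).
have hD : W' = wint w a' a + (wint w a b + wint w b b').
  by rewrite /W' (wD a' a b') ?(wD a b b') //; lra.
have hm : m * ((a - a') + (b' - b)) <= W' / 2.
  have -> : m * ((a - a') + (b' - b)) = L * W' * (((a - a') + (b' - b)) / (b' - a')).
    by rewrite /m; field; lra.
  have -> : W' / 2 = L * W' * (2 * q) by field; lra.
  apply: ler_wpM2l; first by apply: mulr_ge0 => //; lra.
  rewrite ler_pdivrMr //; have : q * (b - a) <= q * (b' - a').
    by apply: ler_wpM2l; [exact/ltW/extension_ratio_gt0|lra].
  lra.
rewrite mulrDr in hm; lra.
Qed.

(** Each step extends both sides by the ratio [q], clipped at [A] and [B]. Unless both sides are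
    clipped, one grows in full and the length gains the factor [1 + q]. *)
Lemma wint_expand (n : nat) a b A B : -1 <= A -> A <= a -> a < b -> b <= B -> B <= 1 ->
  B - A <= (1 + q) ^+ n * (b - a) -> wint w A B <= 4 ^+ n * wint w a b.
Proof.
have q0 := extension_ratio_gt0.
elim: n a b => [|n IH] a b A1 Aa ab bB B1.
  rewrite !expr0 !mul1r => h.
  by have -> : A = a by [lra]; have -> : B = b by lra.
move=> h.
pose b' := Num.min B (b + q * (b - a)); pose a' := Num.max A (a - q * (b - a)).
have q1 : 0 < q * (b - a) by rewrite mulr_gt0 // subr_gt0.
have [bb bB'] : b <= b' /\ b' <= B.
  by rewrite /b' le_min ge_min lexx bB lerDl (ltW q1).
have [aa aA'] : a' <= a /\ A <= a'.
  by rewrite /a' le_max ge_max lexx Aa gerBl (ltW q1).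
have s2 : wint w a' b' <= 2 * wint w a b.
  by apply: wint_extend; rewrite ?le_max ?ge_min ?lexx ?orbT //; lra.
have s3 : wint w A B <= 4 ^+ n * wint w a' b'.
  apply: IH => //; try lra.
  have p1 : 1 <= (1 + q) ^+ n by rewrite exprn_ege1 //; lra.
  have [e1|h1] : b' = B \/ b' = b + q * (b - a).
    by rewrite /b'; case: leP; [left|right].
  - have [e2|h2] : a' = A \/ a' = a - q * (b - a).
      by rewrite /a'; case: leP; [right|left].
    + by rewrite e1 e2 ler_peMl //; lra.
    + apply: le_trans h _; rewrite exprSr -mulrA ler_wpM2l ?(le_trans ler01) //; lra.
  - by apply: le_trans h _; rewrite exprSr -mulrA ler_wpM2l ?(le_trans ler01) //; lra.
have w0 : 0 <= wint w a b by have [_ w0 _ _ _] := W; apply: w0; lra.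
apply: le_trans s3 _; rewrite exprS (mulrC 4) -mulrA ler_wpM2l ?exprn_ge0 //; lra.
Qed.

Lemma expr_unbounded (c y : R) : 0 < c -> exists n : nat, y <= (1 + c) ^+ n.
Proof.
move=> c0; pose n := (Num.truncn (`|y| / c)).+1.
have bern (m : nat) : 1 + m%:R * c <= (1 + c) ^+ m.
  elim: m => [|m IH]; first by rewrite mul0r expr0; lra.
  rewrite exprS -natr1; have : 0 <= m%:R * c by rewrite mulr_ge0 // ltW.
  have : 0 <= (1 + c) ^+ m by rewrite exprn_ge0 //; lra.
  nra.
exists n; apply: le_trans (bern n); apply: le_trans (ler_norm y) _.
have : `|y| / c < n%:R by rewrite truncnS_gt.
rewrite ltr_pdivrMr //; lra.
Qed.

(** Take [s] with [4 <= (1 + q) ^ s] and the least [n] for which [(1 + q) ^ n] reaches the ratio of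
    lengths; minimality bounds [4 ^ n] by 4 times the [s]-th power of that ratio. *)
Lemma wint_growth : exists s : nat, forall a b A B, -1 <= A -> A <= a -> a < b -> b <= B -> B <= 1 ->
  wint w A B <= 4 * ((B - A) / (b - a)) ^+ s * wint w a b.
Proof.
have q0 := extension_ratio_gt0; have [L1 w0 _ _ _] := W.
have [s hs] := expr_unbounded 4 q0.
exists s => a b A B A1 Aa ab bB B1.
have ab0 : 0 < b - a by lra.
set y := (B - A) / (b - a).
have y1 : 1 <= y by rewrite ler_pdivlMr //; lra.
have w1 : 0 <= wint w a b by apply: w0; lra.
have hy n : y <= (1 + q) ^+ n -> wint w A B <= 4 ^+ n * wint w a b.
  by move=> hn; apply: wint_expand => //; rewrite -ler_pdivrMr.
case: (ex_minnP (expr_unbounded y q0)) => [[|n] /hy h hm].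
  apply: le_trans h _; rewrite expr0 mul1r ler_peMl //.
  by have : 1 <= y ^+ s by [rewrite exprn_ege1]; lra.
apply: le_trans h _; rewrite ler_wpM2r // exprS ler_wpM2l //.
have yn : (1 + q) ^+ n <= y.
  by rewrite leNgt; apply/negP => /ltW /hm; rewrite ltnn.
apply: le_trans (_ : ((1 + q) ^+ s) ^+ n <= _).
  by apply: lerXn2r; rewrite ?nnegrE //; apply: exprn_ge0; lra.
by rewrite exprAC lerXn2r // nnegrE; [apply: exprn_ge0|]; lra.
Qed.

End Doubling.

Section ArcAverage.
Context {R : realType}.
Implicit Types (w : R -> R) (k s t u x : R).

(** Ends of the image of the arc of radius [k] about [t], clipped to [[0, pi]]. The cosine
    decreases, so the lower end comes from [t + k]. *)
Definition arc_lo k t : R := cos (Num.min pi (t + k)).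
Definition arc_hi k t : R := cos (Num.max 0 (t - k)).
Definition arc_avg w k t : R :=
  wint w (arc_lo k t) (arc_hi k t) / (arc_hi k t - arc_lo k t).

Lemma arc_bounds k t : -1 <= arc_lo k t /\ arc_hi k t <= 1.
Proof. by rewrite cos_geN1 cos_le1. Qed.

Lemma arc_ends k t : 0 < k -> 0 <= t <= pi ->
  [/\ 0 <= Num.max 0 (t - k) <= pi, 0 <= Num.min pi (t + k) <= pi,
      Num.max 0 (t - k) <= t & t <= Num.min pi (t + k)].
Proof.
move=> k0 /andP[t0 tp]; have p0 := pi_ge0 R.
rewrite !le_max !ge_max !le_min !ge_min !lexx t0 tp p0 /=.
by split; lra.
Qed.

Lemma mem_arc k s t : 0 < k -> 0 <= t <= pi -> 0 <= s <= pi -> `|s - t| <= k ->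
  arc_lo k t <= cos s <= arc_hi k t.
Proof.
move=> k0 tI sI; rewrite ler_norml => /andP[h1 h2].
have [e1 e2 e3 e4] := arc_ends k0 tI; move: (sI) => /andP[s0 sp].
rewrite /arc_lo /arc_hi !cos_le_anti //.
by rewrite le_min ge_max s0 sp; lra.
Qed.

Lemma arc_mem k t x : 0 < k -> 0 <= t <= pi -> arc_lo k t <= x <= arc_hi k t ->
  exists2 s, 0 <= s <= pi & `|s - t| <= k /\ x = cos s.
Proof.
move=> k0 tI /arcP; have [e1 e2 e3 e4] := arc_ends k0 tI.
case; try lra.
move=> s; rewrite ge_max le_min => /andP[/andP[s0 s1] /andP[s2 s3]] ->.
by exists s; [lra|split => //; rewrite ler_norml; lra].
Qed.

Lemma arc_length k t : 0 < k -> k <= 1 -> 0 <= t <= pi ->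
  64^-1 * rho k (cos t) <= arc_hi k t - arc_lo k t <= 2 * rho k (cos t).
Proof.
move=> k0 k1 tI; have [e1 e2 e3 e4] := arc_ends k0 tI.
have p2 := pi_ge2 R.
set a := Num.max _ _ in e1 e3; set b := Num.min _ _ in e2 e4.
have la : cos t <= cos a by rewrite cos_le_anti.
have lb : cos b <= cos t by rewrite cos_le_anti.
rewrite /arc_lo /arc_hi -/a -/b; apply/andP; split.
  (* Since [k <= 1] and [pi >= 2], at least one side of the arc is not clipped, and its image alone
     is long enough. *)
  have [h|h] := leP t 1.
    have := cos_dist_ge e2 tI.
    have -> : `|b - t| = k by rewrite /b min_r; [rewrite ger0_norm; lra|lra].
    rewrite ler0_norm; lra.
  have := cos_dist_ge e1 tI.
  have -> : `|a - t| = k by rewrite /a max_r; [rewrite ler0_norm; lra|lra].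
  rewrite ger0_norm; lra.
have ha : `|a - t| <= k.
  by rewrite ler0_norm; [|lra]; have : t - k <= a by [rewrite le_max lexx orbT]; lra.
have hb : `|b - t| <= k.
  by rewrite ger0_norm; [|lra]; have : b <= t + k by [rewrite ge_min lexx orbT]; lra.
have := cos_dist_le a tI; have := cos_dist_le b tI.
rewrite [`|cos a - _|]ger0_norm ?[`|cos b - _|]ler0_norm; try lra.
have := rho_le (cos t) (normr_ge0 _) ha; have := rho_le (cos t) (normr_ge0 _) hb.
lra.
Qed.

Lemma arc_lt k t : 0 < k -> k <= 1 -> 0 <= t <= pi -> arc_lo k t < arc_hi k t.
Proof.
move=> k0 k1 tI; have /andP[h _] := arc_length k0 k1 tI.
by have := rho_gt0 (cos t) k0; lra.
Qed.

Context (w : R -> R) (L : R) (W : interval_weight w L).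

Lemma weight_le_avg k t s : 0 < k -> k <= 1 -> 0 <= t <= pi -> 0 <= s <= pi ->
  `|s - t| <= k -> w (cos s) <= L * arc_avg w k t.
Proof.
move=> k0 k1 tI sI h; have [_ _ _ wA _] := W.
have [b1 b2] := arc_bounds k t.
have := wA _ _ _ b1 (arc_lt k0 k1 tI) b2 (mem_arc k0 tI sI h).
by rewrite /arc_avg mulrA mulrAC.
Qed.

(** The hull of both images, relative to the image of the arc at [t], has length quadratic in
    [1 + |u - t| / k], which [wint_growth] raises to the power [s]. Passing from integrals to
    averages costs one more power through [rho_doubling]. *)
Lemma avg_growth : exists s : nat, exists2 C : R, 0 < C & forall k t u,
  0 < k -> k <= 1 -> 0 <= t <= pi -> 0 <= u <= pi ->
  arc_avg w k u <= C * (1 + `|u - t| / k) ^+ s * arc_avg w k t.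
Proof.
have [s hs] := wint_growth W; have [_ w0 _ _ _] := W.
exists (2 * s + 1)%N; exists (4 * 128 ^+ s * 128).
  by apply: mulr_gt0; [apply: mulr_gt0; [|apply: exprn_gt0]|]; rewrite ltr0n.
move=> k t u k0 k1 tI uI.
have rt := rho_gt0 (cos t) k0; have ru := rho_gt0 (cos u) k0.
set d := `|u - t|; have d0 : 0 <= d := normr_ge0 _.
have dk0 : 0 <= d / k by rewrite divr_ge0 // ltW.
have /andP[lt1 lt2] := arc_length k0 k1 tI; have /andP[lu1 lu2] := arc_length k0 k1 uI.
have [bt1 bt2] := arc_bounds k t; have [bu1 bu2] := arc_bounds k u.
pose A := Num.min (arc_lo k t) (arc_lo k u); pose B := Num.max (arc_hi k t) (arc_hi k u).
have [A1 At Au] : [/\ -1 <= A, A <= arc_lo k t & A <= arc_lo k u].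
  by rewrite le_min !ge_min bt1 bu1 !lexx orbT.
have [B1 Bt Bu] : [/\ B <= 1, arc_hi k t <= B & arc_hi k u <= B].
  by rewrite ge_max !le_max bt2 bu2 !lexx orbT.
have far v : 0 <= v <= pi -> `|v - t| <= d + k -> `|cos v - cos t| <= (1 + d / k) ^+ 2 * rho k (cos t).
  move=> vI h; apply: le_trans (cos_dist_le v tI) _.
  apply: le_trans (_ : rho ((1 + d / k) * k) (cos t) <= _).
    by apply: rho_le => //; rewrite mulrDl divfK ?lt0r_neq0 //; lra.
  by apply: rho_scale_le; lra.
have eb x v : 0 <= v <= pi -> `|v - t| <= d -> arc_lo k v <= x <= arc_hi k v ->
    `|x - cos t| <= (1 + d / k) ^+ 2 * rho k (cos t).
  move=> vI hv /(arc_mem k0 vI)[z zI [hz ->]]; apply: far => //.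
  by have -> : z - t = (z - v) + (v - t) by [ring]; apply: le_trans (ler_normD _ _) _; lra.
have tt : `|t - t| <= d by rewrite subrr normr0.
have lt := arc_lt k0 k1 tI; have lu := arc_lt k0 k1 uI.
have AB : B - A <= 2 * (1 + d / k) ^+ 2 * rho k (cos t).
  have hB : `|B - cos t| <= (1 + d / k) ^+ 2 * rho k (cos t).
    rewrite /B; case: (leP (arc_hi k t) (arc_hi k u)) => _; [apply: (eb _ u)|apply: (eb _ t)] => //.
      by rewrite lexx ltW.
    by rewrite lexx ltW.
  have hA : `|A - cos t| <= (1 + d / k) ^+ 2 * rho k (cos t).
    rewrite /A; case: (leP (arc_lo k t) (arc_lo k u)) => _; [apply: (eb _ t)|apply: (eb _ u)] => //.
      by rewrite lexx ltW.
    by rewrite lexx ltW.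
  by move: hA hB; rewrite !ler_norml => /andP[h1 h2] /andP[h3 h4]; lra.
have ratio1 : (B - A) / (arc_hi k t - arc_lo k t) <= 128 * (1 + d / k) ^+ 2.
  rewrite ler_pdivrMr ?subr_gt0 //; apply: le_trans AB _.
  have : 0 <= (1 + d / k) ^+ 2 by apply: sqr_ge0.
  nra.
have ratio2 : (arc_hi k t - arc_lo k t) / (arc_hi k u - arc_lo k u) <= 128 * (1 + d / k).
  rewrite ler_pdivrMr ?subr_gt0 //; apply: le_trans lt2 _.
  have h := rho_doubling k0 uI tI; rewrite distrC -/d in h.
  apply: le_trans (_ : 2 * ((1 + d / k) * rho k (cos u)) <= _); first by rewrite ler_wpM2l.
  have : (1 + d / k) * (64^-1 * rho k (cos u)) <= (1 + d / k) * (arc_hi k u - arc_lo k u).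
    by rewrite ler_wpM2l //; lra.
  nra.
have wt0 := w0 _ _ bt1 bt2.
have h1 := hs _ _ _ _ A1 At lt Bt B1.
have h2 : wint w (arc_lo k u) (arc_hi k u) <= wint w A B.
  by apply: (wint_le W) => //; exact: ltW.
have r0 : 0 <= (B - A) / (arc_hi k t - arc_lo k t).
  by apply: divr_ge0; rewrite subr_ge0; [apply: le_trans At _; apply: le_trans Bt|]; exact: ltW.
have h3 : wint w (arc_lo k u) (arc_hi k u) <= 4 * (128 * (1 + d / k) ^+ 2) ^+ s * wint w (arc_lo k t) (arc_hi k t).
  apply: le_trans h2 _; apply: le_trans h1 _; rewrite ler_wpM2r // ler_wpM2l // lerXn2r // nnegrE //.
  by rewrite mulr_ge0 // sqr_ge0.
rewrite /arc_avg.
have lu0 : 0 < arc_hi k u - arc_lo k u by rewrite subr_gt0.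
have lt0' : 0 < arc_hi k t - arc_lo k t by rewrite subr_gt0.
apply: le_trans (_ : 4 * (128 * (1 + d / k) ^+ 2) ^+ s * wint w (arc_lo k t) (arc_hi k t) / (arc_hi k u - arc_lo k u) <= _).
  by rewrite ler_wpM2r // invr_ge0 ltW.
set Wt := wint w _ _ in wt0 *; set lt' := arc_hi k t - arc_lo k t in ratio2 lt0' *.
have -> : 4 * (128 * (1 + d / k) ^+ 2) ^+ s * Wt / (arc_hi k u - arc_lo k u) =
   (4 * 128 ^+ s * ((1 + d / k) ^+ 2) ^+ s * (Wt / lt')) * (lt' / (arc_hi k u - arc_lo k u)).
  by rewrite exprMn; field; move: lu0 lt0'; clear; lra.
have -> : 4 * 128 ^+ s * 128 * (1 + d / k) ^+ (2 * s + 1) * (Wt / lt') =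
   (4 * 128 ^+ s * ((1 + d / k) ^+ 2) ^+ s * (Wt / lt')) * (128 * (1 + d / k)).
  by rewrite exprD exprM expr1; ring.
apply: ler_wpM2l ratio2; apply: mulr_ge0; last by apply: divr_ge0; [|exact: ltW].
by apply: mulr_ge0; [apply: mulr_ge0; [|apply: exprn_ge0]|apply: exprn_ge0; exact: sqr_ge0].
Qed.

(** The image of the subarc has at least the fraction [e ^ 2 / 256] of the length of the large one,
    where [e <= min d 1], so [wint_growth] compares the integrals. *)
Lemma subarc_avg (d : R) : 0 < d -> exists2 C : R, 0 < C & forall k t s,
  0 < k -> k <= 1 -> 0 <= t <= pi -> 0 <= s -> s + d * k <= pi ->
  t - k <= s -> s + d * k <= t + k ->
  arc_avg w k t <= C * (wint w (cos (s + d * k)) (cos s) / (cos s - cos (s + d * k))).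
Proof.
move=> d0; have [p hp] := wint_growth W; have [_ w0 _ _ _] := W.
have [e [e0 e1 ed]] : exists e : R, [/\ 0 < e, e <= 1 & e <= d].
  by exists (Num.min d 1); rewrite lt_min d0 ltr01 !ge_min !lexx orbT.
have c0 : 0 < 256 / e ^+ 2 by apply: divr_gt0; [rewrite ltr0n|exact: exprn_gt0].
exists (4 * (256 / e ^+ 2) ^+ p); first by apply: mulr_gt0; [rewrite ltr0n|exact: exprn_gt0].
move=> k t s k0 k1 tI s0 sp h1 h2.
have dk : 0 < d * k by rewrite mulr_gt0.
have sI : 0 <= s <= pi by lra.
have sI' : 0 <= s + d * k <= pi by lra.
have /andP[lt1 lt2] := arc_length k0 k1 tI.
have [b1 b2] := arc_bounds k t.
have /andP[m1 m2] := mem_arc k0 tI sI ltac:(rewrite ler_norml; lra).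
have /andP[m3 m4] := mem_arc k0 tI sI' ltac:(rewrite ler_norml; lra).
have ordc : cos (s + d * k) <= cos s by rewrite cos_le_anti //; lra.
have len : 64^-1 * (e ^+ 2 * rho k (cos s)) <= cos s - cos (s + d * k).
  have := cos_dist_ge sI' sI; rewrite addrC addKr (gtr0_norm dk) ler0_norm; last lra.
  have : e ^+ 2 * rho k (cos s) <= rho (e * k) (cos s).
    by apply: rho_scale_small; [exact: ltW|rewrite (ltW e0)].
  have : rho (e * k) (cos s) <= rho (d * k) (cos s).
    apply: rho_le; first by rewrite mulr_ge0 // ltW.
    by rewrite ler_wpM2r ?(ltW k0).
  lra.
have rs := rho_gt0 (cos s) k0.
have J0 : 0 < cos s - cos (s + d * k).
  by apply: lt_le_trans len; rewrite !mulr_gt0 // exprn_gt0.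
have rts : rho k (cos t) <= 2 * rho k (cos s).
  apply: le_trans (rho_doubling k0 sI tI) _; rewrite ler_wpM2r ?(ltW rs) //.
  have : `|t - s| / k <= 1 by rewrite ler_pdivrMr // mul1r ler_norml; lra.
  lra.
set I := arc_hi k t - arc_lo k t in lt1 lt2.
set J := cos s - cos (s + d * k) in len J0.
have I0 : 0 < I by rewrite subr_gt0 arc_lt.
have ratio : I / J <= 256 / e ^+ 2.
  rewrite ler_pdivrMr // mulrAC ler_pdivlMr ?exprn_gt0 //.
  have : I * e ^+ 2 <= 4 * rho k (cos s) * e ^+ 2 by rewrite ler_wpM2r ?sqr_ge0 //; lra.
  lra.
have h := hp _ _ _ _ b1 m3 ltac:(rewrite -subr_gt0; exact: J0) m2 b2.
rewrite -/I -/J in h.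
have wJ : 0 <= wint w (cos (s + d * k)) (cos s) by rewrite w0 ?cos_geN1 ?cos_le1.
rewrite /arc_avg -/I.
have h' : wint w (arc_lo k t) (arc_hi k t) <= 4 * (256 / e ^+ 2) ^+ p * wint w (cos (s + d * k)) (cos s).
  apply: le_trans h _; rewrite ler_wpM2r // ler_wpM2l // lerXn2r // nnegrE; last exact: ltW.
  by rewrite divr_ge0 // ltW.
have JI : J <= I by rewrite lerB.
rewrite ler_pdivrMr //; apply: le_trans h' _.
rewrite -!mulrA ler_wpM2l //; apply: ler_wpM2l; first by apply: exprn_ge0; exact: ltW.
by rewrite ler_peMr // mulrC ler_pdivlMr // mul1r.
Qed.

End ArcAverage.

(** * Weights comparable away from the nodes *)

Section Comparability.
Context {R : realType} (M : nat) (Z : M.-tuple R) (hZ : in_ZM Z) (w : R -> R).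
Implicit Types (a b k s t d : R).

Definition angle (j : 'I_M) : R := acos (tnth Z j).

Lemma cos_angle j : cos (angle j) = tnth Z j.
Proof. by rewrite acosK // in_itv /=; exact: hZ.1. Qed.

Lemma angleP j : 0 <= angle j <= pi.
Proof. by have h := hZ.1 j; rewrite /angle acos_ge0 ?acos_lepi. Qed.

(** Pigeonhole: [M + 1] disjoint cells against [M] node angles. *)
Lemma empty_cell a d : 0 < d -> exists i : 'I_M.+1, forall j,
  ~ (a + i%:R * d <= angle j < a + (i%:R + 1) * d).
Proof.
move=> d0; apply: contrapT => /forallNP nh.
have /choice[F hF] : forall i : 'I_M.+1, exists j : 'I_M, a + i%:R * d <= angle j < a + (i%:R + 1) * d.
  by move=> i; have /existsNP[j /contrapT] := nh i; exists j.
have Finj : injective F.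
  move=> i i' e; have := hF i; have := hF i'; rewrite e => /andP[h1 h2] /andP[h3 h4].
  have lt (x y : nat) : a + x%:R * d < a + (y%:R + 1) * d -> (x <= y)%N.
    rewrite ltrD2l ltr_pM2r // => h; have : x%:R < y.+1%:R :> R by rewrite -natr1.
    by rewrite ltr_nat ltnS.
  apply/val_inj/eqP; rewrite eqn_leq /=.
  by rewrite (lt i i' (le_lt_trans h3 h2)) (lt i' i (le_lt_trans h1 h4)).
by have := leq_card F Finj; rewrite !card_ord ltnn.
Qed.

(** The condition of [Wstar] with [eps = d / 64]: by [cos_dist_ge], angular distance [d] from a node
    gives distance at least [rho eps] at that node. *)
Lemma Wstar_arc : Wstar Z w -> exists2 c : R, 0 < c & forall d a b s t,
  0 < d -> 0 <= a -> a <= b -> b <= pi -> b - a <= 64^-1 * d ->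
  (forall j u, a <= u <= b -> d <= `|u - angle j|) ->
  a <= s <= b -> a <= t <= b -> c * w (cos t) <= w (cos s).
Proof.
move=> [_ [c c0 hc]]; exists c => // d a b s t d0 a0 ab bp bad far sI tI.
have d64 : 0 < 64^-1 * d by rewrite mulr_gt0.
have I11c u : I11 R (cos u) by rewrite /I11 /= in_itv /= cos_geN1 cos_le1.
have := hc (64^-1 * d) (cos s) (cos t) d64 (I11c s) (I11c t).
case/(_ _ _)/andP => //.
- rewrite distrC; apply: le_trans (cos_dist_le t _) _; first lra.
  by apply: rho_le => //; apply: le_trans bad; rewrite ler_norml; lra.
- move=> j; apply: le_ereal_inf_tmp => _ [p pI <-].
  apply: le_ereal_inf_tmp => _ [e [e0 he] <-]; rewrite lee_fin.
  have [u uI pu] : exists2 u, a <= u <= b & p = cos u.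
    apply: arcP => //; move: pI; rewrite /segment /= in_itv /= => /andP[h1 h2].
    have [h3 h4] : cos b <= cos s /\ cos s <= cos a by rewrite !cos_le_anti //; lra.
    have [h5 h6] : cos b <= cos t /\ cos t <= cos a by rewrite !cos_le_anti //; lra.
    apply/andP; split.
      by apply: le_trans h1; rewrite le_min h3 h5.
    by apply: le_trans h2 _; rewrite ge_max h4 h6.
  have hp : `|p - tnth Z j| <= e.
    by move: he; rewrite /= -ball_normE /= distrC => /ltW.
  apply: le_trans hp; rewrite pu -cos_angle.
  have uI' : 0 <= u <= pi by lra.
  apply: le_trans (cos_dist_ge uI' (angleP j)).
  apply: le_trans (rho_scale_ge _ _ _) _; [exact: ltW|lra|].
  by rewrite ler_wpM2l //; apply: rho_le; [exact: ltW|exact: far].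
Qed.

Lemma Wstar_interval_weight : Wstar Z w -> exists L, interval_weight w L.
Proof. by case=> /Astar_interval_weight. Qed.

(** The arc stays [129 k] away from all node angles and has length at most [2 k], which is below the
    [129 k / 64] allowed by [Wstar_arc]. *)
Lemma away_comparable L : interval_weight w L -> Wstar Z w ->
  exists2 c : R, 0 < c & forall k t s,
  0 < k -> k <= 1 -> 0 <= t <= pi -> (forall j, 130 * k <= `|t - angle j|) ->
  0 <= s <= pi -> `|s - t| <= k -> c * arc_avg w k t <= w (cos s).
Proof.
move=> W hw; have [c c0 hc] := Wstar_arc hw; exists c => // k t s k0 k1 tI far sI st.
have [_ _ _ _ wU] := W; have [b1 b2] := arc_bounds k t.
have lt := arc_lt k0 k1 tI.
rewrite mulrC -ler_pdivlMr // /arc_avg ler_pdivrMr ?subr_gt0 //.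
apply: wU => //; first exact: ltW.
move=> _ /(arc_mem k0 tI)[u uI [ut ->]]; rewrite ler_pdivlMr // mulrC.
have [e1 e2 e3 e4] := arc_ends k0 tI.
set x := Num.max _ _ in e1 e3; set y := Num.min _ _ in e2 e4.
have hx : t - k <= x by rewrite le_max lexx orbT.
have hy : y <= t + k by rewrite ge_min lexx orbT.
have inxy v : 0 <= v <= pi -> `|v - t| <= k -> x <= v <= y.
  by rewrite ler_norml /x /y ge_max le_min => /andP[-> ->]; lra.
apply: (hc (129 * k) x y); try (by apply: inxy).
- by apply: mulr_gt0; [rewrite ltr0n|].
- by case/andP: e1.
- exact: le_trans e4.
- by case/andP: e2.
- by move: hx hy k0; clear; lra.
move=> j v vI; have h : `|v - t| <= k by rewrite ler_norml; lra.
have := ler_distD v t (angle j); have := far j; rewrite (distrC t v); lra.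
Qed.

(** In a cell free of nodes [w] is comparable to its average over a short subarc, which dominates
    the average over the large arc by [subarc_avg]. The radius [k / 2] places the subarc also in the
    arc of radius [k] about any centre within [k / 2] of [t]. *)
Lemma good_arc L : interval_weight w L -> Wstar Z w ->
  exists2 d : R, 0 < d & exists2 c : R, 0 < c & forall k t,
  0 < k -> k <= 1 -> 0 <= t <= pi -> exists a,
  [/\ 0 <= a, a + d * k <= pi, t - k / 2 <= a, a + d * k <= t + k / 2 &
      forall s, a <= s <= a + d * k -> c * arc_avg w k t <= w (cos s)].
Proof.
move=> W hw; have [c c0 hc] := Wstar_arc hw; have [_ _ _ _ wU] := W.
pose m : R := M.+1%:R; have m0 : 0 < m by rewrite ltr0n.
(* With cells of length [l = k / (2 m)], the subarc has length [l / 256], the fraction [1 / 64] of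
   the distance [l / 4] it keeps from the ends of its cell. *)
pose d : R := (512 * m)^-1; have d0 : 0 < d by rewrite invr_gt0; apply: mulr_gt0; [rewrite ltr0n|].
have [C C0 hC] := subarc_avg W d0.
exists d => //; exists (c / C); first by rewrite divr_gt0.
move=> k t k0 k1 tI; have p2 := pi_ge2 R.
(* The cells fill [[A, A + k / 2]], to the right of [t] when [t <= 1] and to its left otherwise, so
   that they stay in [[0, pi]]. *)
have [A [A0 A1 A2 A3]] : exists A, [/\ 0 <= A, A + k / 2 <= pi, t - k / 2 <= A & A <= t].
  by have [h|h] := leP t 1; [exists t|exists (t - k / 2)]; split; lra.
pose l := k / (2 * m); have l0 : 0 < l by rewrite divr_gt0 // mulr_gt0.
have lm : m * l = k / 2 by rewrite /l; field; rewrite lt0r_neq0.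
have ld : d * k = 64^-1 * (l / 4) by rewrite /l /d; field; rewrite lt0r_neq0.
have [i hi] := empty_cell A l0.
have im : (i%:R + 1) * l <= k / 2.
  by rewrite -lm ler_wpM2r ?(ltW l0) // /m natr1 ler_nat.
have i0 : 0 <= i%:R * l by rewrite mulr_ge0 // ltW.
rewrite mulrDl mul1r in im.
pose a := A + i%:R * l + l / 4.
have dk0 : 0 < d * k by rewrite mulr_gt0.
have [h1 h2 h3 h4] : [/\ 0 <= a, a + d * k <= pi, t - k / 2 <= a & a + d * k <= t + k / 2].
  by rewrite /a; split; lra.
exists a; split => // s sI.
have aI : 0 <= a <= pi by lra.
have aI' : 0 <= a + d * k <= pi by rewrite h2 andbT; apply: addr_ge0 => //; exact: ltW.
have lt : cos (a + d * k) < cos a by rewrite ltr_cos ?in_itv //= ltrDl.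
rewrite mulrAC ler_pdivrMr // -ler_pdivlMl //.
apply: le_trans (hC k t a k0 k1 tI h1 h2 _ _) _; [lra|lra|].
rewrite mulrC [leRHS]mulrA ler_wpM2r ?(ltW C0) // ler_pdivrMr ?subr_gt0 //.
apply: wU; rewrite ?cos_geN1 ?cos_le1 ?(ltW lt) //.
move=> x /arcP[] //; first lra.
move=> u uI ->; rewrite ler_pdivlMl //.
apply: (hc (l / 4) a (a + d * k)).
- by rewrite divr_gt0.
- exact: h1.
- by rewrite lerDl ltW.
- exact: h2.
- by rewrite addrC addKr ld.
- move=> j v vI; have hj := hi j; rewrite leNgt; apply/negP; rewrite ltr_norml => h.
  apply: hj; rewrite mulrDl mul1r; move: h vI ld l0; rewrite /a; clear; lra.
- exact: sI.
- exact: uI.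
Qed.

End Comparability.

(** * Local approximants *)

Section ModulusBounds.
Context {R : realType}.
Local Notation mu := (@lebesgue_measure R).
Implicit Types (f w g : R -> R) (I : set R).

Lemma completed_setT_gt0 : (0 < @completed_lebesgue_measure R setT)%E.
Proof.
apply: (@lt_le_trans _ _ (@completed_lebesgue_measure R `]0, 1]%classic)).
  by rewrite completed_itv // subr0 lte01.
by apply: le_measure => //; rewrite inE //; apply: measurable_lebesgueR; exact: measurable_itv.
Qed.

Lemma esup_norm_ge0 I g : (0 <= esup_norm I g)%E.
Proof.
rewrite -(ess_sup_cst (0 : \bar R) completed_setT_gt0).
apply: le_ess_sup; apply: aeW => x.
by rewrite patchE; case: ifPn => // _; rewrite lee_fin.
Qed.

Lemma best_approx_ge0 r f I w : (0 <= best_approx r f I w)%E.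
Proof. by apply: le_ereal_inf_tmp => _ [q _ <-]; exact: esup_norm_ge0. Qed.

Lemma esup_norm_lty I g : (esup_norm I g < +oo)%E ->
  exists2 K : R, 0 <= K & {ae mu, forall x, I x -> `|g x| <= K}.
Proof.
move=> h; have h0 := esup_norm_ge0 I g.
have fin : esup_norm I g \is a fin_num by rewrite ge0_fin_numE.
exists (fine (esup_norm I g)); first exact: fine_ge0.
by apply/esup_normP; rewrite ?fine_ge0 // fineK.
Qed.

Context (M : nat) (Z : M.-tuple R).

Lemma main_modulus_ge0 r f A t w : 0 < t -> (0 <= main_modulus Z r f A t w)%E.
Proof.
move=> t0.
apply: (@le_trans _ _ (esup_norm (I11 R) (fun x => w x * sym_diff r (t * phi x) f x (away_Z Z A t)))).
  exact: esup_norm_ge0.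
by apply: ereal_sup_ubound; exists t => //=; rewrite t0 lexx.
Qed.

Lemma complete_modulus_ge0 r f A B t w : 0 < t -> (0 <= complete_modulus Z r f A B t w)%E.
Proof.
move=> t0; rewrite adde_ge0 ?main_modulus_ge0 //.
by apply: sume_ge0 => j _; exact: best_approx_ge0.
Qed.

Lemma complete_modulus_le r f A B t t' w : 0 < t -> 0 < B -> t <= t' ->
  (complete_modulus Z r f A B t w <= complete_modulus Z r f A B t' w)%E.
Proof.
move=> t0 B0 tt; apply: leeD.
  apply: ereal_sup_le => _ [h /= /andP[h0 ht] <-]; exists h => //=.
  by rewrite h0 (le_trans ht).
apply: lee_sum => j _; apply: le_ereal_inf_tmp => _ [q sq <-].
apply: ge_ereal_inf; eexists; first by exists q.
apply: le_ess_sup; apply: aeW => x; rewrite !patchE.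
case: ifPn => [xn|_]; last by case: ifPn => // _; rewrite lee_fin.
rewrite ifT //; move: xn; rewrite !inE => -[xI h]; split => //.
by apply: le_trans h _; rewrite ler_wpM2l ?(ltW B0) // rho_le // ltW.
Qed.

(** The strict inequality is what produces actual polynomials [q]: the infimum in [best_approx] need
    not be attained. *)
Lemma modulus_bounds r f (A B t Om : R) w : 0 < t ->
  (complete_modulus Z r f A B t w < Om%:E)%E ->
  (forall h, 0 < h -> h <= t -> {ae mu, forall x, I11 R x ->
     `|w x * sym_diff r (h * phi x) f x (away_Z Z A h)| <= Om}) /\
  (forall j, exists2 q : {poly R}, (size q <= r)%N &
     {ae mu, forall x, near_Z Z B t j x -> `|w x * (f x - q.[x])| <= Om}).
Proof.
move=> t0 lt.
have Om0 : 0 <= Om by rewrite -lee_fin; apply: ltW; apply: le_lt_trans lt; exact: complete_modulus_ge0.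
split.
- move=> h h0 ht; apply/esup_normP => //; apply: le_trans (ltW lt).
  apply: (@le_trans _ _ (main_modulus Z r f A t w)).
    by apply: ereal_sup_ubound; exists h => //=; rewrite h0.
  by rewrite leeDl //; apply: sume_ge0 => j _; exact: best_approx_ge0.
- move=> j.
  have : (best_approx r f (near_Z Z B t j) w < Om%:E)%E.
    apply: le_lt_trans lt.
    apply: (@le_trans _ _ (\sum_(i < M) best_approx r f (near_Z Z B t i) w)%E).
      rewrite (bigD1 j) //= leeDl //; apply: sume_ge0 => i _; exact: best_approx_ge0.
    by rewrite leeDr // main_modulus_ge0.
  move=> /ereal_inf_ltP[_ [q sq <-] hq]; exists q => //.
  by apply/esup_normP => //; exact: ltW.
Qed.

End ModulusBounds.

Section LocalApproximants.
Context {R : realType} (M : nat) (Z : M.-tuple R) (hZ : in_ZM Z) (w : R -> R) (L : R).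
Local Notation mu := (@lebesgue_measure R).
Implicit Types (k t u : R).
Context (W : interval_weight w L) (hw : Wstar Z w) (w_pos : 0 < wint w (-1) 1).

(** By [wint_growth] an arc without mass would leave none on all of [[-1, 1]]. *)
Lemma avg_gt0 k t : 0 < k -> k <= 1 -> 0 <= t <= pi -> 0 < arc_avg w k t.
Proof.
move=> k0 k1 tI; have [b1 b2] := arc_bounds k t; have lt := arc_lt k0 k1 tI.
rewrite divr_gt0 ?subr_gt0 //.
have [s hs] := wint_growth W.
rewrite ltNge; apply/negP => h.
have := hs _ _ (-1) 1 (lexx _) b1 lt b2 (lexx _).
rewrite leNgt => /negP; apply; apply: le_lt_trans w_pos.
rewrite mulr_ge0_le0 // mulr_ge0 // exprn_ge0 // divr_ge0 //; lra.
Qed.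

(* The step is bounded through the endpoint of [-1, 1] closest to x. *)
Lemma arc_step k t x s : 0 < k -> k <= 1 -> 0 <= t <= pi -> 0 <= s ->
  arc_lo k t <= x - s / 2 -> x + s / 2 <= arc_hi k t -> s <= 4 * k * phi x.
Proof.
move=> k0 k1 tI s0 h1 h2.
have xA : arc_lo k t <= x <= arc_hi k t by lra.
have [v vI [vt ev]] := arc_mem k0 tI xA.
have p2 := pi_ge2 R.
(* The difference of cosines is [2 sin ((u + v) / 2) |sin ((u - v) / 2)|]; the last factor is at
   most [k], as both angles lie within [k] of [t]. *)
have key (u : R) : 0 <= u <= pi -> `|u - t| <= k -> sin ((u + v) / 2) <= sin v ->
    s / 2 = `|cos u - cos v| -> s <= 4 * k * phi x.
  move=> uI ut sv e.
  have h3 : 0 <= sin ((u + v) / 2) by apply: sin_ge0_pi; lra.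
  have h4 : `|sin ((u - v) / 2)| <= k.
    apply: le_trans (normr_sin_le _) _; rewrite normrM [`|2^-1|]ger0_norm //.
    by have := ler_distD t u v; rewrite (distrC t v); lra.
  have e' : cos u - cos v = - (2 * sin ((u + v) / 2) * sin ((u - v) / 2)).
    have -> : cos u = cos ((u + v) / 2 + (u - v) / 2) by congr cos; lra.
    have -> : cos v = cos ((u + v) / 2 - (u - v) / 2) by congr cos; lra.
    by rewrite cosD cosB; ring.
  rewrite ev phi_cos //.
  have : s / 2 <= 2 * sin v * k.
    rewrite e e' normrN normrM normrM (ger0_norm h3) [`|2|]ger0_norm //.
    apply: ler_pM => //; [by apply: mulr_ge0|lra].
  lra.
have bnd : -1 <= arc_lo k t /\ arc_hi k t <= 1 := arc_bounds k t.
have [h|h] := leP v (pi / 2).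
- have yA : arc_lo k t <= x + s / 2 <= arc_hi k t by lra.
  have [u uI [ut eu]] := arc_mem k0 tI yA.
  have uv : u <= v by rewrite -cos_le_anti // -eu -ev; lra.
  apply: (key u) => //; last by rewrite -eu -ev ger0_norm; lra.
  have : sin ((u + v) / 2) <= sin v; last by [].
  rewrite le_eqVlt; have [->|ne] := eqVneq u v; first by rewrite (_ : (v + v) / 2 = v) ?eqxx //; lra.
  rewrite ltr_sin ?in_itv /=; [|lra|lra]; apply/orP; right.
  by have : u < v by [rewrite lt_neqAle ne]; lra.
- have yA : arc_lo k t <= x - s / 2 <= arc_hi k t by lra.
  have [u uI [ut eu]] := arc_mem k0 tI yA.
  have uv : v <= u by rewrite -cos_le_anti // -eu -ev; lra.
  apply: (key u) => //; last by rewrite -eu -ev ler0_norm; lra.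
  have sinpB (y : R) : sin (pi - y) = sin y by rewrite sinB sinpi cospi; ring.
  rewrite -(sinpB ((u + v) / 2)) -(sinpB v).
  rewrite le_eqVlt; have [->|ne] := eqVneq u v; first by rewrite (_ : (v + v) / 2 = v) ?eqxx //; lra.
  rewrite ltr_sin ?in_itv /=; [|lra|lra]; apply/orP; right.
  by have : v < u by [rewrite lt_neqAle eq_sym ne]; lra.
Qed.

Definition local_family r f k Om (p : R -> {poly R}) : Prop :=
  forall t, 0 <= t <= pi -> (size (p t) <= r)%N /\
    {ae mu, forall x, arc_lo k t <= x <= arc_hi k t -> `|w x * (f x - (p t).[x])| <= Om}.

(** The threshold is [257 k]. Below it the arc is within [258 k] of a node, hence inside the set
    where the modulus supplies a polynomial. Above it the arc keeps [256 k = 64 * (4 k)] from every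
    node, so by [cos_dist_ge] it lies in [away_Z] for all parameters up to [4 k], which by
    [arc_step] are all that its differences involve. *)
Lemma local_approximation r B : (0 < r)%N -> 0 < B -> exists2 C : R, 0 < C &
  forall f k h Om, Linf_w w f -> 0 < k -> k <= 1 -> 0 < Om -> 0 < h ->
    258 * k <= h -> 258 * k <= B * h ->
    (complete_modulus Z r f 1 B h w < Om%:E)%E ->
    exists p, local_family r f k (C * Om) p.
Proof.
move=> r0 B0; have [c c0 hc] := away_comparable hZ W hw.
have [C0 C00 hC] := @whitney_interval R r r0.
have [L1 _ _ _ _] := W.
pose C := 1 + L * (C0 / c).
have C0c : 0 <= C0 / c by rewrite divr_ge0 // ltW.
have LC : 0 <= L * (C0 / c) by rewrite mulr_ge0 //; lra.
exists C; first by rewrite /C; lra.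
move=> f k h Om [mf bf] k0 k1 Om0 h0 kh kB cm.
have [D N] := modulus_bounds h0 cm.
have [K K0 hK] := esup_norm_lty bf.
suff : forall t, exists p : {poly R}, 0 <= t <= pi -> (size p <= r)%N /\
    {ae mu, forall x, arc_lo k t <= x <= arc_hi k t -> `|w x * (f x - p.[x])| <= C * Om}.
  by move=> /choice[p hp]; exists p => t; exact: hp.
move=> t; have [tI|] := boolP (0 <= t <= pi); last by exists 0.
have I11c (u : R) : I11 R (cos u) by rewrite /I11 /= in_itv /= cos_geN1 cos_le1.
have wI u : 0 <= w (cos u).
  by case: (hw) => -[w0 _ _] _; apply: w0; exact: I11c.
have [[j nj]|/forallNP far] := pselect (exists j, `|t - angle Z j| < 257 * k).
- have [q sq hq] := N j; exists q => _; split => //.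
  apply: (ae_mono hq) => x hx /(arc_mem k0 tI)[u uI [ut xu]].
  apply: le_trans (hx _) _; last by rewrite ler_peMl ?(ltW Om0) // lerDl.
  rewrite xu; split; first exact: I11c.
  rewrite -(cos_angle hZ); apply: le_trans (cos_dist_le u (angleP hZ j)) _.
  have d : `|u - angle Z j| <= 258 * k.
    by move: ut nj (ler_distD t u (angle Z j)); clear -hZ W hw w_pos; lra.
  apply: le_trans (rho_le _ (normr_ge0 _) d) _.
  have k258 : 0 <= 258 * k by apply: mulr_ge0; [exact: ler0n|exact: ltW].
  (* For [B >= 1] monotonicity of [rho] in [h] suffices; for [B < 1] the factor [B] is moved inside
     by [rho_scale_ge]. *)
  have [B1|B1] := leP 1 B.
    by apply: le_trans (rho_le _ k258 kh) _; rewrite ler_peMl // ltW // rho_gt0.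
  apply: le_trans (rho_le _ k258 kB) _; apply: rho_scale_ge; [exact: ltW|].
  by rewrite !ltW.
have far' j : 257 * k <= `|t - angle Z j| by rewrite leNgt; apply/negP/far.
have V0 := avg_gt0 k0 k1 tI; set V := arc_avg w k t in V0.
have wlow x : arc_lo k t <= x <= arc_hi k t -> c * V <= w x.
  move=> /(arc_mem k0 tI)[u uI [ut ->]]; apply: hc => // j.
  by apply: le_trans (far' j); rewrite ler_wpM2r ?(ltW k0) // ler_nat.
have wup x : arc_lo k t <= x <= arc_hi k t -> w x <= L * V.
  by move=> /(arc_mem k0 tI)[u uI [ut ->]]; exact: (weight_le_avg W).
have cV : 0 < c * V by rewrite mulr_gt0.
have [b1 b2] := arc_bounds k t.
have inI11 x : arc_lo k t <= x <= arc_hi k t -> I11 R x.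
  by rewrite /I11 /= in_itv /=; move: b1 b2; clear -hZ W hw w_pos; lra.
have [||||x s s0 h1 h2|p sp hp] := hC f (arc_lo k t) (arc_hi k t) (4 * k) (Om / (c * V)) (K / (c * V))
   b1 (arc_lt k0 k1 tI) b2 _ _ mf.
- by rewrite divr_gt0.
- by rewrite divr_ge0 // ltW.
- apply: (ae_mono hK) => x hx xI; rewrite ler_pdivlMr //.
  apply: le_trans (hx (inI11 x xI)); rewrite normrM mulrC ler_wpM2r //.
  by apply: le_trans (ler_norm _); exact: wlow.
- move=> e e0 ek; have eh : e <= h by move: ek kh k0; clear -hZ W hw w_pos; lra.
  apply: (ae_mono (D e e0 eh)) => x hx h1 h2.
  have st : 0 <= r%:R * (e * phi x) / 2 by rewrite !mulr_ge0 ?phi_ge0 // ltW.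
  have xI : arc_lo k t <= x <= arc_hi k t by move: h1 h2 st; clear -hZ W hw w_pos; lra.
  rewrite ler_pdivlMr // mulrC; apply: le_trans (hx (inI11 x xI)).
  rewrite /sym_diff asboolT.
    rewrite -/(sdiff r f x (e * phi x)) normrM ler_wpM2r //.
    by apply: le_trans (ler_norm _); exact: wlow.
  move=> y; rewrite /= in_itv /= => /andP[y1 y2].
  have yI : arc_lo k t <= y <= arc_hi k t by move: h1 h2 y1 y2; clear -hZ W hw w_pos; lra.
  split; first exact: inI11.
  move=> j; have [u uI [ut ->]] := arc_mem k0 tI yI.
  rewrite mul1r -(cos_angle hZ).
  apply: le_trans (cos_dist_ge uI (angleP hZ j)).
  have d : 256 * k <= `|u - angle Z j|.
    by move: ut (far' j) (ler_distD u t (angle Z j)); rewrite (distrC t u); clear -hZ W hw w_pos; lra.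
  have h64 : 0 <= 64 * (4 * k) by apply: mulr_ge0; [|apply: mulr_ge0; [|exact: ltW]].
  apply: (@le_trans _ _ (rho (64^-1 * (64 * (4 * k))) (cos (angle Z j)))).
    have -> : 64^-1 * (64 * (4 * k)) = 4 * k by rewrite mulKf // pnatr_eq0.
    by apply: rho_le => //; exact: ltW.
  apply: le_trans (rho_scale_ge _ h64 _) _.
    by rewrite invr_ge0 invf_le1 // ler0n ler1n.
  by rewrite ler_wpM2l ?invr_ge0 //; apply: rho_le => //; move: d; clear -hZ W hw w_pos; lra.
- have r1 : (1 : R) <= r%:R by rewrite ler1n.
  have rs : s <= r%:R * s by rewrite ler_peMl // ltW.
  by apply: (@arc_step k t x s k0 k1 tI (ltW s0)); move: rs h1 h2; clear -hZ W hw w_pos; lra.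
exists p => _; split => //; apply: (ae_mono hp) => x hx xI.
rewrite normrM; have w0 : 0 <= w x by apply: le_trans (ltW cV) (wlow x xI).
rewrite (ger0_norm w0).
apply: (@le_trans _ _ (L * V * (C0 * (Om / (c * V))))).
  by apply: ler_pM => //; [exact: wup|exact: hx].
have -> : L * V * (C0 * (Om / (c * V))) = L * (C0 / c) * Om by field; rewrite !lt0r_neq0.
by rewrite ler_wpM2r ?(ltW Om0) // lerDr.
Qed.

End LocalApproximants.

(** * Comparison of local approximants *)

Section Chain.
Context {R : realType} (M : nat) (Z : M.-tuple R) (hZ : in_ZM Z) (w : R -> R) (L : R).
Local Notation mu := (@lebesgue_measure R).
Implicit Types (k t u Om : R) (f : R -> R).
Context (W : interval_weight w L) (hw : Wstar Z w) (w_pos : 0 < wint w (-1) 1).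

(** The good subarc for [t] lies in both arcs and [w] is at least [c V] on it, so the two
    polynomials differ there by at most [2 Om / (c V)]. Extension by [poly_growth] costs the power
    [2 (r - 1)]: distances of cosines are at most quadratic in angular distance over [k]. *)
Lemma neighbor_growth r : exists P : nat, exists2 C : R, 0 < C &
  forall f k Om p t t' u, 0 < k -> k <= 1 -> 0 <= Om -> local_family w r f k Om p ->
  0 <= t <= pi -> 0 <= t' <= pi -> `|t - t'| <= k / 2 -> 
  arc_avg w k t * `|(p t).[cos u] - (p t').[cos u]| <= C * Om * (1 + `|u - t| / k) ^+ P.
Proof.
have [d d0 [c c0 hc]] := good_arc hZ W hw.
have [e [e0 e1 ed]] : exists e : R, [/\ 0 < e, e <= 1 & e <= d].
  by exists (Num.min d 1); rewrite lt_min d0 ltr01 !ge_min !lexx orbT.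
pose G := 1 + 64 / e ^+ 2.
have G0 : 0 < 64 / e ^+ 2 by apply: divr_gt0; [rewrite ltr0n|exact: exprn_gt0].
have G1 : 0 < G by rewrite /G; lra.
exists (2 * r.-1)%N; pose C := r%:R * (r%:R * G) ^+ r.-1 * (2 / c).
have C0 : 0 <= C.
  rewrite /C; apply: mulr_ge0; last by apply: divr_ge0 => //; exact: ltW.
  by apply: mulr_ge0 => //; apply: exprn_ge0; apply: mulr_ge0 => //; exact: ltW.
exists (C + 1); first by lra.
move=> f k Om p t t' u k0 k1 Om0 hp tI tI' tt.
have [a [a0 a1 a2 a3 ha]] := hc k t k0 k1 tI.
have V0 := avg_gt0 W w_pos k0 k1 tI; set V := arc_avg w k t in ha V0 *.
have cV : 0 < c * V by rewrite mulr_gt0.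
have dk : 0 < d * k by rewrite mulr_gt0.
have aI : 0 <= a <= pi by lra.
have bI : 0 <= a + d * k <= pi by lra.
set lo := cos (a + d * k); pose l := cos a - lo.
have rlo := rho_gt0 lo k0.
have ll : 64^-1 * (e ^+ 2 * rho k lo) <= l.
  have lol : lo <= cos a by rewrite cos_le_anti //; lra.
  have := cos_dist_ge aI bI; rewrite -/lo (ger0_norm (_ : 0 <= cos a - lo)) ?subr_ge0 //.
  rewrite distrC addrC addKr (gtr0_norm dk) -/l.
  have : e ^+ 2 * rho k lo <= rho (e * k) lo by apply: rho_scale_small; [exact: ltW|rewrite (ltW e0)].
  have : rho (e * k) lo <= rho (d * k) lo.
    by apply: rho_le; [exact/ltW/mulr_gt0|rewrite ler_wpM2r ?(ltW k0)].
  lra.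
have l0 : 0 < l by apply: lt_le_trans ll; rewrite !mulr_gt0 // exprn_gt0.
have [sp bp] := hp t tI; have [sp' bp'] := hp t' tI'.
have sq : (size (p t - p t')%R <= r)%N by rewrite (leq_trans (size_polyD _ _)) // size_polyN geq_max sp sp'.
have bq z : lo <= z <= lo + l -> `|(p t - p t').[z]| <= 2 * Om / (c * V).
  apply: ae_poly_bound; first lra.
  apply: (ae_mono (ae_conj bp bp')) => x [h1 h2] xI.
  have [v vI ev] : exists2 v, a <= v <= a + d * k & x = cos v.
    by apply: arcP => //; [rewrite lerDl ltW|rewrite -/lo; move: xI; rewrite /l; clear -hZ W hw w_pos; lra].
  have vI' : 0 <= v <= pi by lra.
  have {}h1 := h1 ltac:(rewrite ev; apply: mem_arc => //; rewrite ler_norml; move: a2 a3 vI k0; clear -hZ W hw w_pos; lra).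
  have {}h2 := h2 ltac:(rewrite ev; apply: mem_arc => //; move: tt a2 a3 vI; rewrite !ler_norml; clear -hZ W hw w_pos; lra).
  have wx : c * V <= w x by rewrite ev; exact: ha.
  have w0 : 0 <= w x by apply: le_trans wx; exact: ltW.
  rewrite ler_pdivlMr // hornerD hornerN.
  have -> : (p t).[x] - (p t').[x] = (f x - (p t').[x]) - (f x - (p t).[x]) by ring.
  rewrite !normrM !(ger0_norm w0) in h1 h2.
  set A := f x - _ in h2 *; set A' := f x - _ in h1 *.
  apply: (@le_trans _ _ ((`|A| + `|A'|) * w x)); last by rewrite mulrDl; move: h1 h2; clear -hZ W hw w_pos; lra.
  by apply: ler_pM => //; [exact: ltW|exact: ler_normB].
have := poly_growth (cos u) l0 sq bq; rewrite hornerD hornerN => hg.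
set D := `|u - t| / k; have D0 : 0 <= D by rewrite divr_ge0 // ltW.
have ratio : r%:R * (`|cos u - lo| + l) / l <= r%:R * G * (1 + D) ^+ 2.
  rewrite -!mulrA ler_wpM2l // mulrDl divff ?lt0r_neq0 //.
  have D1 : 1 <= (1 + D) ^+ 2 by rewrite exprn_ege1 // lerDl.
  suff : `|cos u - lo| / l <= 64 / e ^+ 2 * (1 + D) ^+ 2 by rewrite /G mulrDl mul1r; move: D1; clear -hZ W hw w_pos; lra.
  rewrite ler_pdivrMr //.
  apply: (@le_trans _ _ ((1 + D) ^+ 2 * rho k lo)).
    apply: le_trans (cos_dist_le u bI) _; rewrite -/lo.
    apply: le_trans (_ : rho ((1 + D) * k) lo <= _).
      apply: rho_le => //; rewrite mulrDl mul1r divfK ?lt0r_neq0 //.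
      apply: le_trans (ler_distD t _ _) _; rewrite addrC lerD2r ler_norml; move: a0 a1 a2 a3 k0 dk; clear -hZ W hw w_pos; lra.
    by apply: rho_scale_le; [exact: ltW|rewrite lerDl].
  have -> : 64 / e ^+ 2 * (1 + D) ^+ 2 * l = (1 + D) ^+ 2 * (64 / e ^+ 2 * l) by ring.
  rewrite ler_wpM2l ?sqr_ge0 //.
  have -> : 64 / e ^+ 2 * l = (64 * l) / e ^+ 2 by rewrite mulrAC.
  by rewrite ler_pdivlMr ?exprn_gt0 //; move: ll; clear -hZ W hw w_pos; lra.
apply: le_trans (ler_wpM2l (ltW V0) hg) _.
have step : r%:R * (r%:R * (`|cos u - lo| + l) / l) ^+ r.-1 * (2 * Om / (c * V)) <=
    r%:R * (r%:R * G * (1 + D) ^+ 2) ^+ r.-1 * (2 * Om / (c * V)).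
  apply: ler_wpM2r.
    by apply: divr_ge0; [exact: mulr_ge0|exact: ltW].
  apply: ler_wpM2l => //; apply: lerXn2r; rewrite ?nnegrE //.
    by apply: divr_ge0; [apply: mulr_ge0 => //; apply: addr_ge0 => //; exact: ltW|exact: ltW].
  by apply: mulr_ge0 (sqr_ge0 _); apply: mulr_ge0 => //; exact: ltW.
apply: le_trans (ler_wpM2l (ltW V0) step) _.
have -> : V * (r%:R * (r%:R * G * (1 + D) ^+ 2) ^+ r.-1 * (2 * Om / (c * V))) = C * Om * (1 + D) ^+ (2 * r.-1).
  by rewrite /C (exprMn _ (r%:R * G)) -exprM; field; rewrite !lt0r_neq0.
by apply: ler_wpM2r; [apply: exprn_ge0; exact: addr_ge0|rewrite ler_wpM2r // lerDl].
Qed.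

(** The centres are joined by at most [2 D + 1] links of length at most [k / 2]. Each link is
    estimated with the average at its own centre and brought to the average at [t] by [avg_growth];
    the number of links adds one to the exponent. *)
Lemma chain_growth r : exists P : nat, exists2 C : R, 0 < C &
  forall f k Om p t u, 0 < k -> k <= 1 -> 0 <= Om -> local_family w r f k Om p ->
  0 <= t <= pi -> 0 <= u <= pi ->
  arc_avg w k t * `|(p u).[cos t] - (p t).[cos t]| <= C * Om * (1 + `|t - u| / k) ^+ P.
Proof.
have [P1 [C1 C10 h1]] := neighbor_growth r.
have [s [C2 C20 h2]] := avg_growth W.
exists (s + P1).+1; exists (2 * (C1 * C2)); first by rewrite !mulr_gt0.
move=> f k Om p t u k0 k1 Om0 hp tI uI.
set D := `|t - u| / k; have D0 : 0 <= D by rewrite divr_ge0 // ltW.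
have V0 := avg_gt0 W w_pos k0 k1 tI; set V := arc_avg w k t in V0 *.
pose X := C1 * C2 * Om * (1 + D) ^+ (s + P1).
have X0 : 0 <= X by rewrite !mulr_ge0 ?exprn_ge0 ?(ltW C10) ?(ltW C20) //; lra.
have claim (m : nat) : forall v, 0 <= v <= pi -> `|v - t| <= m%:R * (k / 2) -> `|v - t| <= D * k ->
    V * `|(p v).[cos t] - (p t).[cos t]| <= m%:R * X.
  elim: m => [|m IH] v vI h hD.
    rewrite mul0r in h; have -> : v = t by move: h; rewrite ler_norml; lra.
    by rewrite subrr normr0 mulr0 mul0r.
  have m1 : 0 < m.+1%:R :> R by rewrite ltr0n.
  pose q : R := m%:R / m.+1%:R.
  have q0 : 0 <= q by rewrite divr_ge0.
  have q1 : q <= 1 by rewrite ler_pdivrMr // mul1r ler_nat.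
  pose v' := t + (v - t) * q.
  have e1 : v' - t = (v - t) * q by rewrite /v'; ring.
  have e2 : v' - v = - ((v - t) / m.+1%:R).
    by rewrite /v' /q -natr1; field; rewrite natr1 lt0r_neq0.
  have vI' : 0 <= v' <= pi.
    rewrite /v'; have [hh|hh] := leP 0 (v - t).
      have : (v - t) * q <= v - t by rewrite ler_piMr.
      have : 0 <= (v - t) * q by rewrite mulr_ge0.
      lra.
    have : 0 <= (t - v) * (1 - q) by apply: mulr_ge0; lra.
    have : 0 <= (t - v) * q by apply: mulr_ge0; lra.
    lra.
  have d1 : `|v' - t| = `|v - t| * q by rewrite e1 normrM (ger0_norm q0).
  have d1' : `|v' - t| <= `|v - t| by rewrite d1 ler_piMr.
  have a1 : `|v' - t| <= m%:R * (k / 2).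
    have -> : m%:R * (k / 2) = m.+1%:R * (k / 2) * q by rewrite /q; field; rewrite addrC natr1 lt0r_neq0.
    by rewrite d1 ler_wpM2r.
  have a2 : `|v' - v| <= k / 2.
    rewrite e2 normrN normrM [`|_^-1|]ger0_norm ?invr_ge0 ?(ltW m1) // ler_pdivrMr //; lra.
  have IH' := IH v' vI' a1 (le_trans d1' hD).
  have n1 := h1 f k Om p v' v t k0 k1 Om0 hp vI' vI a2.
  have n2 := h2 k v' t k0 k1 vI' tI; rewrite -/V in n2.
  have D' : (1 + `|t - v'| / k) <= 1 + D.
    by rewrite lerD2l distrC ler_pdivrMr //; exact: le_trans hD.
  have D1 : 0 <= 1 + `|t - v'| / k by rewrite addr_ge0 // divr_ge0 // ltW.
  have D2 : 0 <= 1 + D by exact: addr_ge0.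
  set A := `|(p v').[cos t] - (p v).[cos t]| in n1.
  have nA : V * A <= X.
    apply: (@le_trans _ _ (C2 * (1 + D) ^+ s * (arc_avg w k v' * A))).
      rewrite (mulrA (C2 * _)); apply: ler_wpM2r; first exact: normr_ge0.
      apply: le_trans n2 _.
      rewrite ler_wpM2r ?(ltW (avg_gt0 W w_pos k0 k1 vI')) // ler_wpM2l ?(ltW C20) //.
      by rewrite lerXn2r // nnegrE.
    have -> : X = C2 * (1 + D) ^+ s * (C1 * Om * (1 + D) ^+ P1) by rewrite /X exprD; ring.
    rewrite ler_wpM2l; [by []|by rewrite mulr_ge0 ?exprn_ge0 // ltW|].
    apply: le_trans n1 _; rewrite ler_wpM2l; [by []|by rewrite mulr_ge0 // ltW|].
    by rewrite lerXn2r // nnegrE.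
  rewrite -natr1 mulrDl mul1r; apply: le_trans (lerD IH' nA).
  rewrite -mulrDr ler_wpM2l ?(ltW V0) //.
  have -> : (p v).[cos t] - (p t).[cos t] = ((p v').[cos t] - (p t).[cos t]) - ((p v').[cos t] - (p v).[cos t]) by ring.
  exact: ler_normB.
pose m := (Num.truncn (2 * D)).+1.
have m1 : 2 * D < m%:R by rewrite truncnS_gt.
have m2 : m%:R <= 2 * D + 1.
  have D20 : 0 <= 2 * D by apply: mulr_ge0.
  by rewrite /m -natr1 lerD2r; have /andP[] := truncn_itv D20.
have eD : D * k = `|u - t| by rewrite /D divfK ?lt0r_neq0 // distrC.
have := claim m u uI; rewrite -eD => /(_ _ (lexx _))h.
apply: le_trans (h _) _.
  have : 2 * D * k <= m%:R * k by rewrite ler_wpM2r ?(ltW k0) // ltW.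
  lra.
apply: (@le_trans _ _ (2 * (1 + D) * X)); first by rewrite ler_wpM2r //; lra.
by rewrite /X exprS le_eqVlt; apply/orP; left; apply/eqP; ring.
Qed.

End Chain.

(** * Gluing local polynomials with Fejér kernels *)

Section Gluing.
Context {R : realType}.
Implicit Types (k t u E : R) (V : R -> R) (p : R -> {poly R}).

(** Expresses the growth in the quantity [1 + N ^ 2 (1 - cos)] that one factor of the Fejér kernel
    absorbs, through [1 + y <= 2 (1 + y ^ 2)] and [one_sub_cos_ge]. *)
Lemma distance_growth k (N : R) t u : 0 < k -> 0 < N -> 0 <= t <= pi -> 0 <= u <= pi ->
  1 + `|t - u| / k <= 2 * (1 + 32 / (N * k) ^+ 2) * (1 + N ^+ 2 * (1 - cos (t - u))).
Proof.
move=> k0 N0 tI uI.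
have tu : `|t - u| <= pi by rewrite ler_norml; lra.
have h := one_sub_cos_ge tu; rewrite -real_normK ?num_real // in h.
set y := `|t - u| / k; have y0 : 0 <= y by rewrite divr_ge0 // ltW.
have ey : `|t - u| = y * k by rewrite /y divfK // lt0r_neq0.
rewrite ey exprMn in h.
set b := 1 - cos (t - u) in h *.
have b0 : 0 <= b by apply: le_trans h; rewrite divr_ge0 // mulr_ge0 // sqr_ge0.
have Nk : 0 < (N * k) ^+ 2 by rewrite exprn_gt0 // mulr_gt0.
set G := 32 / (N * k) ^+ 2; have G0 : 0 <= G by apply: divr_ge0; [exact: ler0n|exact: ltW].
have h2 : y ^+ 2 <= G * (N ^+ 2 * b).
  rewrite /G mulrAC ler_pdivlMr //.
  have -> : (N * k) ^+ 2 = N ^+ 2 * k ^+ 2 by rewrite exprMn.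
  have : N ^+ 2 * (y ^+ 2 * k ^+ 2 / 32) <= N ^+ 2 * b by rewrite ler_wpM2l // sqr_ge0.
  lra.
have h3 : 0 <= N ^+ 2 * b by rewrite mulr_ge0 // sqr_ge0.
have h4 : 0 <= G * (N ^+ 2 * b) by rewrite mulr_ge0.
have h5 : 1 + y <= 2 * (1 + y ^+ 2) by have := sqr_ge0 (1 - y); have := sqr_ge0 y; rewrite sqrrB; nra.
apply: le_trans h5 _; rewrite -mulrA ler_wpM2l //.
have -> : (1 + G) * (1 + N ^+ 2 * b) = 1 + G + N ^+ 2 * b + G * (N ^+ 2 * b) by ring.
lra.
Qed.

(* The folding [acos \o cos] of a node back to [0, pi] only decreases distances. *)
Lemma cos_fold_le t u : 0 <= t <= pi ->
  cos (t - u) <= cos (t - acos (cos u)) /\ cos (t + u) <= cos (t - acos (cos u)).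
Proof.
move=> tI; set v := acos (cos u).
have uI : -1 <= cos u <= 1 by rewrite cos_geN1 cos_le1.
have vI : 0 <= v <= pi by rewrite acos_ge0 ?acos_lepi.
have ev : cos v = cos u by rewrite acosK // in_itv /=.
have sv := sin_ge0_pi vI; have st := sin_ge0_pi tI.
have e2 : sin v ^+ 2 = sin u ^+ 2 by rewrite !sin2cos2 ev.
have : `|sin u| <= sin v by rewrite -(@ler_pXn2r _ 2) ?nnegrE // real_normK ?num_real // e2.
rewrite ler_norml => /andP[h1 h2].
rewrite !cosB cosD ev; split; first by rewrite lerD2l ler_wpM2l.
by rewrite lerD2l -mulrN ler_wpM2l //; lra.
Qed.

(** Of the [P + 1] kernel factors, [P] cancel the growth at a cost of [3 N ^ 2] each, and the last
    sums to [N m] over the nodes. Division by [S >= N ^ (2 (P + 1))] removes all powers of [N]. *)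
Lemma gluing (r N P : nat) V E k p : (0 < N)%N -> 0 < k -> 0 <= E ->
  (forall t, 0 <= t <= pi -> 0 <= V t) ->
  (forall t, 0 <= t <= pi -> (size (p t) <= r)%N) ->
  (forall t u, 0 <= t <= pi -> 0 <= u <= pi ->
     V t * `|(p u).[cos t] - (p t).[cos t]| <= E * (1 + `|t - u| / k) ^+ P) ->
  exists2 q : {poly R}, (size q <= r + P.+1 * N.-1)%N & forall t, 0 <= t <= pi ->
     V t * `|q.[cos t] - (p t).[cos t]| <=
       3 ^+ P * P.+1%:R * (2 * (1 + 32 / (N%:R * k) ^+ 2)) ^+ P * E.
Proof.
move=> N0 k0 E0 V0 sp hp.
pose G := 2 * (1 + 32 / (N%:R * k) ^+ 2).
have N0' : 0 < N%:R :> R by rewrite ltr0n.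
have G0 : 0 <= G.
  apply: mulr_ge0 => //; apply: addr_ge0 => //; apply: divr_ge0; first exact: ler0n.
  exact: sqr_ge0.
(* Enough nodes for [node_sum_poly] to be exact on [U]. *)
pose m := (P.+1 * N)%N; have m0 : (0 < m)%N by rewrite muln_gt0.
pose F : {poly R} := fejer N.
pose U := F ^+ P.+1.
have sU : (size U <= P.+1 * N.-1 + 1)%N by apply: size_fejer_exp.
have sUm : (size U <= m)%N.
  apply: leq_trans sU _; rewrite /m -[in leqRHS](prednK N0) mulnS addnC.
  by rewrite leq_add2r.
pose node (i : 'I_m) : R := i%:R * (2 * pi / m%:R).
have [S hS] := node_sum_poly sUm.
have U0 x : 0 <= U.[cos x] by rewrite horner_exp exprn_ge0 // fejer_ge0.
(* The node at angle zero alone contributes the peak of the kernel. *)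
have S1 : N%:R ^+ (2 * P.+1) <= S.
  rewrite -(hS 0) (bigD1 (Ordinal m0)) //= mul0r addr0 horner_exp fejer_at0 exprM lerDl.
  by apply: sumr_ge0 => i _; exact: U0.
have S0 : 0 < S by apply: lt_le_trans S1; rewrite exprn_gt0.
have hSB t : \sum_(i < m) U.[cos (t - node i)] = S.
  by rewrite -(hS (- t)); apply: eq_bigr => i _; rewrite -cosN opprB addrC.
have /choice[v hv] : forall i : 'I_m, exists v : {poly R}, (size v <= size U)%N /\
    forall t, v.[cos t] = U.[cos (t - node i)] + U.[cos (t + node i)].
  by move=> i; have [v h1 h2] := sym_translate U (node i); exists v.
(* The nodes run round the whole circle while [p] is controlled only on [[0, pi]], so each node uses
   the approximant at its folded angle. *)
pose th (i : 'I_m) := acos (cos (node i)).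
have thI i : 0 <= th i <= pi.
  have uI : -1 <= cos (node i) <= 1 by rewrite cos_geN1 cos_le1.
  by rewrite /th acos_ge0 ?acos_lepi.
pose q : {poly R} := (2 * S)^-1 *: \sum_(i < m) p (th i) * v i.
exists q.
  apply: leq_trans (size_scale_leq _ _) _.
  apply: (leq_trans (size_sum _ _ _)); apply/bigmax_leqP => i _.
  apply: leq_trans (size_polyMleq _ _) _.
  have [h1 _] := hv i; have h2 := sp _ (thI i).
  apply: (@leq_trans (r + (P.+1 * N.-1 + 1)).-1); last by rewrite addn1 addnS.
  rewrite -[leqLHS]subn1 -[leqRHS]subn1; apply: leq_sub2r; apply: leq_add; [exact: h2|exact: leq_trans h1 sU].
move=> t tI; have Vt := V0 t tI.
have eq1 : q.[cos t] - (p t).[cos t] =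
    (2 * S)^-1 * \sum_(i < m) ((p (th i)).[cos t] - (p t).[cos t]) * (v i).[cos t].
  have e : (p t).[cos t] = (2 * S)^-1 * \sum_(i < m) (p t).[cos t] * (v i).[cos t].
    rewrite -mulr_sumr; have -> : \sum_(i < m) (v i).[cos t] = 2 * S.
      under eq_bigr => i _ do rewrite (hv i).2.
      by rewrite big_split /= hSB hS; ring.
    by rewrite mulrCA mulVf ?mulr1 // mulf_neq0 // lt0r_neq0.
  rewrite /q hornerZ [X in _ - X = _]e -mulrBr horner_sum -sumrB; congr (_ * _).
  by apply: eq_bigr => i _; rewrite hornerM mulrBl.
have term i : V t * `|((p (th i)).[cos t] - (p t).[cos t]) * (v i).[cos t]| <=
    E * G ^+ P * (3 * N%:R ^+ 2) ^+ P * (F.[cos (t - node i)] + F.[cos (t + node i)]).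
  have bnd s : cos s <= cos (t - th i) ->
      (1 + `|t - th i| / k) ^+ P * U.[cos s] <= G ^+ P * (3 * N%:R ^+ 2) ^+ P * F.[cos s].
    move=> hs.
    have g1 : 1 + `|t - th i| / k <= G * (1 + N%:R ^+ 2 * (1 - cos s)).
      apply: le_trans (distance_growth k0 N0' tI (thI i)) _.
      by rewrite ler_wpM2l // lerD2l ler_wpM2l ?sqr_ge0 // lerB.
    have D0 : 0 <= 1 + `|t - th i| / k by rewrite addr_ge0 // divr_ge0 // ltW.
    have F0 := fejer_ge0 N s.
    rewrite /U horner_exp exprSr mulrA ler_wpM2r // -!exprMn lerXn2r ?nnegrE //.
    - by rewrite mulr_ge0.
    - by rewrite mulr_ge0 // mulr_ge0 // sqr_ge0.
    apply: le_trans (ler_wpM2r F0 g1) _; rewrite -(mulrA G) ler_wpM2l //.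
    exact: fejer_growth.
  have [c1 c2] := cos_fold_le (node i) tI.
  rewrite normrM mulrA.
  have v0 : 0 <= (v i).[cos t] by rewrite (hv i).2 addr_ge0.
  rewrite (ger0_norm v0).
  apply: le_trans (ler_wpM2r v0 (hp t (th i) tI (thI i))) _.
  rewrite (hv i).2 mulrDr [leRHS]mulrDr -!(mulrA E) lerD // ler_wpM2l //.
  - exact: bnd.
  - exact: bnd.
rewrite eq1 normrM [`|_^-1|]ger0_norm ?invr_ge0 ?mulr_ge0 ?(ltW S0) // mulrCA.
have sumb : V t * `|\sum_(i < m) ((p (th i)).[cos t] - (p t).[cos t]) * (v i).[cos t]| <=
    E * G ^+ P * (3 * N%:R ^+ 2) ^+ P * (2 * (N * m)%:R).
  apply: (@le_trans _ _ (\sum_(i < m) V t * `|((p (th i)).[cos t] - (p t).[cos t]) * (v i).[cos t]|)).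
    by rewrite -mulr_sumr ler_wpM2l // ler_norm_sum.
  apply: le_trans (ler_sum _ (fun i _ => term i)) _.
  rewrite -mulr_sumr big_split /=.
  have Nm : (N <= m)%N by rewrite leq_pmull.
  have e1 : \sum_(i < m) F.[cos (t - node i)] = (N * m)%:R.
    by rewrite -(fejer_node_sum (- t) Nm); apply: eq_bigr => i _; rewrite -cosN opprB addrC.
  have e2 : \sum_(i < m) F.[cos (t + node i)] = (N * m)%:R by exact: fejer_node_sum.
  by rewrite e1 e2 (_ : 2 * (N * m)%:R = (N * m)%:R + (N * m)%:R) //; ring.
rewrite mulrC ler_pdivrMr ?mulr_gt0 //; apply: le_trans sumb _.
have -> : E * G ^+ P * (3 * N%:R ^+ 2) ^+ P * (2 * (N * m)%:R) =
   3 ^+ P * P.+1%:R * G ^+ P * E * (2 * N%:R ^+ (2 * P.+1)).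
  have -> : (3 * N%:R ^+ 2) ^+ P = 3 ^+ P * N%:R ^+ (2 * P) :> R by rewrite exprMn -exprM.
  by rewrite /m !natrM mulnS exprD; ring.
rewrite -/G; apply: ler_wpM2l; last exact: ler_wpM2l.
by apply: mulr_ge0 => //; apply: mulr_ge0; [apply: mulr_ge0 => //; exact: exprn_ge0|exact: exprn_ge0].
Qed.

End Gluing.

(** * Polynomials of large degree *)

(** The kernel index is taken proportional to [n]: small enough for the glued polynomial to fit into
    [n] coefficients, large enough for [N k] to stay bounded below. *)
Lemma degree_budget (n r Q : nat) : (0 < Q)%N -> (2 * r + Q <= n)%N -> let N := ((n - r) %/ Q)%N in
  [/\ (0 < N)%N, (n <= 4 * Q * N)%N & (r + Q * N.-1 <= n)%N].
Proof.
move=> Q0 h; have := divn_eq (n - r) Q; have := ltn_pmod (n - r) Q0.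
set N := ((n - r) %/ Q)%N; set m := ((n - r) %% Q)%N => mQ e /=.
have N0 : (0 < N)%N by rewrite divn_gt0 //; lia.
have QN : (Q <= N * Q)%N by rewrite leq_pmull.
split => //; first lia.
have : (Q * N.-1 <= N * Q)%N by rewrite mulnC leq_mul2r leq_pred orbT.
lia.
Qed.

Section LargeDegree.
Context {R : realType} (M : nat) (Z : M.-tuple R) (hZ : in_ZM Z) (w : R -> R) (L : R).
Local Notation mu := (@lebesgue_measure R).
Implicit Types (t u Om : R) (f : R -> R).
Context (W : interval_weight w L) (hw : Wstar Z w) (w_pos : 0 < wint w (-1) 1).

Definition good_approximant (r nu0 n : nat) f (K : R) (P : {poly R}) : Prop :=
  [/\ (size P <= n)%N,
   {ae mu, forall x, I11 R x -> `|w x * (f x - P.[x])| <= K} &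
   forall nu x, (r <= nu <= nu0)%N -> I11 R x ->
     `|w x * phi x ^+ nu * P^`(nu).[x]| <= K * n%:R ^+ nu].

Lemma large_degree (r nu0 : nat) (theta B : R) : (0 < r)%N -> 0 < theta -> 0 < B ->
  exists n0 : nat, exists2 C : R, 0 < C & forall f n Om, Linf_w w f -> (n0 <= n)%N -> 0 < Om ->
    (complete_modulus Z r f 1 B (theta / n%:R) w < Om%:E)%E ->
    exists P, good_approximant r nu0 n f (C * Om) P.
Proof.
move=> r0 th0 B0.
have [C1 C10 hloc] := local_approximation hZ W hw w_pos r0 B0.
have [P [C2 C20 hchain]] := chain_growth hZ W hw w_pos r.
have [s [C3 C30 havg]] := avg_growth W.
have [Cb Cb0 hbern] := @bernstein_growth R (s + P) nu0.
have [L1 _ _ _ _] := W; have L0 : 0 <= L by exact: le_trans ler01 L1.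
(* The arcs have radius [k0 / n]; the last two bounds are the requirements of [local_approximation]
   on [258 k] at [h = theta / n]. *)
have [k0 [k00 k01 k0t k0B]] : exists k0 : R,
    [/\ 0 < k0, k0 <= 1, k0 <= theta / 258 & k0 <= B * theta / 258].
  have h1 : 0 < theta / 258 by apply: divr_gt0; [exact: th0|rewrite ltr0n].
  have h2 : 0 < B * theta / 258 by apply: divr_gt0; [exact: mulr_gt0|rewrite ltr0n].
  exists (Num.min 1 (Num.min (theta / 258) (B * theta / 258))).
  by rewrite !lt_min ltr01 h1 h2 !ge_min !lexx !orbT.
(* From [n <= 4 (P + 1) N] one gets [N k >= k0 / (4 (P + 1))], so [H] bounds [32 / (N k) ^ 2]
   uniformly in [n]. *)
pose H := 512 * P.+1%:R ^+ 2 / k0 ^+ 2.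
have H0 : 0 <= H.
  by rewrite /H; apply: divr_ge0; [apply: mulr_ge0; [exact: ler0n|]|]; exact: sqr_ge0.
pose Cg := 3 ^+ P * P.+1%:R * (2 * (1 + H)) ^+ P.
have Cg0 : 0 <= Cg.
  rewrite /Cg; apply: mulr_ge0; first by apply: mulr_ge0 => //; exact: exprn_ge0.
  by apply: exprn_ge0; apply: mulr_ge0 => //; lra.
pose G := 2 * (1 + 32 / k0 ^+ 2).
have G0 : 0 <= G.
  by apply: mulr_ge0 => //; apply: addr_ge0 => //; apply: divr_ge0; [exact: ler0n|exact: sqr_ge0].
pose Ca := C1 + L * (2 ^+ P + Cg) * (C2 * C1).
pose Cd := L * (Cb * (C3 * (Cg + 1) * G ^+ (s + P))) * (C2 * C1).
have C21 : 0 < C2 * C1 by rewrite mulr_gt0.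
have Ca0 : 0 < Ca.
  rewrite /Ca; apply: ltr_pwDl => //; apply: mulr_ge0; last exact: ltW.
  by apply: mulr_ge0; [exact: L0|apply: addr_ge0 => //; exact: exprn_ge0].
have X0 : 0 <= C3 * (Cg + 1) * G ^+ (s + P).
  by apply: mulr_ge0; [apply: mulr_ge0; [exact: ltW|exact: addr_ge0]|exact: exprn_ge0].
have Cd0 : 0 <= Cd.
  rewrite /Cd; apply: mulr_ge0; last exact: ltW.
  by apply: mulr_ge0; [exact: L0|exact: mulr_ge0].
exists (2 * r + P.+1)%N; exists (Ca + Cd); first by apply: ltr_pwDl.
move=> f n Om hf hn Om0 hmod.
have n0 : (0 < n)%N by apply: leq_trans hn; rewrite addnS.
have nR : 0 < n%:R :> R by rewrite ltr0n.
pose k := k0 / n%:R.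
have kk0 : 0 < k by rewrite divr_gt0.
have kk1 : k <= 1 by rewrite ler_pdivrMr // mul1r; apply: le_trans k01 _; rewrite ler1n.
have kt : 258 * k <= theta / n%:R.
  by rewrite /k mulrA ler_wpM2r ?invr_ge0 ?(ltW nR) //; move: k0t; clear -hZ W hw w_pos; lra.
have kB : 258 * k <= B * (theta / n%:R).
  by rewrite /k !mulrA ler_wpM2r ?invr_ge0 ?(ltW nR) //; move: k0B; clear -hZ W hw w_pos; lra.
have [p hp] := hloc f k (theta / n%:R) Om hf kk0 kk1 Om0 (divr_gt0 th0 nR) kt kB hmod.
set E1 := C1 * Om in hp; have E10 : 0 < E1 by rewrite mulr_gt0.
pose V := arc_avg w k.
have V0 t : 0 <= t <= pi -> 0 < V t by move=> tI; exact: (avg_gt0 W).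
pose N := ((n - r) %/ P.+1)%N.
have [N0 nN0 budget] : [/\ (0 < N)%N, (n <= 4 * P.+1 * N)%N & (r + P.+1 * N.-1 <= n)%N].
  exact: degree_budget.
have nN : n%:R <= 4 * P.+1%:R * N%:R :> R by rewrite -!natrM ler_nat.
have N0' : 0 < N%:R :> R by rewrite ltr0n.
have HN : 32 / (N%:R * k) ^+ 2 <= H.
  have Nk : 0 < (N%:R * k) ^+ 2 by rewrite exprn_gt0 // mulr_gt0.
  have q0 : 0 < 4 * P.+1%:R :> R by apply: mulr_gt0; rewrite ltr0n.
  have b1 : k0 <= 4 * P.+1%:R * (N%:R * k).
    rewrite /k mulrA mulrA ler_pdivlMr // mulrC; apply: ler_wpM2r => //; exact: ltW.
  have b2 : k0 ^+ 2 <= (4 * P.+1%:R * (N%:R * k)) ^+ 2.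
    rewrite lerXn2r // nnegrE; first exact: ltW.
    by apply: le_trans b1; exact: ltW.
  rewrite ler_pdivrMr // /H mulrAC ler_pdivlMr ?exprn_gt0 //.
  by rewrite exprMn exprMn in b2; move: b2; clear -hZ W hw w_pos; lra.
have sp t : 0 <= t <= pi -> (size (p t) <= r)%N by move=> /hp[].
have [q sq hq] := gluing N0 kk0 (ltW (mulr_gt0 C20 E10)) (fun t tI => ltW (V0 t tI)) sp
   (fun t u tI uI => hchain f k E1 p t u kk0 kk1 (ltW E10) hp tI uI).
set E := C2 * E1 in hq; have E0 : 0 < E by rewrite mulr_gt0.
have eE : E = C2 * C1 * Om by rewrite /E /E1 mulrA.
have chain t u : 0 <= t <= pi -> 0 <= u <= pi ->
    V t * `|(p u).[cos t] - (p t).[cos t]| <= E * (1 + `|t - u| / k) ^+ P.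
  by move=> tI uI; exact: (hchain f k E1 p t u kk0 kk1 (ltW E10) hp tI uI).
have {}hq t : 0 <= t <= pi -> V t * `|q.[cos t] - (p t).[cos t]| <= Cg * E.
  move=> tI; apply: le_trans (hq t tI) _; apply: ler_wpM2r; first exact: ltW.
  rewrite /Cg; apply: ler_wpM2l; first by apply: mulr_ge0 => //; exact: exprn_ge0.
  have : 0 <= 32 / (N%:R * k) ^+ 2 by apply: divr_ge0; [exact: ler0n|exact: sqr_ge0].
  move=> h; apply: lerXn2r; rewrite ?nnegrE; try (by apply: mulr_ge0 => //; exact: addr_ge0).
  by apply: ler_wpM2l => //; rewrite lerD2l.
have wI u : 0 <= w (cos u).
  by case: (hw) => -[w0 _ _] _; apply: w0; rewrite /I11 /= in_itv /= cos_geN1 cos_le1.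
have wV t : 0 <= t <= pi -> w (cos t) <= L * V t.
  by move=> tI; apply: (weight_le_avg W) => //; rewrite subrr normr0 ltW.
have I11P (x : R) : I11 R x -> exists2 t, 0 <= t <= pi & x = cos t.
  rewrite /I11 /= in_itv /= => xI; exists (acos x); first by rewrite acos_ge0 ?acos_lepi.
  by rewrite acosK // in_itv.
have Om00 : 0 <= Om by exact: ltW.
exists q; split.
- exact: leq_trans sq budget.
(* Every centre has its own null set, so only the countably many centres [i k] are used; each angle
   lies within [k] of one of them. *)
- have cover : {ae mu, forall x, forall i : nat, i%:R * k <= pi ->
      arc_lo k (i%:R * k) <= x <= arc_hi k (i%:R * k) -> `|w x * (f x - (p (i%:R * k)).[x])| <= E1}.
    apply: ae_forall_nat => i; have [ip|ip] := boolP (i%:R * k <= pi); last first.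
      by apply: ae_all => x.
    have iI : 0 <= i%:R * k <= pi by rewrite ip mulr_ge0 // ltW.
    by have [_ h] := hp _ iI; apply: (ae_mono h) => x hx _; exact: hx.
  apply: (ae_mono cover) => x hx /I11P[t tI xt].
  have tk0 : 0 <= t / k by case/andP: tI => h _; apply: divr_ge0; [exact: h|exact: ltW].
  have := truncn_itv tk0; set i := Num.truncn _ => /andP[i1 i2].
  rewrite ler_pdivlMr // in i1; rewrite -natr1 ltr_pdivrMr // in i2.
  pose u := i%:R * k.
  have uI : 0 <= u <= pi by rewrite /u mulr_ge0 ?(ltW kk0) //=; move: i1 tI; clear -hZ W hw w_pos; lra.
  have tu : `|t - u| <= k by rewrite ler_norml /u; move: i1 i2; clear -hZ W hw w_pos; lra.
  have b1 : `|w x * (f x - (p u).[x])| <= E1.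
    apply: hx; first by case/andP: uI.
    by rewrite xt; apply: mem_arc => //; lra.
  rewrite xt in b1 *.
  have -> : w (cos t) * (f (cos t) - q.[cos t]) = w (cos t) * (f (cos t) - (p u).[cos t]) +
     w (cos t) * (((p u).[cos t] - (p t).[cos t]) - (q.[cos t] - (p t).[cos t])) by ring.
  apply: le_trans (ler_normD _ _) _; rewrite [X in _ + X]normrM (ger0_norm (wI t)).
  have b2 := chain t u tI uI; have b3 := hq t tI.
  have b4 : (1 + `|t - u| / k) ^+ P <= 2 ^+ P.
    have h0 : 0 <= `|t - u| / k by rewrite divr_ge0 // ltW.
    have h1 : `|t - u| / k <= 1 by rewrite ler_pdivrMr // mul1r.
    apply: lerXn2r; rewrite ?nnegrE; [by apply: addr_ge0|exact: ler0n|by rewrite -[leRHS]/(1 + 1) lerD2l].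
  set a1 := (p u).[cos t] - (p t).[cos t] in b2 *; set a2 := q.[cos t] - (p t).[cos t] in b3 *.
  have b5 : w (cos t) * `|a1 - a2| <= L * V t * (`|a1| + `|a2|).
    by apply: ler_pM => //; [exact: wV|exact: ler_normB].
  have b6 : L * V t * (`|a1| + `|a2|) <= L * ((2 ^+ P + Cg) * E).
    rewrite -mulrA; apply: ler_wpM2l => //; rewrite mulrDr mulrDl; apply: lerD => //.
    by apply: le_trans b2 _; rewrite mulrC ler_wpM2r // ltW.
  have : 0 <= Cd * Om by rewrite mulr_ge0.
  have -> : (Ca + Cd) * Om = E1 + L * ((2 ^+ P + Cg) * E) + Cd * Om by rewrite eE /Ca /E1; ring.
  by move: b1 b5 b6; clear -hZ W hw w_pos; lra.
- move=> nu x /andP[rnu nunu] /I11P[t0 t0I ->].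
  (* Subtracting [p t0] changes no derivative of order at least [r], and the difference is small
     near [t0] with polynomial growth away from it. *)
  pose Q := q - p t0.
  have V00 := V0 t0 t0I.
  have sQ : (size Q <= n.+1)%N.
    rewrite (leq_trans (size_polyD _ _)) // size_polyN geq_max.
    apply/andP; split; last by apply: leq_trans (sp _ t0I) _; apply: leqW; apply: leq_trans budget; exact: leq_addr.
    by apply: leqW; exact: leq_trans sq budget.
  pose Eb := C3 * (Cg + 1) * G ^+ (s + P) * E / V t0.
  have Eb0 : 0 <= Eb.
    by apply: divr_ge0; [apply: mulr_ge0 => //; exact: ltW|exact: ltW].
  have grow t : 0 <= t <= pi -> `|Q.[cos t]| <= Eb * (1 + n%:R ^+ 2 * (1 - cos (t - t0))) ^+ (s + P).
    move=> tI; set g := 1 + _.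
    have b1 := havg k t t0 kk0 kk1 tI t0I; rewrite -/(V t) -/(V t0) distrC in b1.
    have b2 := hq t tI; have b3 := chain t t0 tI t0I.
    have dg := distance_growth kk0 nR tI t0I.
    have nk : n%:R * k = k0 by rewrite /k mulrC divfK // lt0r_neq0.
    rewrite nk -/G -/g in dg.
    set D := 1 + `|t - t0| / k in b1 b3 dg.
    have D1 : 1 <= D by rewrite lerDl divr_ge0 // ltW.
    have D0 : 0 <= D by exact: le_trans ler01 D1.
    have DP : 1 <= D ^+ P by exact: exprn_ege1.
    rewrite /Eb mulrAC ler_pdivlMr // mulrC /Q hornerD hornerN.
    have -> : q.[cos t] - (p t0).[cos t] = (q.[cos t] - (p t).[cos t]) - ((p t0).[cos t] - (p t).[cos t]) by ring.
    set a2 := q.[cos t] - _ in b2 *; set a1 := (p t0).[cos t] - _ in b3 *.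
    apply: (@le_trans _ _ (C3 * D ^+ s * (V t * (`|a2| + `|a1|)))).
      by rewrite mulrA; apply: ler_pM => //; [exact: ltW|exact: ler_normB].
    apply: (@le_trans _ _ (C3 * D ^+ s * ((Cg + 1) * E * D ^+ P))).
      apply: ler_wpM2l; first by apply: mulr_ge0; [exact: ltW|exact: exprn_ge0].
      rewrite mulrDr -mulrA mulrDl mul1r; apply: lerD => //.
      by apply: le_trans b2 _; rewrite ler_wpM2l // ler_peMr // ltW.
    have -> : C3 * D ^+ s * ((Cg + 1) * E * D ^+ P) = C3 * (Cg + 1) * E * D ^+ (s + P).
      by rewrite exprD; ring.
    have -> : C3 * (Cg + 1) * G ^+ (s + P) * E * g ^+ (s + P) = C3 * (Cg + 1) * E * (G * g) ^+ (s + P).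
      by rewrite (exprMn (s + P) G g); ring.
    apply: ler_wpM2l; first by apply: mulr_ge0; [apply: mulr_ge0; [exact: ltW|exact: addr_ge0]|exact: ltW].
    by apply: lerXn2r => //; rewrite nnegrE //; exact: le_trans D0 dg.
  have hb := hbern n Q Eb t0 nu n0 sQ Eb0 t0I grow nunu.
  have -> : q^`(nu) = Q^`(nu).
    by rewrite /Q derivnB (derivn_poly0 (leq_trans (sp _ t0I) rnu)) subr0.
  rewrite -mulrA normrM (ger0_norm (wI t0)).
  apply: (@le_trans _ _ (L * V t0 * (Cb * n%:R ^+ nu * Eb))).
    by apply: ler_pM => //; exact: wV.
  have -> : L * V t0 * (Cb * n%:R ^+ nu * Eb) = Cd * Om * n%:R ^+ nu.
    by rewrite /Eb eE /Cd; field; rewrite lt0r_neq0.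
  have : 0 <= n%:R ^+ nu :> R by exact: exprn_ge0.
  by move=> h; apply: ler_wpM2r => //; apply: ler_wpM2r => //; rewrite lerDr ltW.
Qed.

End LargeDegree.

(** * Reduction to large degree *)

Section DerivativeControl.
Context {R : realType}.
Implicit Types (p q : {poly R}).

(** The approximant is the Taylor polynomial at 0, built from its top coefficient downwards; each
    application of the mean value theorem multiplies the bound by [|x| <= 1]. *)
Lemma derivative_control r p (K : R) :
  (forall x, -1 <= x <= 1 -> `|p^`(r).[x]| <= K) ->
  exists2 q : {poly R}, (size q <= r)%N & forall x, -1 <= x <= 1 -> `|p.[x] - q.[x]| <= K.
Proof.
elim: r p => [|r IH] p hK.
  by exists 0; rewrite ?size_poly0 // => x xI; rewrite horner0 subr0; exact: hK.
have K0 : 0 <= K by apply: le_trans (hK 0 _) => //; lra.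
pose c := p^`(r).[0].
have f0 : (r`!)%:R != 0 :> R by rewrite pnatr_eq0 -lt0n fact_gt0.
pose u : {poly R} := (c / (r`!)%:R) *: 'X^r.
have du : u^`(r) = c%:P.
  rewrite /u derivnZ derivnXn subnn ffactnn expr0 -[X in _ *: X]mulr_natl mulr1 -polyC_natr.
  by rewrite -mul_polyC -polyCM divfK.
have [x xI|q sq hq] := IH (p - u).
  rewrite derivnB du hornerD hornerN hornerC.
  have mvt (a b : R) : a <= b -> -1 <= a -> b <= 1 -> `|p^`(r).[b] - p^`(r).[a]| <= K * (b - a).
    move=> ab a1 b1.
    have [z zI ->] := @MVT_segment R (horner p^`(r)) (horner p^`(r)^`()) a b ab
      (fun z _ => is_derive_poly _ z) ltac:(by apply: continuous_subspaceT => z; exact: continuous_horner).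
    rewrite normrM (ger0_norm (_ : 0 <= b - a)) ?subr_ge0 // ler_wpM2r ?subr_ge0 //.
    by rewrite -derivnS hK //; move: zI; rewrite in_itv /= => /andP[h1 h2]; lra.
  have [x0|x0] := leP 0 x.
    have h := mvt 0 x x0 ltac:(lra) ltac:(lra).
    by apply: le_trans h _; rewrite subr0 ler_piMr //; lra.
  have h := mvt x 0 (ltW x0) ltac:(lra) ltac:(lra).
  by rewrite distrC; apply: le_trans h _; rewrite sub0r ler_piMr //; lra.
exists (q + u).
  rewrite (leq_trans (size_polyD _ _)) // geq_max (leq_trans sq) //.
  by rewrite (leq_trans (size_scale_leq _ _)) // size_polyXn.
by move=> x xI; have := hq x xI; rewrite !hornerD hornerN opprD addrA addrAC.
Qed.

Lemma le0_of_le_inv (x K : R) : (forall n : nat, x <= K / n.+1%:R) -> x <= 0.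
Proof.
move=> h; rewrite leNgt; apply/negP => x0.
have K0 : 0 < K by have := h 0%N; rewrite divr1; lra.
have := h (Num.truncn (K / x)).
rewrite ler_pdivlMr ?ltr0n // mulrC -ler_pdivlMr // leNgt => /negP; apply.
exact: truncnS_gt.
Qed.

End DerivativeControl.

(** * Passage to degrees from [r] on and to a vanishing modulus *)

Section SmallDegree.
Context {R : realType} (M : nat) (Z : M.-tuple R) (hZ : in_ZM Z) (w : R -> R) (L : R).
Local Notation mu := (@lebesgue_measure R).
Implicit Types (x t u Om : R) (f : R -> R).
Context (W : interval_weight w L) (hw : Wstar Z w) (w_pos : 0 < wint w (-1) 1).

(** A good subarc about [pi / 2]. On its image weighted estimates become ordinary bounds on
    polynomials. *)
Lemma positive_interval : exists lo hi m : R,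
  [/\ -1 <= lo, lo < hi, hi <= 1, 0 < m &
      forall x, lo <= x <= hi -> m <= w x /\ 1 / 2 <= phi x].
Proof.
have [d d0 [c c0 hc]] := good_arc hZ W hw.
have p2 := pi_ge2 R; have tI : 0 <= (pi : R) / 2 <= pi by lra.
have [a [a0 a1 a2 a3 ha]] := hc 1 (pi / 2) ltr01 (lexx _) tI.
rewrite mulr1 in a1 a3 ha.
exists (cos (a + d)), (cos a), (c * arc_avg w 1 (pi / 2)).
split; rewrite ?cos_geN1 ?cos_le1 //.
- by rewrite ltr_cos ?in_itv /=; lra.
- by rewrite mulr_gt0 // (avg_gt0 W).
move=> x /arcP[] //; first lra.
move=> s sI ->; split; first exact: ha.
have ds : `|s - pi / 2| <= 1 / 2 by rewrite ler_norml; lra.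
have := cos_dist_le s tI; rewrite cos_pihalf subr0 => h.
have h2 : `|cos s| <= 3 / 4.
  apply: le_trans h _; apply: le_trans (rho_le _ (normr_ge0 _) ds) _.
  have := phi_le1 (0 : R); rewrite /rho => h0.
  have : 1 / 2 * phi (0 : R) <= 1 / 2 * 1 by rewrite ler_wpM2l.
  have -> : (1 / 2 : R) ^+ 2 = 1 / 4 by field.
  lra.
rewrite -(@ler_pXn2r _ 2) ?nnegrE ?phi_ge0 // phi_sqr ?cos_geN1 ?cos_le1 //.
have : `|cos s| ^+ 2 <= (3 / 4) ^+ 2 by rewrite lerXn2r // nnegrE.
rewrite real_normK ?num_real // => h3.
have -> : (1 / 2 : R) ^+ 2 = 1 / 4 by field.
by have : (3 / 4 : R) ^+ 2 = 9 / 16 by [field]; lra.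
Qed.

Lemma weight_bounded x : -1 <= x <= 1 -> 0 <= w x <= L / 2 * wint w (-1) 1.
Proof.
move=> xI; have [_ _ _ wA _] := W.
have I11x : I11 R x by rewrite /I11 /= in_itv.
have [w0 _ _] := hw.1; rewrite w0 //=.
have -> : L / 2 = L / (1 - -1) by congr (_ / _); ring.
by apply: wA => //; lra.
Qed.

(** The bound on [w phi ^ r P^(r)] controls [P^(r)] on the interval of [positive_interval], hence on
    [[-1, 1]] by [poly_growth]. The replacement has degree less than [r], so its derivatives of
    order [r] and higher vanish. *)
Lemma degree_reduction (r n1 : nat) : (0 < r)%N -> (0 < n1)%N -> exists2 C : R, 0 < C &
  forall f Om P nu0 n, 0 < Om -> (r <= nu0)%N -> (r <= n)%N ->
    good_approximant w r nu0 n1 f Om P ->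
    exists q, good_approximant w r nu0 n f (C * Om) q.
Proof.
move=> r0 n10; have [lo [hi [m [lo1 lohi hi1 m0 hm]]]] := positive_interval.
have [L1 w0 _ _ _] := W.
pose Wm := L / 2 * wint w (-1) 1.
have Wm0 : 0 <= Wm by rewrite mulr_ge0 ?w0 //; lra.
pose D : R := n1%:R * (n1%:R * (2 + (hi - lo)) / (hi - lo)) ^+ n1.-1.
have D0 : 0 <= D.
  rewrite /D; apply: mulr_ge0 => //; apply: exprn_ge0; apply: divr_ge0; last lra.
  by apply: mulr_ge0 => //; lra.
pose m' : R := m * (1 / 2) ^+ r.
have m'0 : 0 < m' by rewrite mulr_gt0 // exprn_gt0.
pose X := Wm * (D * (n1%:R ^+ r / m')).
have X0 : 0 <= X.
  by do 2 (apply: mulr_ge0 => //); apply: divr_ge0; [exact: exprn_ge0|exact: ltW].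
exists (1 + X); first lra.
move=> f Om P nu0 n Om0 rnu0 rn [sP fP dP].
have b1 x : lo <= x <= lo + (hi - lo) -> `|P^`(r).[x]| <= n1%:R ^+ r / m' * Om.
  move=> xI; have xI' : lo <= x <= hi by lra.
  have [h1 h2] := hm x xI'.
  have := dP r x; rewrite leqnn rnu0 /I11 /= in_itv /= => /(_ isT) h.
  rewrite mulrAC ler_pdivlMr //.
  apply: (@le_trans _ _ `|w x * phi x ^+ r * P^`(r).[x]|); last by rewrite (mulrC _ Om); apply: h; lra.
  rewrite normrM mulrC ler_wpM2r //; apply: le_trans (ler_norm _).
  rewrite /m'; apply: ler_pM; [exact: ltW|by apply: exprn_ge0; lra|exact: h1|].
  by rewrite lerXn2r // nnegrE ?phi_ge0.
have b2 x : -1 <= x <= 1 -> `|P^`(r).[x]| <= D * (n1%:R ^+ r / m' * Om).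
  move=> xI; have l0 : 0 < hi - lo by lra.
  have sd : (size P^`(r) <= n1)%N by apply: leq_trans (size_derivn _ _) sP.
  apply: le_trans (poly_growth x l0 sd b1) _.
  apply: ler_wpM2r.
    by apply: mulr_ge0; [apply: divr_ge0; [exact: exprn_ge0|exact: ltW]|exact: ltW].
  rewrite /D; apply: ler_wpM2l => //; apply: lerXn2r.
  - rewrite nnegrE; apply: divr_ge0; last exact: ltW.
    by apply: mulr_ge0 => //; apply: addr_ge0 => //; exact: ltW.
  - rewrite nnegrE; apply: divr_ge0; last exact: ltW.
    by apply: mulr_ge0 => //; lra.
  apply: ler_wpM2r; first by rewrite invr_ge0 ltW.
  by apply: ler_wpM2l => //; apply: lerD => //; rewrite ler_norml; lra.
have [q sq hq] := derivative_control b2.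
exists q; split.
- exact: leq_trans sq rn.
- apply: (ae_mono fP) => x hx xI.
  have xI' : -1 <= x <= 1 by move: xI; rewrite /I11 /= in_itv.
  have /andP[wx0 wx1] := weight_bounded xI'.
  have -> : w x * (f x - q.[x]) = w x * (f x - P.[x]) + w x * (P.[x] - q.[x]) by ring.
  apply: le_trans (ler_normD _ _) _; rewrite mulrDl mul1r; apply: lerD; first exact: hx.
  rewrite normrM (ger0_norm wx0) /X.
  have -> : Wm * (D * (n1%:R ^+ r / m')) * Om = Wm * (D * (n1%:R ^+ r / m' * Om)) by rewrite -!(mulrA Wm) -!(mulrA D).
  by apply: ler_pM; [exact: wx0|exact: normr_ge0|exact: wx1|exact: hq].
- move=> nu x /andP[rnu _] _; rewrite (derivn_poly0 (leq_trans sq rnu)) horner0 mulr0 normr0.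
  apply: mulr_ge0; last exact: exprn_ge0.
  by apply: mulr_ge0; [lra|exact: ltW].
Qed.

(** The points [y i] avoid the exceptional sets of all [P k] and lie where [w >= m], so [P k]
    converges to [f] there. By Lagrange's formula [P k] and its derivatives converge pointwise to
    those of the interpolant [Q], which inherits the estimates. *)
Lemma limit_approximant (r nu0 n : nat) f (C : R) : (0 < n)%N -> 0 <= C ->
  (forall Om, 0 < Om -> exists P, good_approximant w r nu0 n f (C * Om) P) ->
  exists P, good_approximant w r nu0 n f 0 P.
Proof.
move=> n0 C0 happ; have [lo [hi [m [lo1 lohi hi1 m0 hm]]]] := positive_interval.
pose e (k : nat) : R := k.+1%:R^-1.
have /choice[P hP] : forall k : nat, exists P, good_approximant w r nu0 n f (C * e k) P.
  by move=> k; apply: happ; rewrite invr_gt0 ltr0n.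
have full : {ae mu, forall x, forall k, I11 R x -> `|w x * (f x - (P k).[x])| <= C * e k}.
  by apply: ae_forall_nat => k; have [_ h _] := hP k.
have nR : 0 < n%:R :> R by rewrite ltr0n.
pose l := (hi - lo) / n%:R; have l0 : 0 < l by rewrite divr_gt0 // subr_gt0.
have /choice[y hy] : forall i : nat, exists y, lo + i%:R * l < y < lo + i%:R * l + l /\
    forall k, I11 R y -> `|w y * (f y - (P k).[y])| <= C * e k.
  move=> i; have [|y yI h] := @ae_exists_itv R _ (lo + i%:R * l) (lo + i%:R * l + l) _ full.
    by rewrite ltrDl.
  by exists y.
have yI (i : 'I_n) : lo <= y i <= hi.
  have [/andP[h1 h2] _] := hy i.
  have h3 : 0 <= i%:R * l by rewrite mulr_ge0 // ltW.
  have h4 : (i%:R + 1) * l <= n%:R * l by rewrite ler_wpM2r ?(ltW l0) // natr1 ler_nat.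
  have h5 : n%:R * l = hi - lo by rewrite /l mulrC divfK // lt0r_neq0.
  by rewrite mulrDl mul1r in h4; lra.
have ydist (i j : 'I_n) : i != j -> y i != y j.
  wlog ij : i j / (i < j)%N => [hwl|_].
    move=> ne; have [ij|ij] := ltnP i j; first exact: hwl.
    by rewrite eq_sym; apply: hwl; rewrite 1?eq_sym // ltn_neqAle ij andbT eq_sym.
  have [/andP[h1 h2] _] := hy i; have [/andP[h3 h4] _] := hy j.
  have : (i%:R + 1) * l <= j%:R * l by rewrite ler_wpM2r ?(ltW l0) // natr1 ler_nat.
  by rewrite mulrDl mul1r => h; rewrite lt_eqF //; lra.
have [Q sQ hQ] := interpolation (f \o y) ydist.
pose K x (nu : nat) := \sum_(i < n) C / m * `|(lagp y i)^`(nu).[x]|.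
have close x nu k : `|Q^`(nu).[x] - (P k)^`(nu).[x]| <= K x nu * e k.
  have [sP _ _] := hP k.
  have sD : (size (Q - P k)%R <= n)%N by rewrite (leq_trans (size_polyD _ _)) // size_polyN geq_max sQ.
  have -> : Q^`(nu).[x] - (P k)^`(nu).[x] = (Q - P k)^`(nu).[x] by rewrite derivnB hornerD hornerN.
  rewrite {1}(lagrange_eq ydist sD) linear_sum /= horner_sum /K mulr_suml.
  apply: le_trans (ler_norm_sum _ _ _) _; apply: ler_sum => i _.
  rewrite derivnZ hornerZ normrM mulrAC ler_wpM2r //.
  rewrite hornerD hornerN hQ /= mulrAC ler_pdivlMr //.
  have [h1 _] := hm _ (yI i); have [_ h2] := hy i.
  have := h2 k _; rewrite normrM mulrC => h3.
  apply: le_trans (h3 _); last by rewrite /I11 /= in_itv /=; have := yI i; lra.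
  by apply: ler_wpM2l => //; apply: le_trans h1 (ler_norm _).
have tozero (a K' : R) : (forall k, `|a| <= K' * e k) -> `|a| <= 0.
  by move=> h; apply: (@le0_of_le_inv _ _ K') => k; exact: h.
exists Q; split => //.
- apply: (ae_mono full) => x hx xI; apply: (tozero _ (C + `|w x| * K x 0%N)) => k.
  have -> : w x * (f x - Q.[x]) = w x * (f x - (P k).[x]) - w x * (Q.[x] - (P k).[x]) by ring.
  apply: le_trans (ler_normB _ _) _; rewrite mulrDl; apply: lerD; first exact: hx.
  by rewrite normrM -mulrA ler_wpM2l //; exact: (close x 0%N k).
- move=> nu x rnu xI; rewrite mul0r.
  apply: (tozero _ (C * n%:R ^+ nu + `|w x * phi x ^+ nu| * K x nu)) => k.
  have -> : w x * phi x ^+ nu * Q^`(nu).[x] = w x * phi x ^+ nu * (P k)^`(nu).[x] +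
     w x * phi x ^+ nu * (Q^`(nu).[x] - (P k)^`(nu).[x]) by ring.
  apply: le_trans (ler_normD _ _) _; rewrite mulrDl; apply: lerD.
    by have [_ _ h] := hP k; rewrite [leRHS]mulrAC; exact: h.
  by rewrite normrM -mulrA ler_wpM2l.
Qed.

(** A degree below the threshold [n0] is reached from [n1 = n0 + r]; since [n <= n1], the modulus at
    [theta / n1] does not exceed the one at [theta / n]. *)
Lemma all_degrees (r nu0 : nat) (theta B : R) : (0 < r)%N -> (r <= nu0)%N -> 0 < theta -> 0 < B ->
  exists2 C : R, 0 < C & forall f n Om, Linf_w w f -> (r <= n)%N -> 0 < Om ->
    (complete_modulus Z r f 1 B (theta / n%:R) w < Om%:E)%E ->
    exists P, good_approximant w r nu0 n f (C * Om) P.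
Proof.
move=> r0 rnu th0 B0.
have [n0 [C C0 hC]] := large_degree hZ W hw w_pos nu0 r0 th0 B0.
pose n1 := (n0 + r)%N; have n10 : (0 < n1)%N by rewrite addn_gt0 r0 orbT.
have [D D0 hD] := degree_reduction r0 n10.
exists (C + D * C); first by rewrite addr_gt0 // mulr_gt0.
have weaken f n K K' P : K <= K' -> good_approximant w r nu0 n f K P -> good_approximant w r nu0 n f K' P.
  move=> KK [sP fP dP]; split => //.
    by apply: (ae_mono fP) => x hx xI; apply: le_trans (hx xI) KK.
  by move=> nu x nuI xI; apply: le_trans (dP nu x nuI xI) _; rewrite ler_wpM2r // exprn_ge0.
move=> f n Om hf rn Om0 hmod.
have n0R : 0 < n%:R :> R by rewrite ltr0n; exact: leq_trans rn.
have CO : 0 < C * Om by rewrite mulr_gt0.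
have DO : 0 < D * C * Om by rewrite -mulrA mulr_gt0.
have [nn|nn] := leqP n0 n.
  have [P hP] := hC f n Om hf nn Om0 hmod; exists P.
  by apply: weaken hP; rewrite mulrDl lerDl ltW.
have nn1 : (n <= n1)%N by rewrite ltnW // (leq_trans nn) // leq_addr.
have [P hP] : exists P, good_approximant w r nu0 n1 f (C * Om) P.
  apply: hC => //; first exact: leq_addr.
  apply: le_lt_trans hmod; apply: complete_modulus_le => //.
    by rewrite divr_gt0 // ltr0n.
  by rewrite ler_wpM2l ?(ltW th0) // lef_pV2 ?posrE ?ltr0n // ?ler_nat // (leq_trans r0).
have [q hq] := hD f (C * Om) P nu0 n CO rnu rn hP.
by exists q; apply: weaken hq; rewrite mulrDl mulrA lerDr ltW.
Qed.

End SmallDegree.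

Unset Implicit Arguments.

Theorem theorem6p1 (R : realType) (M : nat) (hM : (0 < M)%N)
  (Z : M.-tuple R) (hZ : in_ZM Z) (w : R -> R) (hw : Wstar Z w)
  (r : nat) (hr : (0 < r)%N) (theta : R) (htheta : 0 < theta) :
  exists2 N : nat, (0 < N)%N &
    forall (nu0 : nat) (B : R), (r <= nu0)%N -> 0 < B ->
    exists2 c : R, 0 < c &
      forall f : R -> R, Linf_w w f ->
      forall n : nat, (N <= n)%N ->
      exists2 P : {poly R}, (size P <= n)%N &
        (esup_norm (I11 R) (fun x => w x * (f x - P.[x]))%R
           <= c%:E * complete_modulus Z r f 1 B (theta / n%:R)%R w)%E /\
        (forall nu : nat, (r <= nu <= nu0)%N ->
           esup_norm (I11 R) (fun x => w x * phi x ^+ nu * P^`(nu).[x])%R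
             <= (c * n%:R ^+ nu)%R%:E
                * complete_modulus Z r f 1 B (theta / n%:R)%R w)%E.
Proof.
(* The threshold is [r] itself: for small [n] the approximants have degree less than [r]. *)
exists r => // nu0 B rnu B0.
have [L W] := Wstar_interval_weight hw; have [L1 wint0 _ wA _] := W.
(* The class contains the zero weight. A vanishing total integral forces [w = 0] on [[-1, 1]] by the
   A* inequality, and then every polynomial will do. *)
have [/eqP weq0|w_pos] : wint w (-1) 1 == 0 \/ 0 < wint w (-1) 1.
  by have := wint0 (-1) 1 (lexx _) (lexx _); rewrite le_eqVlt eq_sym => /orP[]; [left|right].
  exists 1 => // f _ n rn.
  have n0 : (0 < n)%N by exact: leq_trans rn.
  have mod0 := complete_modulus_ge0 (M := M) Z r f 1 B w (divr_gt0 htheta (_ : 0 < n%:R :> R)).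
  rewrite ltr0n in mod0; have {}mod0 := mod0 n0.
  have w00 x : I11 R x -> w x = 0.
    rewrite /I11 /= in_itv /= => xI; apply/eqP; rewrite eq_le.
    have [w0 _ _] := hw.1; rewrite w0 ?andbT; last by rewrite /I11 /= in_itv.
    have := wA (-1) 1 x (lexx _) ltac:(lra) (lexx _) xI; by rewrite weq0 mulr0.
  have zero (g : R -> R) : (esup_norm (I11 R) (fun x => w x * g x)%R <= 0)%E.
    by apply/esup_normP => //; apply: ae_all => x xI; rewrite w00 // mul0r normr0.
  exists 0; first by rewrite size_poly0.
  split; first by apply: le_trans (zero _) _; rewrite mule_ge0.
  move=> nu _; apply: (@le_trans _ _ 0%E).
    by have := zero (fun x => phi x ^+ nu * (0 : {poly R})^`(nu).[x]); under eq_fun do rewrite mulrA.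
  by rewrite mule_ge0 // lee_fin mulr_ge0 // exprn_ge0.
have [C C0 hC] := all_degrees hZ W hw w_pos hr rnu htheta B0.
(* The factor 2 gives room for the strict inequality between the modulus and [Om] in
   [all_degrees]. *)
exists (2 * C); first by rewrite mulr_gt0.
move=> f hf n rn.
have n0 : (0 < n)%N by exact: leq_trans rn.
have nR : 0 < n%:R :> R by rewrite ltr0n.
have mod0 := complete_modulus_ge0 Z r f 1 B w (divr_gt0 htheta nR).
have fromgood (K : R) P : 0 <= K -> good_approximant w r nu0 n f K P ->
  [/\ (size P <= n)%N, (esup_norm (I11 R) (fun x => w x * (f x - P.[x]))%R <= K%:E)%E &
   forall nu, (r <= nu <= nu0)%N ->
     (esup_norm (I11 R) (fun x => w x * phi x ^+ nu * P^`(nu).[x])%R <= (K * n%:R ^+ nu)%:E)%E].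
  move=> K0 [sP fP dP]; split => //; first exact/esup_normP.
  move=> nu nuI; apply/esup_normP; first by rewrite mulr_ge0 // exprn_ge0.
  by apply: ae_all => x xI; exact: dP.
(* For modulus zero every positive [Om] is admissible and the limit is taken; a positive finite
   modulus uses its double as [Om]; an infinite one makes both bounds trivial. *)
case E : (complete_modulus Z r f 1 B (theta / n%:R) w) mod0 => [Om||] //=.
- rewrite lee_fin le_eqVlt => /orP[/eqP Om0|Om0].
    have [P hP] : exists P, good_approximant w r nu0 n f 0 P.
      apply: (limit_approximant hZ W hw w_pos n0 (ltW C0)) => e e0.
      by apply: hC => //; rewrite E -Om0 lte_fin.
    have [sP fP dP] := fromgood 0 P (lexx _) hP.
    exists P => //; rewrite -Om0 mule0; split => // nu nuI.
    by rewrite mule0; have := dP nu nuI; rewrite mul0r.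
  have [P hP] : exists P, good_approximant w r nu0 n f (C * (2 * Om)) P.
    by apply: hC => //; [rewrite mulr_gt0|rewrite E lte_fin; lra].
  have [sP fP dP] := fromgood _ P (mulr_ge0 (ltW C0) (mulr_ge0 (ler0n _ 2) (ltW Om0))) hP.
  exists P => //; split => [|nu nuI].
    by apply: le_trans fP _; rewrite -EFinM lee_fin le_eqVlt; apply/orP; left; apply/eqP; ring.
  by apply: le_trans (dP nu nuI) _; rewrite -EFinM lee_fin le_eqVlt; apply/orP; left; apply/eqP; ring.
- move=> _; exists 0; first by rewrite size_poly0.
  have c0 : 0 < 2 * C by rewrite mulr_gt0.
  split => [|nu _]; rewrite gt0_muley ?leey // lte_fin // mulr_gt0 // exprn_gt0 //.
Qed.
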